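(* Let $\mathcal{I}\subset\mathbb{N}$ be a finite index set with $m=|\mathcal{I}|$ and let $u\in\mathcal{L}^2[0,\infty)$ be a scalar input. Let $(\hat{v},\hat{w})$ be the solution with $\hat{v}(0)=0$ of the stochastic Galerkin system $$\hat{E}\,\dot{\hat{v}}(t) = \hat{A}\hat{v}(t)+\hat{B}u(t), \qquad \hat{w}(t)=\hat{C}\hat{v}(t), \qquad t\ge 0,$$ associated with $\mathcal{I}$, and let $(\bar{v},\bar{w})$ be the solution with $\bar{v}(0)=0$ of a reduced system $$\bar{E}\,\dot{\bar{v}}(t) = \bar{A}\bar{v}(t)+\bar{B}u(t), \qquad \bar{w}(t)=\bar{C}\bar{v}(t), \qquad t\ge 0,$$ with $\bar{A},\bar{E}\in\mathbb{R}^{r\times r}$, $\bar{B}\in\mathbb{R}^{r}$, $\bar{C}\in\mathbb{R}^{m\times r}$, so that it has the same number $m$ of outputs. Let $\hat{H}=(\hat{H}_i)_{i\in\mathcal{I}}$ and $\bar{H}=(\bar{H}_i)_{i\in\mathcal{I}}$ be the transfer functions $\hat{H}(s)=\hat{C}(s\hat{E}-\hat{A})^{-1}\hat{B}$ and $\bar{H}(s)=\bar{C}(s\bar{E}-\bar{A})^{-1}\bar{B}$, and define $$\hat{y}^{(\mathcal{I})}(t,p)=\sum_{i\in\mathcal{I}}\hat{w}_i(t)\Phi_i(p), \qquad \bar{y}^{(\mathcal{I})}(t,p)=\sum_{i\in\mathcal{I}}\bar{w}_i(t)\Phi_i(p).$$ Suppose that both systems are stable. (i) If the norms $\|\hat{H}_i-\bar{H}_i\|_{\mathcal{H}_2}$,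 $i\in\mathcal{I}$, are finite, then $$\sup_{t\ge 0}\left\|\hat{y}^{(\mathcal{I})}(t,\cdot)-\bar{y}^{(\mathcal{I})}(t,\cdot)\right\|_{\mathcal{L}^2(\Omega)} \le \sqrt{\sum_{i\in\mathcal{I}}\left\|\hat{H}_i-\bar{H}_i\right\|_{\mathcal{H}_2}^2}\;\;\|u\|_{\mathcal{L}^2[0,\infty)} .$$ (ii) If the norms $\|\hat{H}_i-\bar{H}_i\|_{\mathcal{H}_\infty}$, $i\in\mathcal{I}$, are finite, then $$\left\|\hat{y}^{(\mathcal{I})}-\bar{y}^{(\mathcal{I})}\right\|_{\mathcal{L}^2(\Omega)\times\mathcal{L}^2[0,\infty)} \le \sqrt{\sum_{i\in\mathcal{I}}\left\|\hat{H}_i-\bar{H}_i\right\|_{\mathcal{H}_\infty}^2}\;\;\|u\|_{\mathcal{L}^2[0,\infty)} .$$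
   Context: Random parameters. $\Pi \subseteq \mathbb{R}^q$ is the parameter domain and $\rho : \Pi \to \mathbb{R}$ a probability density. $\mathcal{L}^2(\Pi,\rho)$ is the Hilbert space of measurable $f:\Pi\to\mathbb{R}$ with $\mathbb{E}[f^2]<\infty$, where $\mathbb{E}[f] = \int_\Pi f(p)\rho(p)\,dp$, with inner product $\langle f,g\rangle = \mathbb{E}[fg]$ and norm $\|f\|_{\mathcal{L}^2(\Omega)} = \sqrt{\langle f,f\rangle}$. $(\Phi_i)_{i\in\mathbb{N}} \subset \mathcal{L}^2(\Pi,\rho)$ is a complete orthonormal system with $\Phi_1 \equiv 1$. Underlying system. For each $p\in\Pi$ there is a single-input-single-output linear system $E(p)\dot{x}(t,p) = A(p)x(t,p)+B(p)u(t)$, $y(t,p)=C(p)x(t,p)$, $x(0,p)=0$, with $A(p),E(p)\in\mathbb{R}^{n\times n}$ ($E(p)$ possibly singular), $B(p)\in\mathbb{R}^{n\times 1}$, $C(p)\in\mathbb{R}^{1\times n}$; the pencil $\lambda E(p)-A(p)$ is regular and all its finite eigenvalues have negative real part, for every $p \in \Pi$. Stochastic Galerkin system. For a finite index set $\mathcal{I}$ with $m=|\mathcal{I}|$, the constant matrices $\hat{A},\hat{E}\in\mathbb{R}^{mn\times mn}$, $\hat{B}\in\mathbb{R}^{mn}$, $\hat{C}\in\mathbb{R}^{m\times mn}$ are obtained by Galerkin projection: they consist of blocks indexed by $i,j\in\mathcal{I}$, the $(i,j)$ blocks of $\hat{A},\hat{E},\hat{C}$ being $\mathbb{E}[\Phi_i\Phi_j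 A]$, $\mathbb{E}[\Phi_i\Phi_j E]$, $\mathbb{E}[\Phi_i\Phi_j C]$ and the $i$-th block of $\hat{B}$ being $\mathbb{E}[\Phi_i B]$ (expectations taken entrywise and assumed to exist). The state is $\hat{v}(t)\in\mathbb{R}^{mn}$, the output $\hat{w}(t)\in\mathbb{R}^m$. Outputs and transfer function components of both systems are indexed by $i\in\mathcal{I}$. The pencils $\lambda\hat{E}-\hat{A}$ and $\lambda\bar{E}-\bar{A}$ are regular, so that the transfer functions are vectors of rational functions defined outside finite sets of poles. Stability. A linear system is stable if all finite eigenvalues of its matrix pencil have negative real part. Norms. For a scalar transfer function $G$, $\|G\|_{\mathcal{H}_\infty} = \sup_{\omega\in\mathbb{R}} |G(\mathrm{i}\omega)|$ and $\|G\|_{\mathcal{H}_2} = \sqrt{\frac{1}{2\pi}\int_{-\infty}^{\infty} |G(\mathrm{i}\omega)|^2\,d\omega}$. Further, $\|u\|_{\mathcal{L}^2[0,\infty)} = \sqrt{\int_0^\infty u(t)^2\,dt}$ and $\|z\|_{\mathcal{L}^2(\Omega)\times\mathcal{L}^2[0,\infty)} = \sqrt{\int_0^\infty\int_\Pi z(t,p)^2\rho(p)\,dp\,dt}$. *)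

(* Defs.v *)
From HB Require Import structures.
From mathcomp Require Import all_boot all_order all_algebra.
From mathcomp Require Import finmap complex.
From mathcomp Require Import all_classical all_reals all_analysis.

Set Implicit Arguments.
Unset Strict Implicit.
Unset Printing Implicit Defensive.

Import Order.TTheory GRing.Theory Num.Theory.
Import numFieldNormedType.Exports.

Local Open Scope classical_set_scope.
Local Open Scope ring_scope.
Local Open Scope complex_scope.

(* R^q is represented by q-tuples with the product (Borel) sigma-algebra. *)
Notation Rvec R q := (q.-tuple (measurableTypeR R)).

Section LebesgueTuple.
Context (R : realType).

Local Notation T := (measurableTypeR R).

Definition tuple_cons (q : nat) (z : T * q.-tuple T) : q.+1.-tuple T :=
  [tuple of z.1 :: z.2].

Definition tuple_uncons (q : nat) (x : q.+1.-tuple T) : T * q.-tuple T :=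
  (tnth x ord0, [tuple of behead x]).

Lemma measurable_tuple_cons q : measurable_fun setT (@tuple_cons q).
Proof. by apply: measurable_cons. Qed.

Lemma measurable_tuple_uncons q : measurable_fun setT (@tuple_uncons q).
Proof.
apply: measurable_fun_pair; last exact: measurable_behead.
exact: measurable_tnth.
Qed.

Lemma tuple_consK q : cancel (@tuple_cons q) (@tuple_uncons q).
Proof.
by case=> x t; congr pair; apply/val_inj.
Qed.

Section Step.
Context (q : nat) (mu : {sigma_finite_measure set (q.-tuple T) -> \bar R}).

Definition lebesgue_tupleS : set (q.+1.-tuple T) -> \bar R :=
  pushforward (@lebesgue_measure R \x mu)%E (@tuple_cons q).

Let mT : measurable_fun setT (@tuple_cons q) := @measurable_tuple_cons q.

Let lebesgue_tupleS0 : lebesgue_tupleS set0 = 0%E.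
Proof. by rewrite /lebesgue_tupleS /pushforward preimage_set0 measure0. Qed.

Let lebesgue_tupleS_ge0 A : (0 <= lebesgue_tupleS A)%E.
Proof. exact: measure_ge0. Qed.

Let lebesgue_tupleS_sigma_additive : semi_sigma_additive lebesgue_tupleS.
Proof. exact: (@measure_semi_sigma_additive _ _ _ (measure_function_pushforward__canonical__measure_function_Measure (@lebesgue_measure R \x mu)%E mT)). Qed.

HB.instance Definition _ := isMeasure.Build _ _ _ lebesgue_tupleS
  lebesgue_tupleS0 lebesgue_tupleS_ge0 lebesgue_tupleS_sigma_additive.

Let lebesgue_tupleS_sigma_finite : sigma_finite setT lebesgue_tupleS.
Proof.
have /sigma_finiteP[F [TF ndF Foo]] := sigma_finiteT (@lebesgue_measure R).
have /sigma_finiteP[G [TG ndG Goo]] := sigma_finiteT mu.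
exists (fun n => @tuple_uncons q @^-1` (F n `*` G n)).
  rewrite -preimage_bigcup (_ : \bigcup_i _ = setT) ?preimage_setT//.
  apply/seteqP; split => // -[x y] _.
  have [n _ Fnx] : (\bigcup_i F i) x by rewrite -TF.
  have [k _ Gky] : (\bigcup_i G i) y by rewrite -TG.
  exists (maxn n k) => //; split.
  - by move: x Fnx; exact/subsetPset/ndF/leq_maxl.
  - by move: y Gky; exact/subsetPset/ndG/leq_maxr.
move=> n; have [mF Fn] := Foo n; have [mG Gn] := Goo n.
have mFG : measurable (F n `*` G n) by exact: measurableX.
split.
  by rewrite -[X in measurable X]setTI; exact: measurable_tuple_uncons.
rewrite /lebesgue_tupleS /pushforward -comp_preimage.
rewrite (_ : _ \o _ = id); last by apply/funext => z /=; rewrite tuple_consK.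
by rewrite preimage_id product_measure1E// lte_mul_pinfty// ge0_fin_numE.
Qed.

HB.instance Definition _ := Measure_isSigmaFinite.Build _ _ _ lebesgue_tupleS
  lebesgue_tupleS_sigma_finite.

End Step.

(* Lebesgue measure on R^q: the q-fold product of lebesgue_measure. *)
Fixpoint lebesgue_tuple (q : nat) :
    {sigma_finite_measure set (q.-tuple T) -> \bar R} :=
  match q with
  | 0%N => dirac ([tuple] : 0.-tuple T)
  | q'.+1 => lebesgue_tupleS (lebesgue_tuple q')
  end.

End LebesgueTuple.

Section ParameterSpace.
Context (R : realType) (q : nat) (Pi : set (Rvec R q)) (rho : Rvec R q -> R).

(* The values of rho outside Pi are irrelevant. *)
Definition probability_density : Prop :=
  [/\ measurable_fun Pi rho, (forall p, Pi p -> 0 <= rho p) &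
      (\int[@lebesgue_tuple R q]_(p in Pi) (rho p)%:E = 1)%E].

Definition has_expectation (f : Rvec R q -> R) : Prop :=
  (@lebesgue_tuple R q).-integrable Pi (EFin \o (fun p => f p * rho p)).

Definition expectation_rho (f : Rvec R q -> R) : R :=
  \int[@lebesgue_tuple R q]_(p in Pi) (f p * rho p).

Definition sq_expectation (f : Rvec R q -> R) : \bar R :=
  (\int[@lebesgue_tuple R q]_(p in Pi) (f p ^+ 2 * rho p)%:E)%E.

Definition in_L2rho (f : Rvec R q -> R) : Prop :=
  measurable_fun Pi f /\ (sq_expectation f < +oo)%E.

Definition L2rho_norm (f : Rvec R q -> R) : \bar R := sqrte (sq_expectation f).

Definition inner_L2rho (f g : Rvec R q -> R) : R :=
  expectation_rho (fun p => f p * g p).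

(* Complete: only the zero vector of L2 is orthogonal to the whole family. *)
Definition complete_orthonormal_system (Phi : nat -> Rvec R q -> R) : Prop :=
  [/\ forall i, in_L2rho (Phi i),
      forall i j, inner_L2rho (Phi i) (Phi j) = (i == j)%:R &
      forall f, in_L2rho f -> (forall i, inner_L2rho f (Phi i) = 0) ->
        L2rho_norm f = 0%E].

Definition mx_has_expectation (a b : nat) (M : Rvec R q -> 'M[R]_(a, b)) :=
  forall k l, has_expectation (fun p => M p k l).

Definition mx_expectation (a b : nat) (M : Rvec R q -> 'M[R]_(a, b)) :
    'M[R]_(a, b) :=
  \matrix_(k < a, l < b) expectation_rho (fun p => M p k l).

(* ||z|| in L2(Omega) x L2[0,oo) *)
Definition L2L2_norm (z : R -> Rvec R q -> R) : \bar R :=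
  sqrte (\int[@lebesgue_measure R]_(t in `[0%R, +oo[)
           \int[@lebesgue_tuple R q]_(p in Pi) (z t p ^+ 2 * rho p)%:E)%E.

End ParameterSpace.

Section TimeL2.
Context (R : realType).

Definition L2time_norm (u : R -> R) : \bar R :=
  sqrte (\int[@lebesgue_measure R]_(t in `[0%R, +oo[) (u t ^+ 2)%:E)%E.

Definition in_L2time (u : R -> R) : Prop :=
  measurable_fun (`[0, +oo[ : set (measurableTypeR R)) u /\
  (L2time_norm u < +oo)%E.

End TimeL2.

(* E x' = A x + B u, y = C x, with N states, one input and m outputs; E may be
   singular. *)
Record descriptor_system (R : Type) (N m : nat) := DescriptorSystem {
  sysE : 'M[R]_N;
  sysA : 'M[R]_N;
  sysB : 'cV[R]_N;
  sysC : 'M[R]_(m, N)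
}.

Section Systems.
Context (R : realType) (N m : nat) (S : descriptor_system R N m).

Definition complex_mx (a b : nat) (M : 'M[R]_(a, b)) : 'M[R[i]]_(a, b) :=
  map_mx (real_complex R) M.

Definition pencil (s : R[i]) : 'M[R[i]]_N :=
  s *: complex_mx (sysE S) - complex_mx (sysA S).

Definition regular_pencil : Prop := exists s : R[i], \det (pencil s) != 0.

Definition finite_eigenvalue (s : R[i]) : Prop := \det (pencil s) = 0.

Definition stable_system : Prop :=
  forall s, finite_eigenvalue s -> complex.Re s < 0.

(* Only meaningful where the pencil is invertible: invmx is the identity
   function on singular matrices. *)
Definition transfer (s : R[i]) : 'cV[R[i]]_m :=
  complex_mx (sysC S) *m invmx (pencil s) *m complex_mx (sysB S).

(* f is locally absolutely continuous on [0,oo), with derivative f' a.e. *)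
Definition locally_AC_with_derivative (f f' : R -> R) : Prop :=
  forall t, 0 <= t ->
    (@lebesgue_measure R).-integrable `[0, t] (EFin \o f') /\
    f t = f 0 + \int[@lebesgue_measure R]_(s in `[0, t]) f' s.

(* Solution of the initial value problem for an input u that is only defined
   up to null sets: v is continuous, E v is locally absolutely continuous, and
   (E v)' = A v + B u almost everywhere.  As usual for differential-algebraic
   equations, only E v is differentiated, since components of v in the kernel
   of E need not be differentiable; every locally absolutely continuous v with
   E v' = A v + B u a.e. is a solution in this sense. *)
Definition is_solution (u : R -> R) (v : R -> 'cV[R]_N) (w : R -> 'cV[R]_m) :
    Prop :=
  [/\ v 0 = 0,
      forall k, {within `[0, +oo[, continuous (fun t : R => v t k ord0 : R)},
      exists2 Ev' : R -> 'cV[R]_N,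
        forall k, locally_AC_with_derivative
          (fun t => (sysE S *m v t) k ord0) (fun t => Ev' t k ord0) &
        {ae @lebesgue_measure R, forall t, 0 <= t ->
          Ev' t = sysA S *m v t + u t *: sysB S} &
      forall t, 0 <= t -> w t = sysC S *m v t].

End Systems.

Section HardyNorms.
Context (R : realType).
Local Open Scope ereal_scope.

Definition Hinf_norm (G : R[i] -> R[i]) : \bar R :=
  ereal_sup [set (Normc.normc (G (0 +i* omega)%C))%:E | omega in [set: R]].

Definition H2_norm (G : R[i] -> R[i]) : \bar R :=
  sqrte ((2 * pi)^-1%:E *
    \int[@lebesgue_measure R]_omega
      (Normc.normc (G (0 +i* omega)%C) ^+ 2)%:E).

End HardyNorms.

Section StochasticGalerkin.
Context (R : realType) (q n : nat) (Pi : set (Rvec R q)) (rho : Rvec R q -> R).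
Context (Phi : nat -> Rvec R q -> R) (S : Rvec R q -> descriptor_system R n 1).
Context (I : {fset nat}).

(* The members of I, numbered by 'I_#|I|; block and output number k belongs to
   the function basis_fun k. *)
Definition basis_fun (k : 'I_#|` I|) : Rvec R q -> R :=
  Phi (nth 0%N (enum_fset I) k).

Local Notation m := #|` I|.
Local Notation E_ := (mx_expectation Pi rho).
Local Notation wE i j p := (basis_fun i p * basis_fun j p).

Definition galerkin_expectations_exist : Prop :=
  forall i j : 'I_m,
  [/\ mx_has_expectation Pi rho (fun p => wE i j p *: sysA (S p)),
      mx_has_expectation Pi rho (fun p => wE i j p *: sysE (S p)),
      mx_has_expectation Pi rho (fun p => wE i j p *: sysC (S p)) &
      mx_has_expectation Pi rho (fun p => basis_fun i p *: sysB (S p))].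

(* The (i, j) block of C is a single row: the i-th row of the j-th block
   column. *)
Definition galerkin_system : descriptor_system R (\sum_(i < m) n)%N m :=
  DescriptorSystem
    (\mxblock_(i < m, j < m) E_ (fun p => wE i j p *: sysE (S p)))
    (\mxblock_(i < m, j < m) E_ (fun p => wE i j p *: sysA (S p)))
    (\mxcol_(i < m) E_ (fun p => basis_fun i p *: sysB (S p)))
    (\mxrow_(j < m) \matrix_(i < m, l < n)
        E_ (fun p => wE i j p *: sysC (S p)) ord0 l).

Definition expansion (w : R -> 'cV[R]_m) (t : R) (p : Rvec R q) : R :=
  \sum_(i < m) w t i ord0 * basis_fun i p.

End StochasticGalerkin.

(* Main.v *)
Require Import Defs.
From HB Require Import structures.
From mathcomp Require Import all_boot all_order all_algebra.
From mathcomp Require Import finmap complex.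
From mathcomp Require Import all_classical all_reals all_analysis.
From mathcomp Require Import perm measurable_realfun zify ring lra.

Set Implicit Arguments.
Unset Strict Implicit.
Unset Printing Implicit Defensive.

Import Order.TTheory GRing.Theory Num.Theory.
Import numFieldNormedType.Exports.

Local Open Scope classical_set_scope.
Local Open Scope ring_scope.

(** Write J f t for the integral of f over [0, t].  A solution of
    E v' = A v + B u with v 0 = 0 satisfies E v = J (A v + B u), which is an
    identity between polynomials in the operator J.  Multiplying it by the
    adjugate of E - x A turns it into the scalar relations d(J) w_i = e_i(J) u
    with the real polynomials d = det (E - x A) and
    e_i = x C_i adj (E - x A) B.  Here x stands for 1 / s, so that the transfer
    function is e_i (1 / s) / d (1 / s); a singular E merely makes 0 a root of
    d ([output_rpol], [transfer_imag]).  The difference y_i of two outputs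
    satisfies a relation of the same kind, whose d is the product of both
    determinants.  By stability, its roots other than 0 have negative real
    part, and e_i has at most the degree of d.

    Finiteness of the norm of e_i / d makes the power of x dividing d divide
    e_i as well, and one power more in the case of the H2 norm
    ([bounded_cancel], [integrable_cancel]).  Powers of J are injective up to
    null sets, so these factors cancel.  The remaining d is a product of
    factors 1 - l x with Re l < 0.  Each factor is invertible at J, by
    variation of constants, and its inverse preserves square integrability, by
    an energy estimate.  Hence u = d(J) z, where z, J z, ..., J^n z are square
    integrable for n the degree of d ([res_wsq]), and y_i = e_i(J) z.

    For (ii) it has to be shown that |e| <= g |d| on the imaginary axis gives
    a bound of the integral of (e(J) z)^2 by g^2 times that of (d(J) z)^2.
    Integration by parts makes J antisymmetric, so the integral of (p(J) z)^2
    is a linear functional of p(x) p(-x).  For c > g^2 the polynomial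
    c d(x) d(-x) - e(x) e(-x) is positive on the imaginary axis.  Pairing its
    roots writes it as a sum of two terms q(x) q(-x), on which that functional
    is nonnegative ([even_part_sos], [gain_bound]).

    For (i), e_i = x f, the function eta with d(J) eta = 1 gives the impulse
    response h = f(J) eta, and y_i T is the integral of h (T - s) u(s) over
    [0, T] because polynomials in J move across a convolution
    ([convol_rpol]).  The Cauchy-Schwarz inequality bounds (y_i T)^2 by the
    integral of h^2 times that of u^2.  Since h decays exponentially, its
    Fourier transform exists and equals e_i / d, and the integral of h^2 is
    controlled by that of |e_i / d|^2 ([parseval_le], [impulse_response]).

    Finally the Phi_i are orthonormal, so the squared norm in the parameter is
    the sum of the y_i t ^+ 2 ([sq_expectation_combination]). *)

(** * Integrals from 0 to t of locally integrable functions *)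

Section RealIntegral.
Context {R : realType}.
Notation mu := (@lebesgue_measure R).
Notation T := (measurableTypeR R).
Implicit Types (f g : R -> R) (k : T * T -> R).

Definition summable_on (A : set R) f := mu.-integrable A (EFin \o f).

Lemma summable_onD A f g : measurable A -> summable_on A f -> summable_on A g ->
  summable_on A (fun x => f x + g x).
Proof. by move=> mA; exact: integrableD. Qed.

Lemma summable_onZ A c f : measurable A -> summable_on A f ->
  summable_on A (fun x => c * f x).
Proof. by move=> mA; exact: integrableZl. Qed.

Lemma summable_on_measurable A f : summable_on A f -> measurable_fun A f.
Proof. by move=> /measurable_int /measurable_EFinP. Qed.

Lemma summable_on_le A f g : measurable A -> measurable_fun A f ->
  (forall x, A x -> `|f x| <= `|g x|) -> summable_on A g -> summable_on A f.
Proof.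
move=> mA mf fg; apply: le_integrable => //; exact/measurable_EFinP.
Qed.

Lemma summable_onM A f g M : measurable A -> summable_on A f ->
  measurable_fun A g -> (forall x, A x -> `|g x| <= M) ->
  summable_on A (fun x => f x * g x).
Proof.
move=> mA fi mg gM.
apply: (@summable_on_le _ _ (fun x => M * f x)) => //.
- by apply: measurable_funM => //; exact: summable_on_measurable.
- move=> x Ax; rewrite !normrM mulrC ler_wpM2r //.
  by rewrite (le_trans (gM x Ax)) // ler_norm.
- exact: summable_onZ.
Qed.

(** The kernel k is bounded by 1, so f(x) g(y) k(x, y) is dominated by the
    integrable |f(x)| |g(y)|. *)
Lemma Rfubini f g k : summable_on setT f -> summable_on setT g ->
  measurable_fun setT k -> (forall z, `|k z| <= 1) ->
  \int[mu]_x (f x * \int[mu]_y (g y * k (x, y))) =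
  \int[mu]_y (g y * \int[mu]_x (f x * k (x, y))).
Proof.
move=> fi gi mk k1.
have mf := summable_on_measurable fi; have mg := summable_on_measurable gi.
pose F (z : T * T) := ((f z.1 * g z.2 * k z)%:E).
have mF : measurable_fun setT F.
  apply/measurable_EFinP; apply: measurable_funM => //; apply: measurable_funM.
    exact: (measurableT_comp mf).
  exact: (measurableT_comp mg).
have gk x : summable_on setT (fun y => g y * k (x, y)).
  by apply: (@summable_onM _ _ _ 1) => //; exact: measurableT_comp.
have fk y : summable_on setT (fun x => f x * k (x, y)).
  by apply: (@summable_onM _ _ _ 1) => //; exact: measurableT_comp.
have Fi : (mu \x mu)%E.-integrable setT F.
  apply/integrable12ltyP => //.
  apply: (@le_lt_trans _ _ (\int[mu]_x ((\int[mu]_y `|g y|) * `|f x|)%:E)%E).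
    apply: ge0_le_integral => //=.
    - by move=> x _; exact: integral_ge0.
    - have h : measurable_fun setT (abse \o F) by exact: measurableT_comp.
      have := @measurable_fun_fubini_tonelli_F _ _ _ _ _ mu (abse \o F) h.
      by rewrite /fubini_F /F /=; apply.
    - by apply/measurable_EFinP; apply: measurable_funM => //; exact: measurableT_comp.
    - move=> x _.
      have ig : summable_on setT (fun y => `|f x| * `|g y|).
        by apply: summable_onZ => //; exact: (integrable_norm gi).
      rewrite mulrC -RintegralZl//; last exact: (integrable_norm gi).
      rewrite /Rintegral fineK; last exact: (integrable_fin_num _ ig).
      apply: ge0_le_integral => //=.
      + apply/measurable_EFinP; apply: measurableT_comp => //.
        under eq_fun do rewrite -mulrA.
        exact: (summable_on_measurable (summable_onZ (f x) measurableT (gk x))).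
      + exact: measurable_int ig.
      + move=> y _; rewrite lee_fin !normrM ler_piMr//.
  apply: integrable_lty => //.
  by apply: summable_onZ => //; exact: (integrable_norm fi).
have e1 : (\int[mu]_x \int[mu]_y F (x, y) =
    \int[mu]_x (f x * \int[mu]_y (g y * k (x, y)))%:E)%E.
  apply: eq_integral => x _.
  have <- : \int[mu]_y (f x * (g y * k (x, y))) = f x * \int[mu]_y (g y * k (x, y)).
    by rewrite RintegralZl//; exact: gk.
  rewrite /Rintegral fineK.
    by apply: eq_integral => y _; rewrite /F /= mulrA.
  by apply: integrable_fin_num => //; exact: summable_onZ.
have e2 : (\int[mu]_y \int[mu]_x F (x, y) =
    \int[mu]_y (g y * \int[mu]_x (f x * k (x, y)))%:E)%E.
  apply: eq_integral => y _.
  have <- : \int[mu]_x (g y * (f x * k (x, y))) = g y * \int[mu]_x (f x * k (x, y)).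
    by rewrite RintegralZl//; exact: fk.
  rewrite /Rintegral fineK.
    by apply: eq_integral => x _; rewrite /F /= mulrA [X in X * _]mulrC.
  by apply: integrable_fin_num => //; exact: summable_onZ.
by rewrite /Rintegral -e1 -e2 Fubini.
Qed.

Lemma measurable_Rparam g k : summable_on setT g ->
  measurable_fun setT k -> (forall z, `|k z| <= 1) ->
  measurable_fun setT (fun x : T => \int[mu]_y (g y * k (x, y))).
Proof.
move=> gi mk k1; have mg := summable_on_measurable gi.
pose F (z : T * T) := ((g z.2 * k z)%:E).
have mF : measurable_fun setT F.
  apply/measurable_EFinP; apply: measurable_funM => //.
  exact: (measurableT_comp mg).
pose Fp x := (\int[mu]_y F^\+ (x, y))%E.
pose Fn x := (\int[mu]_y F^\- (x, y))%E.
have mFp : measurable_fun (setT : set T) Fp.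
  have h : measurable_fun setT F^\+%E by exact: measurable_funepos.
  by have := @measurable_fun_fubini_tonelli_F _ _ _ _ _ mu _ h; apply.
have mFn : measurable_fun (setT : set T) Fn.
  have h : measurable_fun setT F^\-%E by exact: measurable_funeneg.
  by have := @measurable_fun_fubini_tonelli_F _ _ _ _ _ mu _ h; apply.
rewrite (_ : (fun x => _) = fine \o (Fp \- Fn)%E).
  apply: measurableT_comp => //.
  exact: emeasurable_funB.
apply/funext => x; rewrite /Rintegral integralE /=.
by rewrite /Fp /Fn; congr (fine (_ - _)%E); apply: eq_integral => y _; rewrite ?funeposE ?funenegE.
Qed.

Lemma measurable_ltr_pair : measurable_fun setT (fun z : T * T => (z.1 < z.2)%R).
Proof. by apply: measurable_fun_ltr. Qed.

(** The operator J of integration from 0; [prim f t] is 0 for t < 0, because the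
    interval is then empty. *)
Definition prim f t := \int[mu]_(s in `[0, t]) f s.
Definition locint f := forall t, summable_on `[0, t] f.
Definition cont0 f := forall t, {within `[0, t], continuous f}.

Lemma prim_lt0 f t : t < 0 -> prim f t = 0.
Proof.
by move=> t0; rewrite /prim set_itv_ge ?Rintegral_set0// bnd_simp -ltNge.
Qed.

Lemma prim0 f : prim f 0 = 0.
Proof. by rewrite /prim set_itv1 Rintegral_set1. Qed.

Lemma eq_prim f g t : (forall s, 0 <= s <= t -> f s = g s) ->
  prim f t = prim g t.
Proof.
move=> fg; apply: eq_Rintegral => s; rewrite inE/= in_itv/=.
by move=> /fg.
Qed.

Lemma locintD f g : locint f -> locint g -> locint (fun x => f x + g x).
Proof. by move=> fi gi t; exact: summable_onD. Qed.

Lemma locintZ c f : locint f -> locint (fun x => c * f x).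
Proof. by move=> fi t; exact: summable_onZ. Qed.

Lemma primD f g t : locint f -> locint g ->
  prim (fun x => f x + g x) t = prim f t + prim g t.
Proof. by move=> fi gi; rewrite /prim RintegralD//; [exact: fi|exact: gi]. Qed.

Lemma primZ c f t : locint f -> prim (fun x => c * f x) t = c * prim f t.
Proof. by move=> fi; rewrite /prim RintegralZl//; exact: fi. Qed.

Lemma cont0_locint f : cont0 f -> locint f.
Proof.
move=> cf t; apply: continuous_compact_integrable => //.
exact: segment_compact.
Qed.

Lemma cont0_bounded f t : cont0 f ->
  exists M, forall s, s \in `[0, t] -> `|f s| <= M.
Proof.
move=> cf; have [t0|t0] := ltP t 0.
  exists 0 => s; rewrite in_itv/= => /andP[s0 st].
  by have := le_lt_trans (le_trans s0 st) t0; rewrite ltxx.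
have cn : {within `[0, t], continuous (fun x => `|f x|)}.
  by move=> x; apply: cvg_comp; [exact: cf|exact: norm_continuous].
have [c _ cM] := EVT_max t0 cn.
by exists `|f c|.
Qed.

Lemma locintM f g : locint f -> cont0 g -> locint (fun x => f x * g x).
Proof.
move=> fi cg t; have [M gM] := cont0_bounded t cg.
apply: (@summable_onM _ _ _ M) => //.
  exact: (summable_on_measurable (cont0_locint cg t)).
Qed.

Lemma cont0_prim f : locint f -> cont0 (prim f).
Proof.
move=> fi t; have [t0|t0] := ltP t 0; last first.
  exact: (parameterized_integral_continuous t0 (fi t)).
rewrite set_itv_ge ?bnd_simp -?ltNge//; exact: continuous_subspace0.
Qed.

Lemma cont0D f g : cont0 f -> cont0 g -> cont0 (fun x => f x + g x).
Proof. by move=> cf cg t x; apply: cvgD; [exact: cf|exact: cg]. Qed.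

Lemma cont0M f g : cont0 f -> cont0 g -> cont0 (fun x => f x * g x).
Proof. by move=> cf cg t x; apply: cvgM; [exact: cf|exact: cg]. Qed.

Lemma cont0_cst c : cont0 (fun=> c).
Proof. by move=> t x; exact: cvg_cst. Qed.

Lemma cont0_continuous f : continuous f -> cont0 f.
Proof. by move=> cf t; exact: continuous_subspaceT. Qed.

Lemma prim_tail f s t : locint f -> 0 <= s <= t ->
  \int[mu]_(x in `]s, t]) f x = prim f t - prim f s.
Proof.
move=> fi /andP[s0 st]; rewrite /prim Rintegral_itvB//; exact: fi.
Qed.

(** Integration by parts for merely integrable f and g: Fubini on the square [0,
    t] x [0, t], cut along the diagonal. *)
Lemma primM f g t : locint f -> locint g ->
  prim f t * prim g t = prim (fun s => f s * prim g s + g s * prim f s) t.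
Proof.
move=> fi gi.
have [t0|t0] := ltP t 0; first by rewrite !prim_lt0// mulr0.
have fp := locintM fi (cont0_prim gi); have gp := locintM gi (cont0_prim fi).
pose k (z : T * T) : R := if ((z.1 : R) < z.2)%R then 1 else 0.
have mk : measurable_fun setT k.
  by apply: measurable_fun_ifT => //; exact: measurable_ltr_pair.
have k1 z : `|k z| <= 1 by rewrite /k; case: ifP => _; rewrite ?normr1 ?normr0.
have fT : summable_on setT (f \_ `[0, t]).
  have := (@integrable_mkcond _ _ _ mu `[0, t] (EFin \o f) _).1.
  by rewrite restrict_EFin; apply => //; exact: (fi t).
have gT : summable_on setT (g \_ `[0, t]).
  have := (@integrable_mkcond _ _ _ mu `[0, t] (EFin \o g) _).1.
  by rewrite restrict_EFin; apply => //; exact: (gi t).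
have := Rfubini fT gT mk k1.
have -> : \int[mu]_x ((f \_ `[0, t]) x *
    \int[mu]_y ((g \_ `[0, t]) y * k (x, y))) =
    prim (fun s => f s * (prim g t + - 1 * prim g s)) t.
  rewrite /prim [RHS]Rintegral_mkcond; apply: eq_Rintegral => x _.
  rewrite [in LHS]patchE [in RHS]patchE.
  case: ifPn => [|_]; last by rewrite mul0r.
  rewrite inE/= in_itv/= => /andP[x0 xt]; congr (_ * _).
  rewrite mulN1r -prim_tail ?x0// [RHS]Rintegral_mkcond; apply: eq_Rintegral => y _.
  rewrite !patchE /k/= !mem_setE !in_itv/=.
  have [xy|yx] := ltP x y; last by rewrite mulr0.
  by rewrite (le_trans x0 (ltW xy))/= mulr1.
have -> : \int[mu]_y ((g \_ `[0, t]) y *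
    \int[mu]_x ((f \_ `[0, t]) x * k (x, y))) =
    prim (fun s => g s * prim f s) t.
  rewrite /prim [RHS]Rintegral_mkcond; apply: eq_Rintegral => y _.
  rewrite [in LHS]patchE [in RHS]patchE.
  case: ifPn => [|_]; last by rewrite mul0r.
  rewrite inE/= in_itv/= => /andP[y0 yt]; congr (_ * _).
  rewrite -Rintegral_itv_bndo_bndc; last first.
    apply: (integrableS _ _ _ (fi y)) => //.
    by apply: subset_itvl; rewrite bnd_simp.
  rewrite [RHS]Rintegral_mkcond; apply: eq_Rintegral => x _.
  rewrite !patchE /k/= !mem_setE !in_itv/=.
  have [xy|yx] := ltP x y; last by rewrite mulr0 andbF.
  by rewrite (le_trans (ltW xy) yt) !andbT/= mulr1.
rewrite primD// => <-.
under [X in _ + X]eq_prim do rewrite mulrDr mulrC mulrCA.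
rewrite primD; [|exact: locintZ|exact: locintZ].
by rewrite !primZ// mulN1r subrKC mulrC.
Qed.

End RealIntegral.

(** * Integrals and square-integrable functions on the half-line *)

Section Improper.
Context {R : realType}.
Notation mu := (@lebesgue_measure R).
Notation T := (measurableTypeR R).
Notation half := (`[0%R, +oo[%classic : set R).
Implicit Types (f g : R -> R).

Lemma summable_onS (A B : set R) f : measurable A -> measurable B -> B `<=` A ->
  summable_on A f -> summable_on B f.
Proof. by move=> mA mB BA; exact: integrableS. Qed.

Lemma half_bigcup : half = \bigcup_n (`[0%R, n%:R]%classic : set R).
Proof.
rewrite itv_bndy_bigcup_BRight; apply: eq_bigcupr => n _.
by rewrite add0r.
Qed.

Lemma measurable_half f : (forall t : R, measurable_fun (`[0, t] : set T) f) ->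
  measurable_fun half f.
Proof. move=> mf; rewrite half_bigcup; apply: (measurable_fun_bigcup f _).2 => //.
by move=> i; exact: mf. Qed.

Lemma locint_measurable_half f : locint f -> measurable_fun half f.
Proof.
by move=> fi; apply: measurable_half => t; exact: summable_on_measurable (fi t).
Qed.

Lemma prim_EFin f t : locint f ->
  (prim f t)%:E = (\int[mu]_(s in `[0%R, t]) (f s)%:E)%E.
Proof.
move=> fi; rewrite /prim /Rintegral fineK//.
by apply: integrable_fin_num => //; exact: (fi t).
Qed.

Lemma summable_locint f : summable_on half f -> locint f.
Proof.
move=> fi t; apply: (integrableS _ _ _ fi) => //.
by apply: subset_itvl; rewrite bnd_simp.
Qed.

Lemma prim_cvg_ge0 f : locint f -> (forall t, 0 <= t -> 0 <= f t) ->
  (prim f n%:R)%:E @[n --> \oo] --> (\int[mu]_(s in half) (f s)%:E)%E.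
Proof.
move=> fi f0.
under eq_fun do rewrite prim_EFin//.
rewrite half_bigcup; apply: ge0_nondecreasing_set_cvg_integral => //.
- move=> m n mn; apply/subsetPset; apply: subset_itvl.
  by rewrite bnd_simp ler_nat.
- by move=> n; apply/measurable_EFinP; exact: summable_on_measurable (fi _).
- move=> n x /=; rewrite in_itv/= => /andP[x0 _].
  by rewrite lee_fin f0.
Qed.

Lemma prim_le f s t : locint f -> (forall t, 0 <= t -> 0 <= f t) -> s <= t ->
  prim f s <= prim f t.
Proof.
move=> fi f0 st; have [s0|s0] := ltP s 0.
  rewrite prim_lt0//; apply: Rintegral_ge0 => x /=.
  by rewrite in_itv/= => /andP[x0 _]; exact: f0.
rewrite -subr_ge0 -prim_tail ?s0//; apply: Rintegral_ge0 => x /=.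
by rewrite in_itv/= => /andP[sx _]; apply: f0; exact: le_trans s0 (ltW sx).
Qed.

(** Monotone convergence along the intervals [0, n]. *)
Lemma summable_half_bound f M : locint f -> (forall t, 0 <= t -> 0 <= f t) ->
  (forall t, 0 <= t -> prim f t <= M) ->
  summable_on half f /\ \int[mu]_(t in half) f t <= M.
Proof.
move=> fi f0 fM.
have cv := prim_cvg_ge0 fi f0.
have le : (\int[mu]_(s in half) (f s)%:E <= M%:E)%E.
  rewrite -(cvg_lim _ cv)//; apply: lime_le; first exact: cvgP cv.
  by apply: nearW => n; rewrite lee_fin fM.
have fs : summable_on half f.
  apply/integrableP; split.
    by apply/measurable_EFinP; exact: locint_measurable_half.
  apply: (@le_lt_trans _ _ M%:E); last exact: ltry.
  apply: le_trans le; rewrite le_eqVlt; apply/orP; left; apply/eqP.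
  apply: eq_integral => x; rewrite inE/= in_itv/= andbT => x0.
  by rewrite ger0_norm// f0.
split=> //.
by rewrite -lee_fin /Rintegral fineK//; exact: integrable_fin_num.
Qed.

Lemma Rintegral_tail f t : summable_on half f -> 0 <= t ->
  \int[mu]_(s in half) f s - prim f t = \int[mu]_(s in `]t, +oo[) f s.
Proof. by move=> fi t0; rewrite /prim Rintegral_itvB. Qed.

Lemma prim_le_half f t : summable_on half f -> (forall t, 0 <= t -> 0 <= f t) ->
  prim f t <= \int[mu]_(s in half) f s.
Proof.
move=> fi f0; have [t0|t0] := ltP t 0.
  rewrite prim_lt0//; apply: Rintegral_ge0 => x /=.
  by rewrite in_itv/= andbT => x0; exact: f0.
rewrite -subr_ge0 Rintegral_tail//; apply: Rintegral_ge0 => x /=.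
by rewrite in_itv/= andbT => tx; apply: f0; exact: le_trans t0 (ltW tx).
Qed.

Lemma summable_norm f : summable_on half f -> summable_on half (fun t => `|f t|).
Proof. by move=> fi; exact: (integrable_norm fi). Qed.

Lemma prim_near_half f e : summable_on half f -> 0 < e ->
  exists N : nat, forall t, N%:R <= t ->
    `|\int[mu]_(s in half) f s - prim f t| <= e.
Proof.
move=> fi e0; pose g t := `|f t|.
have gi : summable_on half g := summable_norm fi.
have g0 t : 0 <= t -> 0 <= g t by rewrite /g.
have gl := summable_locint gi.
have cv : prim g n%:R @[n --> \oo] --> \int[mu]_(s in half) g s.
  have fin : (\int[mu]_(s in half) (g s)%:E)%E \is a fin_num.
    exact: integrable_fin_num.
  by have := prim_cvg_ge0 gl g0; rewrite -[X in _ --> X](fineK fin) => /fine_cvg.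
move/cvgrPdist_le : cv => /(_ _ e0)[N _ Ne].
exists N => t Nt.
have t0 : 0 <= t by rewrite (le_trans _ Nt).
have ti : summable_on `]t, +oo[ f.
  by apply: (integrableS _ _ _ fi) => //; apply: subset_itvr; rewrite bnd_simp.
rewrite Rintegral_tail// (le_trans (le_normr_Rintegral _ ti))//.
rewrite -/(Rintegral _ _ g) -Rintegral_tail//.
apply: le_trans (Ne N (leqnn N)).
apply: (le_trans _ (ler_norm _)); rewrite lerB// prim_le//.
Qed.

(** F has the limit c + int f at infinity, and an integrable function can only
    have the limit 0. *)
Lemma vanish_at_oo F f c : (forall t, 0 <= t -> F t = c + prim f t) ->
  summable_on half f -> summable_on half F ->
  c + \int[mu]_(s in half) f s = 0.
Proof.
move=> FE fi Fi; apply/eqP; apply: contraT => L0.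
set L := c + _ in L0.
have L2 : 0 < `|L| / 2 by rewrite divr_gt0// normr_gt0.
have [N Nf] := prim_near_half fi L2.
(* From N on |F| is at least |L| / 2, a constant that is not integrable. *)
have FL t : N%:R <= t -> `|L| / 2 <= `|F t|.
  move=> Nt; have := Nf _ Nt; rewrite FE ?(le_trans _ Nt)//.
  have -> : c + prim f t = L - (\int[mu]_(s in half) f s - prim f t).
    by rewrite /L; ring.
  have := lerB_dist L (\int[mu]_(s in half) f s - prim f t).
  lra.
have Fn := summable_norm Fi; have Fl := summable_locint Fn.
pose M := \int[mu]_(s in half) `|F s|.
have [k kM] : exists k : nat, M / (`|L| / 2) < k%:R.
  exists (Num.bound (M / (`|L| / 2))); apply: archi_boundP.
  by rewrite divr_ge0// ?(ltW L2)//; apply: Rintegral_ge0.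
have k0 : (0 : R) <= k%:R by [].
have := @prim_le_half (fun t => `|F t|) (N%:R + k%:R) Fn (fun t _ => normr_ge0 _).
have : `|L| / 2 * k%:R <= prim (fun t => `|F t|) (N%:R + k%:R) -
    prim (fun t => `|F t|) N%:R.
  rewrite -prim_tail//; last by rewrite ler0n lerDl.
  apply: (@le_trans _ _ (\int[mu]_(s in `]N%:R, N%:R + k%:R]) (`|L| / 2))).
    rewrite Rintegral_cst//.
    have E : mu `]N%:R, N%:R + k%:R] = k%:R%:E.
      rewrite lebesgue_measure_itv/= lte_fin ltrDl; case: ltP => [_|k0'].
        by rewrite -EFinD addrAC subrr add0r.
      by apply/eqP; rewrite eqe eq_le k0 k0'.
    by rewrite (_ : fine _ = k%:R)//; exact: (congr1 fine E).
  apply: le_Rintegral => //.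
  - have := @cont0_locint R _ (@cont0_cst R (`|L| / 2)) (N%:R + k%:R).
    by apply: summable_onS => //; apply: subset_itvr; rewrite bnd_simp.
  - apply: (integrableS _ _ _ Fn) => // x /=; rewrite !in_itv/= => /andP[Nx _].
    by rewrite andbT (le_trans _ (ltW Nx)).
  - by move=> x /=; rewrite in_itv/= => /andP[/ltW Nx _]; exact: FL.
have : 0 <= prim (fun t => `|F t|) N%:R by apply: Rintegral_ge0.
by move: kM; rewrite ltr_pdivrMr// -/M; lra.
Qed.

(** Square integrability on the half-line.  Measurability is required
    separately, because it does not follow from that of the square. *)
Definition sqsum f := measurable_fun half f /\ summable_on half (fun t => f t ^+ 2).

Lemma sqsumM f g : sqsum f -> sqsum g -> summable_on half (fun t => f t * g t).
Proof.
move=> [mf fi] [mg gi].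
apply: (@summable_on_le _ _ _ (fun t => f t ^+ 2 + g t ^+ 2)) => //.
- exact: measurable_funM.
- move=> x _; rewrite [leRHS]ger0_norm ?addr_ge0 ?sqr_ge0// normrM.
  rewrite -(real_normK (num_real (f x))) -(real_normK (num_real (g x))).
  by have := sqr_ge0 (`|f x| - `|g x|); have := sqr_ge0 (`|f x| + `|g x|); nra.
- exact: summable_onD.
Qed.

Lemma sqsumD f g : sqsum f -> sqsum g -> sqsum (fun t => f t + g t).
Proof.
move=> fs gs; split; first by apply: measurable_funD; [case: fs|case: gs].
rewrite [X in summable_on _ X](_ : _ =
  fun t => (f t ^+ 2 + g t ^+ 2) + 2 * (f t * g t)); last first.
  by apply/funext => t; ring.
apply: summable_onD => //; first by apply: summable_onD => //; [case: fs|case: gs].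
by apply: summable_onZ => //; exact: sqsumM.
Qed.

Lemma sqsumZ c f : sqsum f -> sqsum (fun t => c * f t).
Proof.
move=> [mf fi]; split; first exact: measurable_funM.
rewrite [X in summable_on _ X](_ : _ = fun t => c ^+ 2 * f t ^+ 2); last first.
  by apply/funext => t; rewrite exprMn.
exact: summable_onZ.
Qed.

Lemma sqsum_locint f : sqsum f -> locint f.
Proof.
move=> [mf fi] t.
apply: (@summable_on_le _ _ _ (fun t => 1 + f t ^+ 2)) => //.
- apply: measurable_funS mf => //.
  by apply: subset_itvl; rewrite bnd_simp.
- move=> x _; rewrite [leRHS]ger0_norm ?addr_ge0 ?sqr_ge0//.
  rewrite -(real_normK (num_real (f x))).
  by have := sqr_ge0 (`|f x| - 1); have := sqr_ge0 (`|f x| + 1); nra.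
- apply: summable_onD => //; first exact: (cont0_locint (@cont0_cst R 1) t).
  exact: (summable_locint fi).
Qed.

(** J is antisymmetric: the boundary term J f * J g vanishes at infinity, being
    integrable with an integrable derivative. *)
Lemma sqsum_by_parts f g : sqsum f -> sqsum g ->
  sqsum (prim f) -> sqsum (prim g) ->
  \int[mu]_(t in half) (f t * prim g t) = - \int[mu]_(t in half) (prim f t * g t).
Proof.
move=> fs gs pf pg.
have i1 := sqsumM fs pg; have i2 := sqsumM pf gs.
have i3 : summable_on half (fun t => f t * prim g t + g t * prim f t).
  by apply: summable_onD => //; rewrite (_ : (fun _ => _) = fun t => prim f t * g t)//;
     apply/funext => t; rewrite mulrC.
have e : forall t, 0 <= t -> prim f t * prim g t =
    0 + prim (fun t => f t * prim g t + g t * prim f t) t.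
  by move=> t _; rewrite add0r primM//; exact: sqsum_locint.
have := vanish_at_oo e i3 (sqsumM pf pg).
rewrite add0r RintegralD//; last first.
  by rewrite (_ : (fun _ => _) = fun t => prim f t * g t)//; apply/funext => t; rewrite mulrC.
move=> /eqP; rewrite addr_eq0 => /eqP ->; congr (- _).
by apply: eq_Rintegral => t _; rewrite mulrC.
Qed.

End Improper.

(** * Complex-valued integrals, exponentials and energy estimates *)

Section ComplexIntegral.
Context {R : realType}.
Notation mu := (@lebesgue_measure R).
Notation C := (complex R).
Notation Re := complex.Re.
Notation Im := complex.Im.

Lemma prim_derive (F f : R -> R) : (forall x : R, is_derive x 1 F (f x)) ->
  continuous f -> forall t, 0 <= t -> F t = F 0 + prim f t.
Proof.
move=> dF cf t; rewrite le_eqVlt => /predU1P[<-|t0]; first by rewrite prim0 addr0.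
have cF : continuous F.
  by move=> x; apply/differentiable_continuous/derivable1_diffP; have [] := dF x.
have := @continuous_FTC2 R f F 0 t t0 (continuous_subspaceT cf) _ _.
rewrite /prim /Rintegral => ->.
- by rewrite -EFinB /= addrC subrK.
- split; first by move=> x _; have [] := dF x.
  + exact/cvg_at_right_filter/cF.
  + exact/cvg_at_left_filter/cF.
- by move=> x _; rewrite derive1E derive_val.
Qed.

Lemma complexP (x y : C) : Re x = Re y -> Im x = Im y -> x = y.
Proof. by case: x => a b; case: y => c d /= -> ->. Qed.

Lemma ReD (x y : C) : Re (x + y) = Re x + Re y.
Proof. by case: x => a b; case: y. Qed.
Lemma ImD (x y : C) : Im (x + y) = Im x + Im y.
Proof. by case: x => a b; case: y. Qed.
Lemma ReN (x : C) : Re (- x) = - Re x.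
Proof. by case: x. Qed.
Lemma ImN (x : C) : Im (- x) = - Im x.
Proof. by case: x. Qed.
Lemma ReM (x y : C) : Re (x * y) = Re x * Re y - Im x * Im y.
Proof. by case: x => a b; case: y. Qed.
Lemma ImM (x y : C) : Im (x * y) = Re x * Im y + Im x * Re y.
Proof. by case: x => a b; case: y. Qed.
Definition cE := (ReD, ImD, ReN, ImN, ReM, ImM).

Definition cprim (f : R -> C) (t : R) : C :=
  (prim (fun s => Re (f s)) t +i* prim (fun s => Im (f s)) t)%C.
Definition clocint (f : R -> C) :=
  locint (fun s => Re (f s)) /\ locint (fun s => Im (f s)).
Definition ccont0 (f : R -> C) :=
  cont0 (fun s => Re (f s)) /\ cont0 (fun s => Im (f s)).

Lemma eq_cprim f g t : (forall s, 0 <= s <= t -> f s = g s) ->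
  cprim f t = cprim g t.
Proof. by move=> fg; congr Complex; apply: eq_prim => s st; rewrite fg. Qed.

Lemma eq_clocint f g : f =1 g -> clocint f -> clocint g.
Proof. by move=> /funext ->. Qed.

Lemma cprim_lt0 f t : t < 0 -> cprim f t = 0.
Proof. by move=> t0; rewrite /cprim !prim_lt0. Qed.

Lemma clocintD f g : clocint f -> clocint g -> clocint (fun s => f s + g s).
Proof.
move=> [f1 f2] [g1 g2]; split; under [X in locint X]eq_fun do rewrite cE.
  exact: locintD.
exact: locintD.
Qed.

Lemma cprimD f g t : clocint f -> clocint g ->
  cprim (fun s => f s + g s) t = cprim f t + cprim g t.
Proof.
move=> [f1 f2] [g1 g2]; apply: complexP; rewrite cE /=.
  by rewrite -primD//; apply: eq_prim => s _; rewrite cE.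
by rewrite -primD//; apply: eq_prim => s _; rewrite cE.
Qed.

Lemma ccont0_clocint f : ccont0 f -> clocint f.
Proof. by case=> f1 f2; split; exact: cont0_locint. Qed.

Lemma ccont0_cprim f : clocint f -> ccont0 (cprim f).
Proof. by case=> f1 f2; split; exact: cont0_prim. Qed.

Lemma ccont0_cst c : ccont0 (fun=> c).
Proof. by split; exact: cont0_cst. Qed.

Lemma cont0N (f : R -> R) : cont0 f -> cont0 (fun s => - f s).
Proof. by move=> cf t x; apply: cvgN; exact: cf. Qed.

Lemma locintN (f : R -> R) : locint f -> locint (fun s => - f s).
Proof.
move=> fi; rewrite [X in locint X](_ : _ = fun s => - 1 * f s); last first.
  by apply/funext => s; rewrite mulN1r.
exact: locintZ.
Qed.

Lemma ccont0D f g : ccont0 f -> ccont0 g -> ccont0 (fun s => f s + g s).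
Proof.
move=> [f1 f2] [g1 g2]; split; under [X in cont0 X]eq_fun do rewrite cE.
  exact: cont0D.
exact: cont0D.
Qed.

Lemma ccont0M f g : ccont0 f -> ccont0 g -> ccont0 (fun s => f s * g s).
Proof.
move=> [f1 f2] [g1 g2]; split; under [X in cont0 X]eq_fun do rewrite cE.
  by apply: cont0D; [|apply: cont0N]; exact: cont0M.
by apply: cont0D; exact: cont0M.
Qed.

Lemma clocintM f g : clocint f -> ccont0 g -> clocint (fun s => f s * g s).
Proof.
move=> [f1 f2] [g1 g2]; split; under [X in locint X]eq_fun do rewrite cE.
  by apply: locintD; [|apply: locintN]; exact: locintM.
by apply: locintD; exact: locintM.
Qed.

Lemma clocintZ c f : clocint f -> clocint (fun s => c * f s).
Proof.
move=> fi; apply: (@eq_clocint (fun s => f s * c)); first by move=> s; rewrite mulrC.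
exact: (clocintM fi (@ccont0_cst c)).
Qed.

Lemma cprimZ c f t : clocint f -> cprim (fun s => c * f s) t = c * cprim f t.
Proof.
move=> [f1 f2]; apply: complexP; rewrite cE /=.
  rewrite -mulNr -!primZ// -primD; [|exact: locintZ..].
  by apply: eq_prim => s _; rewrite cE mulNr.
rewrite -!primZ// -primD; [|exact: locintZ..].
by apply: eq_prim => s _; rewrite cE.
Qed.

Lemma cprimM f g t : clocint f -> clocint g ->
  cprim f t * cprim g t = cprim (fun s => f s * cprim g s + g s * cprim f s) t.
Proof.
move=> [f1 f2] [g1 g2].
have c1 := cont0_prim f1; have c2 := cont0_prim f2.
have c3 := cont0_prim g1; have c4 := cont0_prim g2.
apply: complexP; rewrite cE /= !primM//.
  rewrite -mulN1r -primZ; last by apply: locintD; exact: locintM.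
  rewrite -primD; first last.
  - by apply: locintZ; apply: locintD; exact: locintM.
  - by apply: locintD; exact: locintM.
  by apply: eq_prim => s _; rewrite !cE /=; ring.
rewrite -primD; [|by apply: locintD; exact: locintM..].
by apply: eq_prim => s _; rewrite !cE /=; ring.
Qed.

Definition cexp (m : C) (t : R) : C :=
  (expR (Re m * t) * cos (Im m * t) +i* (expR (Re m * t) * sin (Im m * t)))%C.

Lemma cexpN m t : cexp (- m) t * cexp m t = 1.
Proof.
have ee : expR (- (Re m * t)) * expR (Re m * t) = 1.
  by rewrite -expRD addNr expR0.
have cs := cos2Dsin2 (Im m * t).
rewrite /cexp !cE !mulNr cosN sinN; apply: complexP; rewrite cE /=.
  rewrite -[RHS]mulr1 -[X in _ = X * _]ee -cs; ring.
ring.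
Qed.

Lemma is_derive_linear (a x : R) : is_derive x 1 (fun t => a * t) a.
Proof.
have := @is_deriveZ _ _ _ (@id R) a x 1 1 (is_derive_id x 1).
by rewrite /GRing.scale /= mulr1.
Qed.

Lemma continuous_expM (a : R) : continuous (fun t : R => expR (a * t)).
Proof.
move=> x; apply: continuous_comp; last exact: continuous_expR.
by apply: continuousM; [exact: cvg_cst|exact: cvg_id].
Qed.

Lemma continuous_cosM (a : R) : continuous (fun t : R => cos (a * t)).
Proof.
move=> x; apply: continuous_comp; last exact: continuous_cos.
by apply: continuousM; [exact: cvg_cst|exact: cvg_id].
Qed.

Lemma continuous_sinM (a : R) : continuous (fun t : R => sin (a * t)).
Proof.
move=> x; apply: continuous_comp; last exact: continuous_sin.
by apply: continuousM; [exact: cvg_cst|exact: cvg_id].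
Qed.

Lemma ccont0_cexp m : ccont0 (cexp m).
Proof.
by split; apply: cont0M; apply: cont0_continuous;
  [exact: continuous_expM|exact: continuous_cosM|exact: continuous_expM|
   exact: continuous_sinM].
Qed.

Lemma cexpE m t : 0 <= t -> cexp m t = 1 + cprim (fun s => m * cexp m s) t.
Proof.
move=> t0.
have dE (x : R) : is_derive x 1 (fun t => expR (Re m * t)) (Re m * expR (Re m * x)).
  have := is_derive1_comp (is_derive_expR (Re m * x)) (is_derive_linear (Re m) x).
  by rewrite mulrC.
have dC (x : R) : is_derive x 1 (fun t => cos (Im m * t)) (Im m * - sin (Im m * x)).
  have := is_derive1_comp (is_derive_cos (Im m * x)) (is_derive_linear (Im m) x).
  by rewrite mulrC.
have dS (x : R) : is_derive x 1 (fun t => sin (Im m * t)) (Im m * cos (Im m * x)).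
  have := is_derive1_comp (is_derive_sin (Im m * x)) (is_derive_linear (Im m) x).
  by rewrite mulrC.
have cE1 : continuous (fun t : R => expR (Re m * t)) by exact: continuous_expM.
have cC : continuous (fun t : R => cos (Im m * t)) by exact: continuous_cosM.
have cS : continuous (fun t : R => sin (Im m * t)) by exact: continuous_sinM.
have cR : continuous (fun s => Re (m * cexp m s)).
  under eq_fun do rewrite cE /=.
  move=> x; apply: cvgB; (apply: cvgM; first exact: cvg_cst).
    by apply: cvgM; [exact: cE1|exact: cC].
  by apply: cvgM; [exact: cE1|exact: cS].
have cI : continuous (fun s => Im (m * cexp m s)).
  under eq_fun do rewrite cE /=.
  move=> x; apply: cvgD; (apply: cvgM; first exact: cvg_cst).
    by apply: cvgM; [exact: cE1|exact: cS].
  by apply: cvgM; [exact: cE1|exact: cC].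
apply: complexP; rewrite cE /=.
- rewrite (@prim_derive (fun t => expR (Re m * t) * cos (Im m * t)) _ _ cR)//.
    by rewrite !mulr0 expR0 cos0 mulr1.
  move=> x; apply: is_derive_eq.
  by rewrite /GRing.scale /= cE /=; ring.
- rewrite (@prim_derive (fun t => expR (Re m * t) * sin (Im m * t)) _ _ cI)//.
    by rewrite !mulr0 sin0 mulr0.
  move=> x; apply: is_derive_eq.
  by rewrite /GRing.scale /= cE /=; ring.
Qed.

(** The derivative of exp(m t) F is exp(m t) (F' + m F), in integrated form. *)
Lemma cexp_shift m c F phi : clocint phi ->
  (forall t, 0 <= t -> F t = c + cprim phi t) ->
  forall t, 0 <= t ->
    cexp m t * F t = c + cprim (fun s => cexp m s * (phi s + m * F s)) t.
Proof.
move=> pi FE t t0.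
pose P := cprim (fun s => m * cexp m s).
have ce : ccont0 (cexp m) := ccont0_cexp m.
have me : clocint (fun s => m * cexp m s) by apply/clocintZ/ccont0_clocint.
have cP : ccont0 P := ccont0_cprim me.
have cQ : ccont0 (cprim phi) := ccont0_cprim pi.
rewrite [cprim _ t](@eq_cprim _ (fun s => (phi s + c * (m * cexp m s)) +
   (m * cexp m s * cprim phi s + phi s * P s))); last first.
  move=> s /andP[s0 _]; rewrite FE// [in LHS]mulrDr {1}cexpE// -/(P s); ring.
rewrite cprimD; first last.
- by apply: clocintD; exact: clocintM.
- by apply: clocintD => //; exact: clocintZ.
rewrite cprimD//; last exact: clocintZ.
rewrite cprimZ// -cprimM// FE// cexpE// -/(P t); ring.
Qed.

(** Variation of constants: J f is the integral of exp(l (t - s)) g(s). *)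
Lemma resolvent_exists l g : clocint g ->
  exists f, [/\ clocint f, forall t, f t - l * cprim f t = g t &
                ccont0 g -> ccont0 f].
Proof.
move=> gi.
pose q s := g s * cexp (- l) s.
have qi : clocint q by apply: clocintM => //; exact: ccont0_cexp.
pose F t := cexp l t * cprim q t.
have cF : ccont0 F by apply: ccont0M; [exact: ccont0_cexp|exact: ccont0_cprim].
pose f t := g t + l * F t.
have fF t : cprim f t = F t.
  have [t0|t0] := ltP t 0; first by rewrite /F !cprim_lt0// mulr0.
  rewrite /F (@cexp_shift l 0 (cprim q) q qi _ t t0); last by move=> s _; rewrite add0r.
  rewrite add0r; apply: eq_cprim => s _.
  have qE : cexp l s * q s = g s by rewrite /q mulrCA [X in _ * X]mulrC cexpN mulr1.
  by rewrite mulrDr qE mulrCA.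
exists f; split.
- by apply: clocintD => //; apply/clocintZ/ccont0_clocint.
- by move=> t; rewrite fF /f addrK.
- move=> cg; apply: ccont0D => //; apply: ccont0M => //; exact: ccont0_cst.
Qed.

Lemma prim_sqr (F phi : R -> R) c : locint phi ->
  (forall t, 0 <= t -> F t = c + prim phi t) ->
  forall t, 0 <= t -> F t ^+ 2 = c ^+ 2 + prim (fun s => 2 * (phi s * F s)) t.
Proof.
move=> pi FE t t0; have cp := cont0_prim pi.
have pp : locint (fun s => phi s * prim phi s) by exact: locintM.
rewrite [prim _ t](@eq_prim _ _ (fun s => (2 * c) * phi s +
   (phi s * prim phi s + phi s * prim phi s))); last first.
  by move=> s /andP[s0 _]; rewrite FE//; ring.
rewrite primD; [|exact: locintZ|exact: locintD].
by rewrite primZ// -primM// FE//; ring.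
Qed.

Definition csq (g : R -> C) :=
  sqsum (fun t => Re (g t)) /\ sqsum (fun t => Im (g t)).

Lemma csq_clocint g : csq g -> clocint g.
Proof. by case=> g1 g2; split; exact: sqsum_locint. Qed.

Lemma csqD f g : csq f -> csq g -> csq (fun t => f t + g t).
Proof.
move=> [f1 f2] [g1 g2]; split; under [X in sqsum X]eq_fun do rewrite cE.
  exact: sqsumD.
exact: sqsumD.
Qed.

Lemma csqZ c f : csq f -> csq (fun t => c * f t).
Proof.
move=> [f1 f2]; split; under [X in sqsum X]eq_fun do rewrite cE.
  under [X in sqsum X]eq_fun do rewrite -mulNr.
  by apply: sqsumD; exact: sqsumZ.
by apply: sqsumD; exact: sqsumZ.
Qed.

Lemma locint_sq (F : R -> R) : cont0 F -> locint (fun t => F t ^+ 2).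
Proof. by move=> cF; apply: cont0_locint; exact: cont0M. Qed.

(** With a = - Re l > 0, the derivative of |F|^2 is at most - a |F|^2 + |g|^2 /
    a; integrating bounds a * int |F|^2 by |c|^2 + int |g|^2 / a. *)
Lemma energy l c g F : Re l < 0 -> csq g -> ccont0 F ->
  (forall t, 0 <= t -> F t = c + cprim (fun s => l * F s + g s) t) ->
  csq F.
Proof.
move=> l0 gs cF FE.
have gi := csq_clocint gs; have Fi := ccont0_clocint cF.
have [p1 p2] : clocint (fun s => l * F s + g s) by apply: clocintD => //; exact: clocintZ.
have [cF1 cF2] := cF; have [g1 g2] := gs.
set F1 := fun s => Re (F s) in cF1; set F2 := fun s => Im (F s) in cF2.
set G1 := fun s => Re (g s) in g1; set G2 := fun s => Im (g s) in g2.
have E1 := @prim_sqr F1 _ (Re c) p1 _; have E2 := @prim_sqr F2 _ (Im c) p2 _.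
pose N s := F1 s ^+ 2 + F2 s ^+ 2; pose G s := G1 s ^+ 2 + G2 s ^+ 2.
have Gs : summable_on `[0, +oo[ G by apply: summable_onD => //; [case: g1|case: g2].
have Ni : locint N by apply: locintD; exact: locint_sq.
have Gi := summable_locint Gs.
set a := - Re l; have a0 : 0 < a by rewrite /a oppr_gt0.
have N0 t : 0 <= N t by rewrite addr_ge0// sqr_ge0.
have G0 t : 0 <= G t by rewrite addr_ge0// sqr_ge0.
pose K := Re c ^+ 2 + Im c ^+ 2.
pose M := (K + a^-1 * \int[mu]_(t in `[0, +oo[) G t) / a.
have NM t : 0 <= t -> prim N t <= M.
  move=> t0.
  have NE : N t = K + (prim (fun s => 2 * (Re (l * F s + g s) * F1 s)) t +
                   prim (fun s => 2 * (Im (l * F s + g s) * F2 s)) t).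
    rewrite /N E1// ?E2//; [by rewrite /K; ring| |].
      by move=> s s0; rewrite /F2 FE// cE.
    by move=> s s0; rewrite /F1 FE// cE.
  have q1 : locint (fun s => 2 * (Re (l * F s + g s) * F1 s)).
    by apply: locintZ; exact: locintM.
  have q2 : locint (fun s => 2 * (Im (l * F s + g s) * F2 s)).
    by apply: locintZ; exact: locintM.
  have le : prim (fun s => 2 * (Re (l * F s + g s) * F1 s) +
      2 * (Im (l * F s + g s) * F2 s)) t <= prim (fun s => - a * N s + a^-1 * G s) t.
    apply: le_Rintegral => //.
    - exact: (locintD q1 q2).
    - exact: (locintD (locintZ _ Ni) (locintZ _ Gi)).
    move=> s _; rewrite !cE /N /G -/(F1 s) -/(F2 s) -/(G1 s) -/(G2 s).
    have -> : Re l = - a by rewrite /a opprK.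
    have s1 := sqr_ge0 (a * F1 s - G1 s); have s2 := sqr_ge0 (a * F2 s - G2 s).
    rewrite -(ler_pM2l a0) -subr_ge0.
    rewrite [leRHS](_ : _ = (a * F1 s - G1 s) ^+ 2 + (a * F2 s - G2 s) ^+ 2).
      exact: addr_ge0.
    by field; exact: lt0r_neq0.
  move: le; rewrite primD// primD; [|exact: locintZ..].
  rewrite (primZ _ _ Ni) (primZ _ _ Gi) => le.
  have GG := @prim_le_half R G t Gs (fun t _ => G0 t).
  rewrite ler_pdivlMr//; have := N0 t; rewrite NE.
  have : a^-1 * prim G t <= a^-1 * \int[mu]_(t in `[0, +oo[) G t.
    by rewrite ler_wpM2l// invr_ge0 ltW.
  have arith (x y z k i b : R) : x <= - b * y + z -> z <= i -> 0 <= k + x ->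
      y * b <= k + i by lra.
  exact: arith.
have [Ns _] := summable_half_bound Ni (fun t _ => N0 t) NM.
split; (split; first by apply: locint_measurable_half; case: Fi).
- apply: (@summable_on_le _ _ _ N) => //.
    by apply: measurable_funM; apply: locint_measurable_half; case: Fi.
  move=> x _; rewrite !ger0_norm ?sqr_ge0//.
  by rewrite lerDl sqr_ge0.
- apply: (@summable_on_le _ _ _ N) => //.
    by apply: measurable_funM; apply: locint_measurable_half; case: Fi.
  move=> x _; rewrite !ger0_norm ?sqr_ge0//.
  by rewrite lerDr sqr_ge0.
Qed.

(** Square integrability against the weight exp(2 sg t).  For sg > 0 it
    expresses exponential decay; for sg = 0 it is [csq]. *)
Definition wsq (sg : R) (g : R -> C) := csq (fun t => cexp (sg%:C)%C t * g t).

(** Multiplication by exp(sg t) replaces the coefficient l by l + sg. *)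
Lemma energy_weighted sg l c g F : Re l + sg < 0 -> wsq sg g -> clocint g ->
  ccont0 F -> (forall t, 0 <= t -> F t = c + cprim (fun s => l * F s + g s) t) ->
  wsq sg F.
Proof.
move=> ls gs gi cF FE.
have Fi := ccont0_clocint cF.
apply: (@energy (l + (sg%:C)%C) c _ _ _ gs).
- by rewrite cE.
- by apply: ccont0M => //; exact: ccont0_cexp.
- move=> t t0; rewrite (@cexp_shift (sg%:C)%C c F _ _ FE)//.
    congr (c + _); apply: eq_cprim => s _; ring.
  by apply: clocintD => //; exact: clocintZ.
Qed.

End ComplexIntegral.

(** * Polynomials in the integration operator *)

Section VolterraPolynomials.
Context {R : realType}.
Notation mu := (@lebesgue_measure R).
Notation C := (complex R).
Notation Re := complex.Re.
Notation Im := complex.Im.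
Implicit Types (p q : {poly C}) (f g : R -> C) (l : C) (rs : seq C).

(** p(J) f, for J = [cprim]. *)
Definition cpol p f (t : R) : C := \sum_(k < size p) p`_k * iter k cprim f t.

Lemma cpolE n p f t : (size p <= n)%N ->
  cpol p f t = \sum_(k < n) p`_k * iter k cprim f t.
Proof.
move=> pn; rewrite /cpol (big_ord_widen n (fun k => p`_k * iter k cprim f t))//.
rewrite big_mkcond/=; apply: eq_bigr => i _; case: ltnP => // pi.
by rewrite nth_default// mul0r.
Qed.

Lemma clocint_iter k f : clocint f -> clocint (iter k cprim f).
Proof. by move=> fi; elim: k => //= k ih; apply/ccont0_clocint/ccont0_cprim. Qed.

Lemma clocint_sum n (F : 'I_n -> R -> C) : (forall i, clocint (F i)) ->
  clocint (fun t => \sum_(i < n) F i t).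
Proof.
elim: n F => [|n ih] F Fi.
  by apply: (@eq_clocint _ (fun=> 0)); [move=> t; rewrite big_ord0|exact/ccont0_clocint/ccont0_cst].
apply: (@eq_clocint _ (fun t => \sum_(i < n) F (widen_ord (leqnSn n) i) t + F ord_max t)).
  by move=> t; rewrite big_ord_recr.
by apply: clocintD => //; exact: ih.
Qed.

Lemma cprim_sum n (F : 'I_n -> R -> C) t : (forall i, clocint (F i)) ->
  cprim (fun t => \sum_(i < n) F i t) t = \sum_(i < n) cprim (F i) t.
Proof.
elim: n F => [|n ih] F Fi.
  rewrite big_ord0 (@eq_cprim _ _ (fun=> 0 * 0)).
    by rewrite cprimZ ?mul0r//; exact/ccont0_clocint/ccont0_cst.
  by move=> s _; rewrite big_ord0 mul0r.
rewrite big_ord_recr/= -ih// -cprimD//; last exact: clocint_sum.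
by apply: eq_cprim => s _; rewrite big_ord_recr.
Qed.

Lemma clocint_cpol p f : clocint f -> clocint (cpol p f).
Proof. by move=> fi; apply: clocint_sum => i; apply: clocintZ; exact: clocint_iter. Qed.

Lemma cpolD p q f t : cpol (p + q) f t = cpol p f t + cpol q f t.
Proof.
rewrite !(@cpolE (maxn (size p) (size q))) ?leq_maxl ?leq_maxr ?size_polyD//.
by rewrite -big_split; apply: eq_bigr => i _; rewrite coefD mulrDl.
Qed.

Lemma cpolZ c p f t : cpol (c *: p) f t = c * cpol p f t.
Proof.
rewrite (@cpolE (size p)) ?size_scale_leq// /cpol mulr_sumr.
by apply: eq_bigr => i _; rewrite coefZ mulrA.
Qed.

Lemma cpol_polyC c f t : cpol c%:P f t = c * f t.
Proof. by rewrite (@cpolE 1) ?size_polyC_leq1// big_ord1 coefC. Qed.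

Lemma cpolMX p f t : clocint f -> cpol (p * 'X) f t = cprim (cpol p f) t.
Proof.
move=> fi; rewrite (@cpolE (size p).+1); last first.
  by apply: (leq_trans (size_polyMleq _ _)); rewrite size_polyX addn2.
rewrite big_ord_recl coefMX mul0r add0r cprim_sum; last first.
  by move=> i; apply: clocintZ; exact: clocint_iter.
apply: eq_bigr => i _; rewrite coefMX/= cprimZ//; exact: clocint_iter.
Qed.

Lemma eq_cpol p f g t : (forall s, 0 <= s <= t -> f s = g s) -> 0 <= t ->
  cpol p f t = cpol p g t.
Proof.
move=> fg t0; apply: eq_bigr => i _; congr (_ * _).
elim: {i}(i : nat) t t0 fg => [t t0 fg|k ih t t0 fg] /=.
  by rewrite fg// t0 lexx.
apply: eq_cprim => s /andP[s0 st]; apply: ih => // r /andP[r0 rs].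
by apply: fg; rewrite r0 (le_trans rs).
Qed.

Lemma cpolM p q f t : clocint f -> cpol (p * q) f t = cpol p (cpol q f) t.
Proof.
move=> fi; elim/poly_ind: p t => [|p c ih] t.
  by rewrite mul0r /cpol size_poly0 !big_ord0.
rewrite mulrDl -mulrA [_ * q]mulrC mulrA cpolD cpolMX// cpolD cpolMX; last first.
  exact: clocint_cpol.
rewrite mul_polyC cpolZ cpol_polyC; congr (_ + _); apply: eq_cprim => s _.
exact: ih.
Qed.

Lemma cpol_fD p f g t : clocint f -> clocint g ->
  cpol p (fun s => f s + g s) t = cpol p f t + cpol p g t.
Proof.
move=> fi gi; elim/poly_ind: p t => [|p c ih] t.
  by rewrite /cpol size_poly0 !big_ord0 addr0.
rewrite !cpolD !cpolMX//; last exact: clocintD.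
rewrite !cpol_polyC mulrDr addrACA -cprimD; [|exact: clocint_cpol..].
by congr (_ + _); apply: eq_cprim => s _; exact: ih.
Qed.

Lemma cpol_fZ p c f t : clocint f ->
  cpol p (fun s => c * f s) t = c * cpol p f t.
Proof.
move=> fi; elim/poly_ind: p t => [|p a ih] t.
  by rewrite /cpol size_poly0 !big_ord0 mulr0.
rewrite !cpolD !cpolMX//; last exact: clocintZ.
rewrite !cpol_polyC mulrDr mulrCA -cprimZ; last exact: clocint_cpol.
by congr (_ + _); apply: eq_cprim => s _; exact: ih.
Qed.

Lemma cpolX f : cpol 'X f = cprim f.
Proof.
apply/funext => t; rewrite (@cpolE 2) ?size_polyX// big_ord_recl big_ord1.
by rewrite !coefX/= mul0r mul1r add0r.
Qed.

Lemma cpol_cprim p f t : clocint f -> cpol p (cprim f) t = cprim (cpol p f) t.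
Proof. by move=> fi; rewrite -cpolX -cpolM// cpolMX. Qed.

(** A product indexed by the reciprocals of its roots: in this form each factor
    1 - l J is a Volterra resolvent, and the value at 0 is 1. *)
Definition res_poly rs : {poly C} := \prod_(l <- rs) (1 - l *: 'X).

Lemma cpol_factor l p f t : clocint f ->
  cpol ((1 - l *: 'X) * p) f t = cpol p f t - l * cprim (cpol p f) t.
Proof.
move=> fi; rewrite mulrBl mul1r -scaleN1r cpolD cpolZ mulN1r.
by rewrite -scalerAl cpolZ ['X * p]mulrC cpolMX.
Qed.

Lemma res_exists rs g : clocint g -> exists f,
  [/\ clocint f, forall t, cpol (res_poly rs) f t = g t & ccont0 g -> ccont0 f].
Proof.
elim: rs g => [|l rs ih] g gi.
  exists g; split=> // t; rewrite /res_poly big_nil.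
  by rewrite -[1]/(1%:P) cpol_polyC mul1r.
have [h [hi hE hc]] := resolvent_exists l gi.
have [f [fi fE fc]] := ih _ hi.
exists f; split=> //; last by move=> /hc /fc.
move=> t; rewrite /res_poly big_cons cpol_factor// -/(res_poly rs) fE.
by rewrite (@eq_cprim _ (cpol _ f) h)// => s _; rewrite fE.
Qed.

Lemma sumsq_le0 (a b : R) : a ^+ 2 + b ^+ 2 <= 0 -> a = 0 /\ b = 0.
Proof.
move=> ab; have : a ^+ 2 + b ^+ 2 == 0 by rewrite eq_le ab addr_ge0 ?sqr_ge0.
by rewrite paddr_eq0 ?sqr_ge0// !sqrf_eq0 => /andP[/eqP ? /eqP].
Qed.

(** F = J h solves F' = l F with F 0 = 0, and |F|^2 cannot increase since Re l <
    0. *)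
Lemma resolvent_inj l h : Re l < 0 -> clocint h ->
  (forall t, 0 <= t -> h t = l * cprim h t) -> forall t, 0 <= t -> h t = 0.
Proof.
move=> l0 hi hE t t0.
suff F0 : cprim h t = 0 by rewrite hE// F0 mulr0.
pose F := cprim h; have cF : ccont0 F := ccont0_cprim hi.
have [h1 h2] := hi.
have E1 := @prim_sqr _ (fun s => Re (F s)) _ 0 h1 (fun s _ => esym (add0r _)) t t0.
have E2 := @prim_sqr _ (fun s => Im (F s)) _ 0 h2 (fun s _ => esym (add0r _)) t t0.
have [cF1 cF2] := cF.
have q1 := locintZ 2 (locintM h1 cF1); have q2 := locintZ 2 (locintM h2 cF2).
have z2 : (0 : R) ^+ 2 = 0 by rewrite expr0n.
have le0 : 0 <= -1 * (prim (fun x => 2 * (Re (h x) * Re (F x))) t +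
                      prim (fun x => 2 * (Im (h x) * Im (F x))) t).
  rewrite -(primD _ q1 q2) -(primZ _ _ (locintD q1 q2)).
  apply: Rintegral_ge0 => s sI.
  have s0 : 0 <= s by move: sI; rewrite /= in_itv/= => /andP[].
  rewrite (hE s s0) -/(F s) !cE.
  rewrite [leRHS](_ : _ = (- Re l) * (2 * (Re (F s) ^+ 2 + Im (F s) ^+ 2))).
    by rewrite mulr_ge0 ?oppr_ge0 ?(ltW l0)// mulr_ge0// addr_ge0 ?sqr_ge0.
  ring.
rewrite z2 add0r in E1; rewrite z2 add0r in E2.
rewrite -E1 -E2 mulN1r oppr_ge0 in le0.
have [e1 e2] := sumsq_le0 le0.
exact: complexP.
Qed.

Lemma res_inj rs f : (forall l, l \in rs -> Re l < 0) -> clocint f ->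
  (forall t, 0 <= t -> cpol (res_poly rs) f t = 0) -> forall t, 0 <= t -> f t = 0.
Proof.
elim: rs f => [|l rs ih] f rs0 fi fE t t0.
  by have := fE t t0; rewrite /res_poly big_nil -[1]/(1%:P) cpol_polyC mul1r.
apply: ih => //; first by move=> l' l'rs; apply: rs0; rewrite inE l'rs orbT.
move=> s s0; apply: (@resolvent_inj l _ _ _ _ s s0).
- by apply: rs0; rewrite mem_head.
- exact: clocint_cpol.
- move=> r r0; have := fE r r0; rewrite /res_poly big_cons cpol_factor//.
  by move=> /eqP; rewrite subr_eq0 => /eqP.
Qed.

Lemma sqsum_eq (f g : R -> R) : (forall t, 0 <= t -> f t = g t) -> sqsum f -> sqsum g.
Proof.
move=> fg [mf fi]; split.
  apply: eq_measurable_fun mf => t; rewrite inE/= in_itv/= andbT; exact: fg.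
apply: eq_integrable fi => // t; rewrite inE/= in_itv/= andbT => t0.
by rewrite fg.
Qed.

Lemma csq_eq f g : (forall t, 0 <= t -> f t = g t) -> csq f -> csq g.
Proof. by move=> fg [f1 f2]; split; [apply: sqsum_eq f1|apply: sqsum_eq f2] => t /fg ->. Qed.

Lemma wsq_eq sg f g : (forall t, 0 <= t -> f t = g t) -> wsq sg f -> wsq sg g.
Proof. by move=> fg; apply: csq_eq => t t0; rewrite fg. Qed.

Lemma wsqD sg f g : wsq sg f -> wsq sg g -> wsq sg (fun t => f t + g t).
Proof.
by move=> fs gs; apply: csq_eq (csqD fs gs) => t _; rewrite mulrDr.
Qed.

Lemma wsqZ sg c f : wsq sg f -> wsq sg (fun t => c * f t).
Proof. by move=> fs; apply: csq_eq (csqZ c fs) => t _; rewrite mulrCA. Qed.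

(** By induction on the factors.  Solving for the first factor shows that J h
    and h = l J h + g are square integrable, where h = P(J) f and P is the
    product of the remaining factors.  The induction hypothesis for the pairs
    (f, h) and (J f, J h) gives q(J) f and q(J) J f, hence one more power of
    J. *)
Lemma res_wsq sg rs f g : (forall l, l \in rs -> Re l + sg < 0) ->
  clocint f -> clocint g -> wsq sg g ->
  (forall t, 0 <= t -> cpol (res_poly rs) f t = g t) ->
  forall p, (size p <= (size rs).+1)%N -> wsq sg (cpol p f).
Proof.
elim: rs f g => [|l rs ih] f g rs0 fi gi gs fE p.
  move=> /size1_polyC ->; apply: wsq_eq (wsqZ p`_0 gs) => t t0.
  rewrite cpol_polyC -fE// /res_poly big_nil.
  by rewrite -[1]/(1%:P) cpol_polyC mul1r.
pose P := res_poly rs; pose h := cpol P f.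
have hi : clocint h := clocint_cpol _ fi.
have cF := ccont0_cprim hi; have pfi := ccont0_clocint (ccont0_cprim fi).
have hE t : 0 <= t -> h t = l * cprim h t + g t.
  move=> t0; rewrite -fE// /res_poly big_cons cpol_factor// -/(res_poly rs) -/P -/h.
  by rewrite addrC subrK.
have Fs : wsq sg (cprim h).
  apply: (@energy_weighted _ sg l 0 g) => //; first by apply: rs0; rewrite mem_head.
  by move=> t t0; rewrite add0r; apply: eq_cprim => s /andP[s0 _]; exact: hE.
have hs : wsq sg h.
  by apply: wsq_eq (wsqD (wsqZ l Fs) gs) => t t0; rewrite hE.
have rs1 l' : l' \in rs -> Re l' + sg < 0 by move=> l'rs; apply: rs0; rewrite inE l'rs orbT.
elim/poly_ind: p => [_|p c _ pc].
  apply: wsq_eq (wsqZ 0 gs) => t _; rewrite mul0r.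
  by rewrite /cpol size_poly0 big_ord0.
have pn : (size p <= (size rs).+1)%N.
  by move: pc; rewrite size_MXaddC; case: ifPn => // /andP[/eqP -> _]; rewrite size_poly0.
have s1 : wsq sg (cpol p (cprim f)).
  apply: (ih _ (cprim h)) => //; first exact: ccont0_clocint.
  by move=> t t0; rewrite cpol_cprim.
have s2 : wsq sg (cpol c%:P f).
  by apply: (ih _ h) => //; exact: (leq_trans (size_polyC_leq1 _)).
apply: wsq_eq (wsqD s1 s2) => t t0; rewrite cpolD; congr (_ + _).
by rewrite cpol_cprim// cpolMX.
Qed.

End VolterraPolynomials.

(** * Polynomials that are positive on the imaginary axis *)

Section SpectralFactorization.
Context {R : realType}.
Notation C := (complex R).
Notation Re := (@complex.Re R).
Notation Im := (@complex.Im R).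
Notation conjp := (map_poly (@conjc R)).
Notation toC := (map_poly (real_complex R)).
Implicit Types (p q c : {poly C}).

Definition sqnorm (z : C) : R := Re z ^+ 2 + Im z ^+ 2.

Lemma sqnormE z : z * conjc z = ((sqnorm z)%:C)%C.
Proof. by case: z => a b; apply: complexP; rewrite cE /sqnorm /=; ring. Qed.

Lemma sqnormM z w : sqnorm (z * w) = sqnorm z * sqnorm w.
Proof. by rewrite /sqnorm !cE; ring. Qed.

Lemma sqnorm_eq0 z : (sqnorm z == 0) = (z == 0).
Proof.
apply/idP/idP => [/eqP h|/eqP ->]; last by rewrite /sqnorm /= !expr0n/= addr0.
have [a b] : Re z = 0 /\ Im z = 0 by apply: sumsq_le0; rewrite -/(sqnorm z) h.
by apply/eqP; exact: complexP.
Qed.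

Lemma sqnorm_ge0 z : 0 <= sqnorm z.
Proof. by rewrite addr_ge0 ?sqr_ge0. Qed.

Lemma real_polyP p : (forall x : R, p.[(x%:C)%C] = 0) -> p = 0.
Proof.
move=> p0; pose rs := [seq ((k%:R : R)%:C)%C | k <- iota 0 (size p)].
apply: (@roots_geq_poly_eq0 _ p rs).
- by apply/allP => z /mapP[k _ ->]; rewrite /root p0.
- rewrite map_inj_uniq ?iota_uniq// => i j /(congr1 Re) /=.
  by move=> /eqP; rewrite eqr_nat => /eqP.
- by rewrite size_map size_iota.
Qed.

Lemma horner_conj p z : (conjp p).[conjc z] = conjc p.[z].
Proof. exact: horner_map. Qed.

(** Fejer-Riesz factorization on the real line: the polynomial is real and has
    no real root, so its roots come in conjugate pairs, and one root of each
    pair is put into c. *)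
Lemma spectral_factor p : (forall x : R, 0 < Re p.[(x%:C)%C] /\ Im p.[(x%:C)%C] = 0) ->
  exists c, p = c * conjp c.
Proof.
elim: {p}(size p) {-2}p (leqnn (size p)) => [|n ih] p pn p0.
  have [] := p0 0; have -> : p = 0 by apply/eqP; rewrite -size_poly_leq0.
  by rewrite horner0 /= ltxx.
have [p1|p1] := leqP (size p) 1.
  have [a pa] : exists a, p = a%:P by exists p`_0; exact: size1_polyC.
  have [r0 i0] := p0 0; move: r0 i0; rewrite pa hornerC => r0 i0.
  exists ((Num.sqrt (Re a))%:C)%C%:P.
  rewrite map_polyC/= -polyCM; congr polyC; apply: complexP; rewrite cE /=.
    by rewrite oppr0 mulr0 subr0 -expr2 sqr_sqrtr// ltW.
  by rewrite oppr0 mul0r mulr0 addr0.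
have [z z0] : exists z, root p z by apply/closed_rootP; rewrite gtn_eqF.
have pconj : conjp p = p.
  apply/eqP; rewrite -subr_eq0; apply/eqP/real_polyP => x.
  rewrite hornerD hornerN.
  have -> : ((x%:C)%C : C) = conjc (x%:C)%C by rewrite conjc_real.
  rewrite horner_conj conjc_real; have [_ i0] := p0 x.
  have hc (v : C) : Im v = 0 -> conjc v - v = 0.
    by case: v => a b /= ->; apply: complexP; rewrite !cE /= ?subrr// oppr0 addr0.
  exact: hc.
have zi : Im z != 0.
  apply/eqP => zi; have [+ _] := p0 (Re z).
  have -> : ((Re z)%:C)%C = z by apply: complexP.
  by rewrite (rootP z0) /= ltxx.
have zz : conjc z != z.
  apply: contra zi => /eqP /(congr1 Im); case: (z) => a b /= h.
  by apply/eqP; lra.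
have z1 : root p (conjc z).
  by rewrite /root -[p in p.[_]]pconj horner_conj (rootP z0) conjc0.
have /factor_theorem[p' p'E] := z0.
have /factor_theorem[p2 p2E] : root p' (conjc z).
  move: z1; rewrite p'E /root hornerM hornerXsubC mulf_eq0 subr_eq0.
  by rewrite (negPf zz) orbF.
have pE : p = p2 * (('X - z%:P) * ('X - (conjc z)%:P)).
  by rewrite p'E p2E -mulrA [X in _ * X]mulrC.
have p2z : p2 != 0.
  apply/eqP => h; have [+ _] := p0 0.
  by rewrite pE h mul0r horner0 /= ltxx.
have [||c cE'] := ih p2.
- move: pn; rewrite pE size_mul ?mulf_neq0 ?polyXsubC_eq0// size_mul ?polyXsubC_eq0//.
  by rewrite !size_XsubC /= addn3 /= ltnS => /ltnW.
- move=> x; have [r0 i0] := p0 x.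
  have nx : 0 < sqnorm ((x%:C)%C - z).
    rewrite lt_neqAle sqnorm_ge0 andbT eq_sym sqnorm_eq0 subr_eq0.
    by apply: contra zi => /eqP <-.
  move: r0 i0; rewrite pE hornerM hornerM !hornerXsubC.
  have -> : (x%:C)%C - conjc z = conjc ((x%:C)%C - z).
    by case: (z) => a b; apply: complexP; rewrite !cE /=; ring.
  rewrite sqnormE !cE /= !mulr0 subr0 add0r.
  rewrite pmulr_lgt0// => ? /eqP; rewrite mulf_eq0 (gt_eqF nx) orbF.
  by move=> /eqP.
exists (('X - z%:P) * c).
rewrite pE cE' rmorphM/= map_polyXsubC; ring.
Qed.

Lemma polyC_split c : c = toC (map_poly Re c) + 'i%C *: toC (map_poly Im c).
Proof.
apply/polyP => k; rewrite coefD coefZ !coef_map_id0//=.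
by apply: complexP; rewrite !cE /=; ring.
Qed.

Lemma coef_toC (p : {poly R}) k : (toC p)`_k = ((p`_k)%:C)%C.
Proof. by rewrite coef_map. Qed.

(** The spectral factorization of W(i x) gives W = b(x) conj b(- x) with b
    complex.  Splitting b into real and imaginary parts and comparing real parts
    turns this product into two real ones of the same kind. *)
Lemma even_part_sos (W : {poly R}) :
  (forall w : R, 0 < Re (toC W).[(0 +i* w)%C] /\ Im (toC W).[(0 +i* w)%C] = 0) ->
  exists c1 c2 : {poly R},
    [/\ W = c1 * (c1 \Po - 'X) + c2 * (c2 \Po - 'X),
        (size c1 <= (size W).+1./2)%N & (size c2 <= (size W).+1./2)%N].
Proof.
move=> W0; pose I : C := 'i%C.
have II : I * I = -1 by rewrite /I -expr2 sqr_i.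
pose pw := toC W \Po (I *: 'X).
have [c cE'] : exists c, pw = c * conjp c.
  apply: spectral_factor => x; rewrite horner_comp hornerZ hornerX.
  have -> : I * (x%:C)%C = (0 +i* x)%C by apply: complexP; rewrite cE /=; ring.
  exact: W0.
have WE : toC W = pw \Po (- I *: 'X).
  rewrite /pw -comp_polyA comp_polyZ comp_polyX scalerA mulrN II opprK scale1r.
  by rewrite comp_polyXr.
pose b := c \Po (- I *: 'X).
have bE : toC W = b * (conjp b \Po - 'X).
  rewrite WE cE' comp_polyM; congr (_ * _).
  have cI : conjc (- I) = I by apply: complexP => /=; rewrite ?oppr0 ?opprK.
  have cIX : conjp (- I *: 'X) = I *: 'X.
    rewrite map_polyZ map_polyX; congr (_ *: _); exact: cI.
  rewrite /b map_comp_poly cIX -comp_polyA; congr (_ \Po _).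
  rewrite comp_polyZ comp_polyX.
  by rewrite scalerN scaleNr.
pose c1 := map_poly Re b; pose c2 := map_poly Im b.
have sb : (size b <= (size W).+1./2)%N.
  have sW : size W = size (toC W) by rewrite size_map_poly.
  have W1 : W != 0.
    apply/eqP => h; have [+ _] := W0 0.
    by rewrite h rmorph0 horner0 /= ltxx.
  have b0 : b != 0.
    apply: contra W1 => /eqP h; rewrite -size_poly_eq0 sW bE h mul0r.
    by rewrite size_poly0.
  have sX : size (- 'X : {poly C}) = 2 by rewrite size_polyN size_polyX.
  have sc : size (conjp b \Po - 'X) = size b.
    rewrite (size_comp_poly2 _ sX).
    exact: size_map_poly.
  have cb0 : conjp b \Po - 'X != 0 by rewrite -size_poly_eq0 sc size_poly_eq0.
  rewrite sW bE size_mul// sc; move: b0; rewrite -size_poly_gt0 => b0.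
  by rewrite prednK ?addn_gt0 ?b0// addnn doubleK.
exists c1, c2; split; last 2 first.
- by apply: (leq_trans (size_poly _ _)).
- by apply: (leq_trans (size_poly _ _)).
have tcomp (p : {poly R}) : toC (p \Po - 'X) = toC p \Po - 'X.
  by rewrite map_comp_poly rmorphN/= map_polyX.
have bs : b = toC c1 + I *: toC c2 by exact: polyC_split.
have bc : conjp b = toC c1 - I *: toC c2.
  apply/polyP => k; rewrite coef_map bs !coefD coefN !coefZ !coef_toC.
  by apply: complexP => /=; rewrite ?cE /=; ring.
have e : toC W = toC (c1 * (c1 \Po - 'X) + c2 * (c2 \Po - 'X)) +
    I *: toC (c2 * (c1 \Po - 'X) - c1 * (c2 \Po - 'X)).
  pose J := I%:P; have JJ : J * J = -1 by rewrite -polyCM II polyCN.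
  rewrite bE bc {1}bs comp_polyB comp_polyZ -!tcomp -!mul_polyC -/J.
  rewrite rmorphD rmorphB !(rmorphM toC).
  set x := toC c1; set y := toC c2; set x' := toC (c1 \Po _); set y' := toC (c2 \Po _).
  transitivity (x * x' + J * (y * x' - x * y') - (J * J) * (y * y')); first ring.
  by rewrite JJ; ring.
apply/polyP => k; have := congr1 (fun p : {poly C} => Re p`_k) e.
rewrite coefD coefZ !coef_toC !cE /= => ->; rewrite /I /=; ring.
Qed.

End SpectralFactorization.

(** * Quadratic functionals of square-integrable solutions *)

Section HankelMoments.
Context {R : realType}.
Notation mu := (@lebesgue_measure R).
Notation half := (`[0%R, +oo[%classic : set R).
Notation C := (complex R).
Notation Re := (@complex.Re R).
Notation Im := (@complex.Im R).
Notation toC := (map_poly (real_complex R)).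

Implicit Types (p q d e : {poly R}) (f : R -> R).

(** p(J) f, for J = [prim]. *)
Definition rpol (p : {poly R}) (f : R -> R) (t : R) : R :=
  \sum_(k < size p) p`_k * iter k prim f t.

Lemma rpolE n p f t : (size p <= n)%N ->
  rpol p f t = \sum_(k < n) p`_k * iter k prim f t.
Proof.
move=> pn; rewrite /rpol (big_ord_widen n (fun k => p`_k * iter k prim f t))//.
rewrite big_mkcond/=; apply: eq_bigr => i _; case: ltnP => // pi.
by rewrite nth_default// mul0r.
Qed.

Lemma Re_iter_cprim k (f : R -> C) t :
  Re (iter k cprim f t) = iter k prim (fun s => Re (f s)) t.
Proof. by elim: k t => //= k ih t; apply: eq_prim => s _. Qed.

Lemma Re_cpol p (f : R -> C) t : Re (cpol (toC p) f t) = rpol p (fun s => Re (f s)) t.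
Proof.
rewrite (@cpolE _ (size p)) ?size_map_poly// raddf_sum; apply: eq_bigr => k _.
transitivity (Re ((toC p)`_k * iter k cprim f t)); first by [].
by rewrite cE coef_toC /= mul0r subr0 Re_iter_cprim.
Qed.

Section Moments.
Variables (z : R -> R) (n : nat).
Hypothesis zs : forall k, (k <= n)%N -> sqsum (iter k prim z).

Let L a b := \int[mu]_(t in half) (iter a prim z t * iter b prim z t).

Let L_shift a b : (a < n)%N -> (b < n)%N -> L a b.+1 = - L a.+1 b.
Proof.
move=> an bn; apply: (@sqsum_by_parts _ (iter a prim z) (iter b prim z)).
- exact/zs/ltnW.
- exact/zs/ltnW.
- exact: (zs an).
- exact: (zs bn).
Qed.

(** The integral of J^k z times z.  Beyond n, where J^k z need not be square
    integrable, antisymmetry of J provides the value by moving k - n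
    integrations to the other factor. *)
Definition moment k := if (k <= n)%N then L k 0 else (-1) ^+ (k - n) * L n (k - n).

Let L_moment a b : (a <= n)%N -> (b <= n)%N -> L a b = (-1) ^+ b * moment (a + b).
Proof.
elim: b a => [|b ih] a an bn; first by rewrite addn0 /moment an expr0 mul1r.
move: an; rewrite leq_eqVlt => /predU1P[->|an].
  have nb : (n + b.+1 <= n)%N = false by rewrite -[X in (_ <= X)%N]addn0 leq_add2l.
  rewrite /moment nb addKn mulrA.
  by rewrite -exprMn mulrNN mulr1 expr1n mul1r.
rewrite L_shift// ih//; last exact: ltnW.
by rewrite exprS mulN1r mulNr addSnnS.
Qed.

Definition moments (p : {poly R}) : R := \sum_(k < size p) p`_k * moment k.

Lemma momentsE m p : (size p <= m)%N -> moments p = \sum_(k < m) p`_k * moment k.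
Proof.
move=> pn; rewrite /moments (big_ord_widen m (fun k => p`_k * moment k))//.
rewrite big_mkcond/=; apply: eq_bigr => i _; case: ltnP => // pi.
by rewrite nth_default// mul0r.
Qed.

Lemma momentsD p q : moments (p + q) = moments p + moments q.
Proof.
rewrite !(@momentsE (maxn (size p) (size q))) ?leq_maxl ?leq_maxr ?size_polyD//.
by rewrite -big_split; apply: eq_bigr => i _; rewrite coefD mulrDl.
Qed.

Lemma momentsZ c p : moments (c *: p) = c * moments p.
Proof.
rewrite (@momentsE (size p)) ?size_scale_leq// /moments mulr_sumr.
by apply: eq_bigr => i _; rewrite coefZ mulrA.
Qed.

Lemma momentsN p : moments (- p) = - moments p.
Proof. by rewrite -scaleN1r momentsZ mulN1r. Qed.

Lemma moments_sum I (r : seq I) (F : I -> {poly R}) :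
  moments (\sum_(i <- r) F i) = \sum_(i <- r) moments (F i).
Proof.
elim: r => [|i r ih]; last by rewrite !big_cons momentsD ih.
by rewrite !big_nil /moments size_poly0 big_ord0.
Qed.

Lemma momentsXn k : moments 'X^k = moment k.
Proof.
rewrite (@momentsE k.+1) ?size_polyXn// big_ord_recr/= coefXn eqxx mul1r.
rewrite big1 ?add0r// => i _; rewrite coefXn.
by rewrite (ltn_eqF (ltn_ord i)) mul0r.
Qed.

Lemma sqsum_rpol p : (size p <= n.+1)%N -> sqsum (rpol p z).
Proof.
move=> pn; rewrite (_ : rpol p z = fun t => \sum_(k < size p) p`_k * iter k prim z t)//.
elim: (size p) pn => [|m ih] mn.
  apply: (@sqsum_eq _ (fun t => 0 * z t)); last by apply: sqsumZ; exact: (zs (leq0n n)).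
  by move=> t _; rewrite big_ord0 mul0r.
apply: (@sqsum_eq _ (fun t => \sum_(k < m) p`_k * iter k prim z t + p`_m * iter m prim z t)).
  by move=> t _; rewrite big_ord_recr.
by apply: sqsumD; [apply: ih; exact: ltnW|apply: sqsumZ; exact: zs].
Qed.

(** Expanding the square, the integral of J^a z times J^b z is (-1)^b times the
    moment of order a + b, which is what x^a (-x)^b contributes. *)
Lemma int_rpol_sqr p : (size p <= n.+1)%N ->
  \int[mu]_(t in half) (rpol p z t ^+ 2) = moments (p * (p \Po - 'X)).
Proof.
move=> pn.
have xi a b : (a < n.+1)%N -> (b < n.+1)%N ->
    summable_on half (fun t => iter a prim z t * iter b prim z t).
  by move=> an bn; apply: sqsumM; exact: zs.
have Rsum m (F : 'I_m -> R -> R) : (forall i, summable_on half (F i)) ->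
    summable_on half (fun t => \sum_(i < m) F i t) /\
    \int[mu]_(t in half) (\sum_(i < m) F i t) = \sum_(i < m) \int[mu]_(t in half) F i t.
  elim: m F => [|m ih] F Fi.
    have E : (fun t : R => \sum_(i < 0) F i t) = cst 0 by apply/funext => t; rewrite big_ord0.
    rewrite E big_ord0; split; first exact: integrable0.
    by rewrite /Rintegral integral0.
  have E : (fun t : R => \sum_(i < m.+1) F i t) =
      fun t => \sum_(i < m) F (widen_ord (leqnSn m) i) t + F ord_max t.
    by apply/funext => t; rewrite big_ord_recr.
  have [s1 e1] := ih (fun i => F (widen_ord (leqnSn m) i)) (fun i => Fi _).
  rewrite E; split; first exact: summable_onD.
  rewrite big_ord_recr/= -e1.
  by apply: RintegralD => //; exact: Fi.
transitivity (\sum_(a < n.+1) \sum_(b < n.+1) p`_a * p`_b * L a b).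
  transitivity (\int[mu]_(t in half) \sum_(a < n.+1) \sum_(b < n.+1)
     (p`_a * p`_b * (iter a prim z t * iter b prim z t))).
    apply: eq_Rintegral => t _; rewrite (rpolE _ _ pn) expr2 mulr_suml.
    apply: eq_bigr => a _; rewrite mulr_sumr; apply: eq_bigr => b _.
    by rewrite mulrACA.
  have i1 (a : 'I_n.+1) := Rsum _ (fun (b : 'I_n.+1) t =>
    p`_a * p`_b * (iter a prim z t * iter b prim z t))
    (fun b => summable_onZ _ (measurable_itv _) (xi _ _ (ltn_ord a) (ltn_ord b))).
  have [_ ->] := Rsum _ (fun (a : 'I_n.+1) t => \sum_(b < n.+1)
     (p`_a * p`_b * (iter a prim z t * iter b prim z t))) (fun a => (i1 a).1).
  apply: eq_bigr => a _; rewrite (i1 a).2; apply: eq_bigr => b _.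
  by rewrite RintegralZl//; exact: xi.
have pE : p = \sum_(a < n.+1) p`_a *: 'X^a.
  rewrite -poly_def; apply/polyP => k; rewrite coef_poly; case: ltnP => // kn.
  by rewrite nth_default// (leq_trans pn).
rewrite [in RHS]pE raddf_sum/= mulr_suml moments_sum; apply: eq_bigr => a _.
rewrite mulr_sumr moments_sum; apply: eq_bigr => b _.
rewrite comp_polyZ comp_Xn_poly.
have -> : (p`_a *: 'X^a) * (p`_b *: (- 'X) ^+ b) =
    (p`_a * p`_b * (-1) ^+ b) *: 'X^(a + b) :> {poly R}.
  rewrite -!mul_polyC (exprNn ('X : {poly R})) !polyCM exprD.
  have -> : ((-1) ^+ b)%:P = (-1) ^+ b :> {poly R} by rewrite rmorphXn/= polyCN.
  by move: ((-1) ^+ b) => s; ring.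
have an : (a <= n)%N by rewrite -ltnS.
have bn : (b <= n)%N by rewrite -ltnS.
by rewrite momentsZ momentsXn (L_moment an bn) [LHS]mulrA.
Qed.

Lemma horner_toC_conj (p : {poly R}) (x : C) :
  (toC p).[conjc x] = conjc (toC p).[x].
Proof.
rewrite -[in LHS](_ : map_poly (@conjc R) (toC p) = toC p) ?horner_conj//.
by apply/polyP => k; rewrite coef_map coef_toC /= oppr0.
Qed.

Lemma toC_even (p : {poly R}) (w : R) :
  (toC (p * (p \Po - 'X))).[(0 +i* w)%C] = ((sqnorm (toC p).[(0 +i* w)%C])%:C)%C.
Proof.
rewrite rmorphM/= map_comp_poly rmorphN/= map_polyX hornerM horner_comp hornerN hornerX.
have -> : - (0 +i* w)%C = conjc (0 +i* w)%C by apply: complexP; rewrite ?cE /= ?oppr0.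
by rewrite horner_toC_conj sqnormE.
Qed.

(** Only the linear functional of W = c d(x) d(-x) - e(x) e(-x) has to be
    nonnegative.  For c > g^2 the polynomial W is positive on the imaginary
    axis, hence a sum of two terms q(x) q(-x), and each of them is the integral
    of a square. *)
Lemma gain_bound d e g : (size d <= n.+1)%N -> (size e <= n.+1)%N -> 0 <= g ->
  (forall w : R, (toC d).[(0 +i* w)%C] != 0) ->
  (forall w : R, sqnorm (toC e).[(0 +i* w)%C] <= g ^+ 2 * sqnorm (toC d).[(0 +i* w)%C]) ->
  \int[mu]_(t in half) (rpol e z t ^+ 2) <=
  g ^+ 2 * \int[mu]_(t in half) (rpol d z t ^+ 2).
Proof.
move=> dn en g0 d0 ed.
(* A strict inequality is needed for the spectral factorization; c tends to g^2
   at the end. *)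
suff key c : g ^+ 2 < c -> \int[mu]_(t in half) (rpol e z t ^+ 2) <=
    c * \int[mu]_(t in half) (rpol d z t ^+ 2).
  set I := \int[mu]_(t in half) (rpol d z t ^+ 2).
  have I0 : 0 <= I by apply: Rintegral_ge0 => t _; exact: sqr_ge0.
  apply/ler_addgt0Pr => eps eps0.
  have := key (g ^+ 2 + eps / (I + 1)) _; rewrite -/I mulrDl => /(_ _)/le_trans; apply.
    by rewrite ltrDl divr_gt0// ltr_wpDl.
  rewrite lerD2l mulrAC ler_pdivrMr ?ltr_wpDl//.
  by rewrite ler_wpM2l ?(ltW eps0)// lerDl.
move=> gc.
pose W := c *: (d * (d \Po - 'X)) - e * (e \Po - 'X).
have Wv w : (toC W).[(0 +i* w)%C] =
    ((c * sqnorm (toC d).[(0 +i* w)%C] - sqnorm (toC e).[(0 +i* w)%C])%:C)%C.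
  rewrite rmorphB/= map_polyZ hornerD hornerN hornerZ !toC_even.
  by apply: complexP; rewrite ?cE /=; ring.
have W0 (w : R) : 0 < Re (toC W).[(0 +i* w)%C] /\ Im (toC W).[(0 +i* w)%C] = 0.
  rewrite Wv /=; split=> //; rewrite subr_gt0 (le_lt_trans (ed w))// ltr_pM2r//.
  by rewrite lt_neqAle eq_sym sqnorm_eq0 d0 sqnorm_ge0.
have [c1 [c2 [WE s1 s2]]] := even_part_sos W0.
have sx (q : {poly R}) : size (q \Po - 'X) = size q.
  by apply: size_comp_poly2; rewrite size_polyN size_polyX.
have sq (q : {poly R}) : (size q <= n.+1)%N -> (size (q * (q \Po - 'X))%R <= n.*2.+1)%N.
  move=> sqnorm_imag; apply: (leq_trans (size_polyMleq _ _)); rewrite sx.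
  by rewrite addnn; case: (size q) sqnorm_imag => // k kn; rewrite doubleS /= ltnS leq_double.
have sW : (size W <= n.*2.+1)%N.
  apply: (leq_trans (size_polyD _ _)); rewrite geq_max size_polyN sq// andbT.
  by apply: (leq_trans (size_scale_leq _ _)); exact: sq.
have h1 : ((size W).+1./2 <= n.+1)%N.
  by apply: (leq_trans (half_leq (_ : _ <= n.*2.+2)%N)) => //; rewrite -doubleS doubleK.
rewrite -subr_ge0 (int_rpol_sqr dn) (int_rpol_sqr en).
have -> : c * moments (d * (d \Po - 'X)) - moments (e * (e \Po - 'X)) = moments W.
  by rewrite /W momentsD momentsN momentsZ.
rewrite WE momentsD -!int_rpol_sqr ?(leq_trans s1)// ?(leq_trans s2)//.
by rewrite addr_ge0//; apply: Rintegral_ge0 => t _; exact: sqr_ge0.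
Qed.

End Moments.
End HankelMoments.

(** * Convolution on an interval *)

Section Reflection.
Context {R : realType}.
Notation mu := (@lebesgue_measure R).
Notation half := (`[0%R, +oo[%classic : set R).
Notation C := (complex R).
Notation Re := (@complex.Re R).
Notation Im := (@complex.Im R).
Notation toC := (map_poly (real_complex R)).
Implicit Types (f g p q : R -> R).

(** Freezing f at its value at 0 to the left of 0 makes continuity on [0, t] for
    all t a continuity on the whole line. *)
Lemma clamp_continuous f : cont0 f -> continuous (fun x : R => f (Num.max x 0)).
Proof.
move=> cf x; have [x0|x0|<-] := ltgtP 0 x; last first.
- apply/left_right_continuousP; rewrite maxxx; split.
    apply: cvg_near_cst; near=> y; congr f.
    by apply/max_r/ltW; near: y; exact: nbhs_left_lt.
  have /continuous_within_itvP[//|_ + _] := cf 1.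
  move=> h; apply: cvg_trans h; apply: near_eq_cvg; near=> y.
  by congr f; apply/esym/max_l/ltW; near: y; exact: nbhs_right_gt.
- rewrite /continuous_at (max_r (ltW x0)).
  apply: cvg_near_cst; near=> y; congr f.
  by apply/max_r/ltW; near: y; exact: lt_nbhsl.
- rewrite /continuous_at (max_l (ltW x0)).
  have x1 : 0 < x + 1 by rewrite addr_gt0.
  have /continuous_within_itvP[//|h _ _] := cf (x + 1).
  have xi : x \in `]0, (x + 1)[ by rewrite in_itv/= x0 ltrDl ltr01.
  apply: cvg_trans (h x xi); apply: near_eq_cvg; near=> y.
  by congr f; apply/esym/max_l/ltW; near: y; exact: lt_nbhsr.
Unshelve. all: by end_near. Qed.

(** The reflection s |-> f (T - s).  Its argument is clamped at 0, so that it is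
    continuous on the whole line and not only on [0, T]. *)
Definition refl T f s := f (Num.max (T - s) 0).

Lemma cont0_refl T f : cont0 f -> cont0 (refl T f).
Proof.
move=> cf; apply: cont0_continuous => s; rewrite /refl.
apply: (@continuous_comp _ _ _ (fun s : R => T - s) (fun x : R => f (Num.max x 0))).
  by apply: cvgB; [exact: cvg_cst|exact: cvg_id].
exact: clamp_continuous.
Qed.

Lemma prim_refl T f s : cont0 f -> 0 <= s <= T ->
  prim (refl T f) s = prim f T - prim f (T - s).
Proof.
move=> cf /andP[s0 sT]; have Ts : 0 <= T - s by rewrite subr_ge0.
have fi := cont0_locint cf.
rewrite -prim_tail ?Ts ?gerBl// Rintegral_itv_obnd_cbnd; last first.
  apply: summable_onS (fi T) => //.
  by apply: subset_itvr; rewrite bnd_simp.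
rewrite /prim /Rintegral; congr fine.
have dF : derive1 (fun x : R => T - x) = cst (-1).
  by apply/funext => x; rewrite derive1E deriveB// derive_cst derive_id sub0r.
have := @integration_by_substitution_decreasing R (fun x => T - x) f 0 s s0.
rewrite subr0 => ->.
- apply: eq_integral => x; rewrite inE/= in_itv/= => /andP[x0 xs].
  rewrite dF /= !fctE /= opprK mulr1 /refl max_l// subr_ge0//.
  exact: le_trans xs sT.
- by move=> x y _ _ xy; rewrite ltrD2l ltrN2.
- by rewrite dF => x _; exact: cvg_cst.
- by rewrite dF; exact: is_cvg_cst.
- by rewrite dF; exact: is_cvg_cst.
- split.
  + by move=> x _; apply: derivableB.
  + apply: cvg_at_right_filter; apply: cvgB; [exact: cvg_cst|exact: cvg_id].
  + apply: cvg_at_left_filter; apply: cvgB; [exact: cvg_cst|exact: cvg_id].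
- apply: continuous_subspaceW (cf T).
  by apply: subset_itvr; rewrite bnd_simp.
Qed.

Definition convol f g T := prim (fun s => refl T f s * g s) T.

(** J commutes with convolution: integration by parts, the primitive of the
    reflected f being J f T - J f (T - s). *)
Lemma convol_prim f g T : cont0 f -> locint g -> 0 <= T ->
  convol (prim f) g T = convol f (prim g) T.
Proof.
move=> cf gi T0; have cr := @cont0_refl T f cf; have ri := cont0_locint cr.
have pr := cont0_prim ri; have pg := cont0_prim gi.
have TT : 0 <= T <= T by rewrite T0 lexx.
have pT : prim (refl T f) T = prim f T.
  by rewrite (prim_refl cf TT) subrr prim0 subr0.
rewrite /convol; transitivity (prim (fun s => prim f T * g s +
    - 1 * (g s * prim (refl T f) s)) T).
  apply: eq_prim => s /andP[s0 sT]; rewrite (prim_refl cf) ?s0//.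
  by rewrite {1}/refl max_l ?subr_ge0//; ring.
rewrite primD; [|exact: locintZ|exact/locintZ/locintM].
rewrite !primZ//; last exact: locintM.
have e1 := primM T ri gi; have e2 := primD T (locintM ri pg) (locintM gi pr).
by rewrite -pT e1 e2 mulN1r addrK.
Qed.

Lemma eq_convol f f' g g' T : (forall s, 0 <= s <= T -> f s = f' s) ->
  (forall s, 0 <= s <= T -> g s = g' s) -> 0 <= T -> convol f g T = convol f' g' T.
Proof.
move=> ff gg T0; apply: eq_prim => s /andP[s0 sT].
rewrite /refl max_l ?subr_ge0// ff ?gg ?s0//.
by rewrite subr_ge0 sT gerBl.
Qed.

Lemma cont0_iter_prim k f : cont0 f -> cont0 (iter k prim f).
Proof. by move=> cf; elim: k => //= k ih; apply/cont0_prim/cont0_locint. Qed.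

Lemma locint_iter k f : locint f -> locint (iter k prim f).
Proof. by move=> fi; elim: k => //= k ih; apply/cont0_locint/cont0_prim. Qed.

Lemma convol_iter k f g T : cont0 f -> locint g -> 0 <= T ->
  convol (iter k prim f) g T = convol f (iter k prim g) T.
Proof.
move=> cf gi T0; elim: k g gi => // k ih g gi.
rewrite iterS (convol_prim (@cont0_iter_prim k f cf) gi T0).
rewrite (ih _ (cont0_locint (cont0_prim gi))).
by rewrite -iterSr.
Qed.

Lemma sum_locint n (F : 'I_n -> R -> R) : (forall i, locint (F i)) ->
  locint (fun s => \sum_(i < n) F i s) /\
  forall t, prim (fun s => \sum_(i < n) F i s) t = \sum_(i < n) prim (F i) t.
Proof.
elim: n F => [|n ih] F Fi.
  have -> : (fun s : R => \sum_(i < 0) F i s) = fun=> 0.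
    by apply/funext => s; rewrite big_ord0.
  split; first exact/cont0_locint/cont0_cst.
  by move=> t; rewrite big_ord0 /prim /Rintegral integral0.
have -> : (fun s => \sum_(i < n.+1) F i s) =
    fun s => \sum_(i < n) F (widen_ord (leqnSn n) i) s + F ord_max s.
  by apply/funext => s; rewrite big_ord_recr.
have [l e] := ih (fun i => F (widen_ord (leqnSn n) i)) (fun i => Fi _).
split; first exact: locintD.
by move=> t; rewrite primD// e big_ord_recr.
Qed.

Lemma locint_rpol (p : {poly R}) f : locint f -> locint (rpol p f).
Proof. by move=> fi; apply: (sum_locint _).1 => i; apply/locintZ/locint_iter. Qed.

Lemma sum_cont0 n (F : 'I_n -> R -> R) : (forall i, cont0 (F i)) ->
  cont0 (fun s => \sum_(i < n) F i s).
Proof.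
elim: n F => [|n ih] F Fi.
  have -> : (fun s : R => \sum_(i < 0) F i s) = fun=> 0.
    by apply/funext => s; rewrite big_ord0.
  exact: cont0_cst.
have -> : (fun s => \sum_(i < n.+1) F i s) =
    fun s => \sum_(i < n) F (widen_ord (leqnSn n) i) s + F ord_max s.
  by apply/funext => s; rewrite big_ord_recr.
by apply: cont0D => //; exact: ih.
Qed.

Lemma cont0Z c f : cont0 f -> cont0 (fun s => c * f s).
Proof. by move=> cf; apply: cont0M => //; exact: cont0_cst. Qed.

Lemma cont0_rpol (p : {poly R}) f : cont0 f -> cont0 (rpol p f).
Proof. by move=> fi; apply: sum_cont0 => i; apply/cont0Z/cont0_iter_prim. Qed.

Lemma convol_rpol (p : {poly R}) f g T : cont0 f -> locint g -> 0 <= T ->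
  convol (rpol p f) g T = convol f (rpol p g) T.
Proof.
move=> cf gi T0.
transitivity (prim (fun s => \sum_(k < size p)
    p`_k * (g s * refl T (iter k prim f) s)) T).
  apply: eq_prim => s _; rewrite /refl /rpol mulr_suml; apply: eq_bigr => k _.
  by rewrite mulrAC mulrA.
rewrite (sum_locint _).2; last first.
  by move=> k; apply/locintZ/locintM => //; apply/cont0_refl/cont0_iter_prim.
transitivity (\sum_(k < size p) p`_k * convol f (iter k prim g) T).
  apply: eq_bigr => k _; rewrite primZ; last first.
    by apply/locintM => //; apply/cont0_refl/cont0_iter_prim.
  rewrite -convol_iter//; congr (_ * _); apply: eq_prim => s _; exact: mulrC.
transitivity (prim (fun s => \sum_(k < size p)
    p`_k * (iter k prim g s * refl T f s)) T); last first.
  apply: eq_prim => s _; rewrite /rpol mulr_sumr; apply: eq_bigr => k _.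
  by rewrite mulrA mulrC.
rewrite (sum_locint _).2; last first.
  by move=> k; apply/locintZ/locintM; [exact: locint_iter|exact: cont0_refl].
apply: eq_bigr => k _; rewrite primZ; last first.
  by apply/locintM; [exact: locint_iter|exact: cont0_refl].
by congr (_ * _); apply: eq_prim => s _; exact: mulrC.
Qed.

Notation emb f := (fun t : R => ((f t)%:C)%C).

Lemma clocint_emb f : locint f -> clocint (emb f).
Proof. by move=> fi; split=> //; exact/cont0_locint/cont0_cst. Qed.

Lemma ccont0_emb f : cont0 f -> ccont0 (emb f).
Proof. by move=> fi; split=> //; exact: cont0_cst. Qed.

Lemma cpol_emb (p : {poly R}) f t : cpol (toC p) (emb f) t = ((rpol p f t)%:C)%C.
Proof.
apply: complexP; rewrite ?Re_cpol//=.
rewrite (@cpolE _ (size p)) ?size_map_poly//.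
have it k s : iter k cprim (emb f) s = ((iter k prim f s)%:C)%C.
  elim: k s => //= k ih s; apply: complexP => /=.
    by apply: eq_prim => r _; rewrite ih.
  transitivity (prim (fun=> 0 : R) s); first by apply: eq_prim => r _; rewrite ih.
  by rewrite /prim /Rintegral integral0.
transitivity (Im (((\sum_(k < size p) p`_k * iter k prim f t)%:C)%C)); last by [].
congr Im; rewrite rmorph_sum/=; apply: eq_bigr => k _.
by rewrite it coef_toC rmorphM.
Qed.

Lemma rpolM (p q : {poly R}) f t : locint f -> rpol (p * q) f t = rpol p (rpol q f) t.
Proof.
move=> fi; have := congr1 Re (cpol_emb (p * q) f t) => /= <-.
rewrite rmorphM/= cpolM; last exact: clocint_emb.
rewrite -[RHS]/(Re ((rpol p (rpol q f) t)%:C)%C) -cpol_emb; congr Re.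
by congr (cpol _ _ _); apply/funext => s; rewrite cpol_emb.
Qed.

End Reflection.

(** * Fourier transforms on the half-line *)

Section Fourier.
Context {R : realType}.
Notation mu := (@lebesgue_measure R).
Notation half := (`[0%R, +oo[%classic : set R).
Notation C := (complex R).
Notation Re := (@complex.Re R).
Notation Im := (@complex.Im R).
Implicit Types (f g F phi : R -> C) (p : {poly C}) (w : R).

Definition csum f :=
  summable_on half (fun t => Re (f t)) /\ summable_on half (fun t => Im (f t)).

Definition cint f : C :=
  (\int[mu]_(t in half) Re (f t) +i* \int[mu]_(t in half) Im (f t))%C.

Lemma csum_eq f g : (forall t, 0 <= t -> f t = g t) -> csum f -> csum g.
Proof.
move=> fg [f1 f2]; split; [apply: eq_integrable f1|apply: eq_integrable f2] => // t;
  by rewrite inE/= in_itv/= andbT => t0; rewrite fg.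
Qed.

Lemma cint_eq f g : (forall t, 0 <= t -> f t = g t) -> cint f = cint g.
Proof.
move=> fg; congr Complex; apply: eq_Rintegral => t;
  by rewrite inE/= in_itv/= andbT => t0; rewrite fg.
Qed.

Lemma csum_clocint f : csum f -> clocint f.
Proof. by case=> f1 f2; split; exact: summable_locint. Qed.

Lemma csumD f g : csum f -> csum g -> csum (fun t => f t + g t).
Proof.
move=> [f1 f2] [g1 g2]; split; under [X in summable_on _ X]eq_fun do rewrite cE.
  exact: summable_onD.
exact: summable_onD.
Qed.

Lemma cintD f g : csum f -> csum g -> cint (fun t => f t + g t) = cint f + cint g.
Proof.
move=> [f1 f2] [g1 g2]; apply: complexP; rewrite cE /= -RintegralD//;
  by apply: eq_Rintegral => t _; rewrite cE.
Qed.

Lemma csumZ c f : csum f -> csum (fun t => c * f t).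
Proof.
move=> [f1 f2]; split; under [X in summable_on _ X]eq_fun do rewrite cE.
  under [X in summable_on _ X]eq_fun do rewrite -mulNr.
  by apply: summable_onD => //; exact: summable_onZ.
by apply: summable_onD => //; exact: summable_onZ.
Qed.

Lemma cintZ c f : csum f -> cint (fun t => c * f t) = c * cint f.
Proof.
move=> [f1 f2]; apply: complexP; rewrite cE /=.
  rewrite -mulNr -!RintegralZl// -RintegralD//; [|exact: summable_onZ..].
  by apply: eq_Rintegral => t _; rewrite cE mulNr.
rewrite -!RintegralZl// -RintegralD//; [|exact: summable_onZ..].
by apply: eq_Rintegral => t _; rewrite cE.
Qed.

Lemma cint_vanish F phi c : csum phi -> csum F ->
  (forall t, 0 <= t -> F t = c + cprim phi t) -> c + cint phi = 0.
Proof.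
move=> [p1 p2] [F1 F2] FE; apply: complexP; rewrite cE /=.
  by apply: vanish_at_oo F1 => // t t0; rewrite FE// cE.
by apply: vanish_at_oo F2 => // t t0; rewrite FE// cE.
Qed.

Definition kern w := cexp (0 -i* w)%C.

Lemma kernE w t : kern w t = (cos (w * t) -i* sin (w * t))%C.
Proof. by rewrite /kern /cexp /= mul0r expR0 !mul1r mulNr cosN sinN. Qed.

Lemma measurable_cosM w (A : set R) : measurable_fun A (fun t : R => cos (w * t)).
Proof.
apply: measurable_funTS; apply: continuous_measurable_fun.
exact: continuous_cosM.
Qed.

Lemma measurable_sinM w (A : set R) : measurable_fun A (fun t : R => sin (w * t)).
Proof.
apply: measurable_funTS; apply: continuous_measurable_fun.
exact: continuous_sinM.
Qed.

Lemma norm_cos_le1 (x : R) : `|cos x| <= 1.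
Proof. by rewrite ler_norml cos_geN1 cos_le1. Qed.

Lemma norm_sin_le1 (x : R) : `|sin x| <= 1.
Proof. by rewrite ler_norml sin_geN1 sin_le1. Qed.

Lemma summable_cosM w (A : set R) (f : R -> R) : measurable A -> summable_on A f ->
  summable_on A (fun t => f t * cos (w * t)).
Proof.
move=> mA fi; apply: (@summable_onM _ _ _ _ 1) => //.
  exact: measurable_cosM.
by move=> x _; exact: norm_cos_le1.
Qed.

Lemma summable_sinM w (A : set R) (f : R -> R) : measurable A -> summable_on A f ->
  summable_on A (fun t => f t * sin (w * t)).
Proof.
move=> mA fi; apply: (@summable_onM _ _ _ _ 1) => //.
  exact: measurable_sinM.
by move=> x _; exact: norm_sin_le1.
Qed.

Lemma csum_kern w f : csum f -> csum (fun t => kern w t * f t).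
Proof.
move=> [f1 f2]; split.
  rewrite [X in summable_on _ X](_ : _ = fun t =>
      Re (f t) * cos (w * t) + Im (f t) * sin (w * t)); last first.
    by apply/funext => t; rewrite kernE cE /=; ring.
  by apply: summable_onD => //; [exact: summable_cosM|exact: summable_sinM].
rewrite [X in summable_on _ X](_ : _ = fun t =>
    Im (f t) * cos (w * t) + -1 * (Re (f t) * sin (w * t))); last first.
  by apply/funext => t; rewrite kernE cE /=; ring.
apply: summable_onD => //; first exact: summable_cosM.
by apply: summable_onZ => //; exact: summable_sinM.
Qed.

(** For functions on the half-line, at the point i w of the imaginary axis. *)
Definition fourier w f := cint (fun t => kern w t * f t).

Lemma fourierD w f g : csum f -> csum g ->
  fourier w (fun t => f t + g t) = fourier w f + fourier w g.
Proof.
move=> fi gi; rewrite /fourier -cintD; [|exact: csum_kern..].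
by apply: cint_eq => t _; rewrite mulrDr.
Qed.

Lemma fourierZ w c f : csum f -> fourier w (fun t => c * f t) = c * fourier w f.
Proof.
move=> fi; rewrite /fourier -cintZ; last exact: csum_kern.
by apply: cint_eq => t _; rewrite mulrCA.
Qed.

(** The Laplace transform of a derivative at s = i w, the constant c being the
    value of F at 0. *)
Lemma fourier_prim w c F phi : csum phi -> csum F ->
  (forall t, 0 <= t -> F t = c + cprim phi t) ->
  fourier w phi = (0 +i* w)%C * fourier w F - c.
Proof.
move=> pi Fi FE.
have Zi := csumZ (0 -i* w)%C Fi.
have E := cexp_shift (0 -i* w)%C (csum_clocint pi) FE.
have := cint_vanish (csum_kern w (csumD pi Zi)) (csum_kern w Fi) E.
rewrite -/(fourier w _) fourierD// fourierZ// => h.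
apply/eqP; rewrite -subr_eq0; apply/eqP; rewrite -[RHS]h.
have -> : (0 -i* w)%C = - (0 +i* w)%C :> C by apply: complexP; rewrite ?cE /= ?oppr0.
ring.
Qed.

(** The Fourier transform turns J into multiplication by 1 / (i w), provided
    that all the functions involved are integrable. *)
Lemma fourier_cpol w n f : w != 0 -> clocint f ->
  (forall q : {poly C}, (size q <= n.+1)%N -> csum (cpol q f)) ->
  forall p, (size p <= n.+1)%N ->
    fourier w (cpol p f) = p.[((0 +i* w)^-1)%C] * fourier w f.
Proof.
move=> w0 fi fs; have f0 : csum f.
  apply: csum_eq (fs 1 _); last by rewrite size_poly1.
  by move=> t _; rewrite -[1]/(1%:P) cpol_polyC mul1r.
set x := ((0 +i* w)^-1)%C.
have iw : (0 +i* w)%C != 0 :> C.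
  by apply: contra w0 => /eqP /(congr1 Im) /= ->.
elim/poly_ind => [|p c ih] pn.
  rewrite horner0 mul0r /fourier.
  rewrite (@cint_eq _ (fun t => 0 * (kern w t * f t))).
    by rewrite cintZ ?mul0r//; exact: csum_kern.
  by move=> t _; rewrite /cpol size_poly0 big_ord0 mulr0 mul0r.
have pn' : (size p <= n)%N.
  by move: pn; rewrite size_MXaddC; case: ifPn => // /andP[/eqP -> _]; rewrite size_poly0.
have s1 := fs p (leqW pn').
have s2 : csum (cpol (p * 'X) f).
  apply: fs; apply: (leq_trans (size_polyMleq _ _)).
  by rewrite size_polyX addn2.
have s3 : csum (cpol c%:P f) by apply: fs; exact: (leq_trans (size_polyC_leq1 _)).
rewrite /fourier (@cint_eq _ (fun t => kern w t * (cpol (p * 'X) f t + cpol c%:P f t))).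
  rewrite -/(fourier _ _) fourierD//.
  have e1 := @fourier_prim w 0 (cpol (p * 'X) f) (cpol p f) s1 s2 _.
  have -> : fourier w (cpol (p * 'X) f) = x * fourier w (cpol p f).
    rewrite e1 ?subr0 /x ?mulKf//.
    by move=> t _; rewrite add0r cpolMX.
  rewrite ih ?(leqW pn')//.
  have -> : fourier w (cpol c%:P f) = c * fourier w f.
    by rewrite -fourierZ//; apply: cint_eq => t _; rewrite cpol_polyC.
  by rewrite -/(fourier w f) hornerMXaddC; ring.
by move=> t _; rewrite cpolD.
Qed.

Lemma csqM f g : csq f -> csq g -> csum (fun t => f t * g t).
Proof.
move=> [f1 f2] [g1 g2]; split.
  rewrite [X in summable_on _ X](_ : _ = fun t =>
      Re (f t) * Re (g t) + -1 * (Im (f t) * Im (g t))); last first.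
    by apply/funext => t; rewrite cE mulN1r.
  apply: summable_onD => //; first exact: sqsumM.
  by apply: summable_onZ => //; exact: sqsumM.
rewrite [X in summable_on _ X](_ : _ = fun t =>
    Re (f t) * Im (g t) + Im (f t) * Re (g t)); last first.
  by apply/funext => t; rewrite cE.
by apply: summable_onD => //; exact: sqsumM.
Qed.

Lemma sqsum0 : sqsum (fun=> 0 : R).
Proof.
split; first exact: measurable_cst.
rewrite [X in summable_on _ X](_ : _ = fun=> 0); first exact: integrable0.
by apply/funext => t; rewrite expr0n.
Qed.

Lemma csq0 : csq (fun _ : R => 0 : C).
Proof. by split; exact: sqsum0. Qed.

Lemma csq_cexp (l : C) : Re l < 0 -> csq (cexp l).
Proof.
move=> l0; apply: (@energy _ l 1 (fun=> 0)) => //; first exact: csq0.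
  exact: ccont0_cexp.
by move=> t t0; rewrite [LHS]cexpE//; congr (_ + _); apply: eq_cprim => s _; rewrite addr0.
Qed.

(** A product of two square-integrable functions, one of them the decaying
    exponential exp(- sg t). *)
Lemma wsq_csum (sg : R) f : 0 < sg -> wsq sg f -> csum f.
Proof.
move=> s0 fs.
have cs : csq (cexp (- (sg%:C)%C)) by apply: csq_cexp; rewrite cE /= oppr_lt0.
apply: csum_eq (csqM cs fs) => t _.
by rewrite mulrA cexpN mul1r.
Qed.

Lemma cexp_real (r t : R) : cexp (r%:C)%C t = ((expR (r * t))%:C)%C.
Proof. by rewrite /cexp /= mul0r cos0 sin0 mulr1 mulr0. Qed.

Lemma csum_exp (e : R) : 0 < e -> csum (cexp ((- e)%:C)%C).
Proof.
move=> e0; have cs : csq (cexp ((- (e / 2))%:C)%C).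
  by apply: csq_cexp; rewrite /= oppr_lt0 divr_gt0.
apply: csum_eq (csqM cs cs) => t _; rewrite !cexp_real.
apply: complexP; rewrite cE /=; last ring.
by rewrite mulr0 subr0 -expRD; congr expR; field.
Qed.

(** The real part of the Fourier transform of exp(- e t), which is 1 / (e + i
    tau). *)
Lemma int_exp_cos (e tau : R) : 0 < e ->
  \int[mu]_(t in half) (expR (- e * t) * cos (tau * t)) = e / (e ^+ 2 + tau ^+ 2).
Proof.
move=> e0; have cs := csum_exp e0.
have := @fourier_prim tau 1 _ _ (csumZ ((- e)%:C)%C cs) cs
   (fun t t0 => cexpE ((- e)%:C)%C t0).
rewrite fourierZ//; set X := fourier _ _ => h.
have h1 : (e +i* tau)%C * X = 1.
  rewrite (_ : (e +i* tau)%C = (0 +i* tau)%C - ((- e)%:C)%C); last first.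
    by apply: complexP; rewrite !cE /=; ring.
  by rewrite mulrBl h; ring.
have -> : \int[mu]_(t in half) (expR (- e * t) * cos (tau * t)) = Re X.
  apply: eq_Rintegral => t _; rewrite kernE cexp_real cE /=; ring.
have hR := congr1 Re h1; have hI := congr1 Im h1.
rewrite !cE /= in hR hI.
have p0 : 0 < e ^+ 2 + tau ^+ 2 by rewrite ltr_pwDl ?exprn_gt0 ?sqr_ge0.
apply: (mulfI (lt0r_neq0 p0)).
rewrite [RHS]mulrC divfK ?lt0r_neq0//.
transitivity (e * (e * Re X - tau * Im X) + tau * (e * Im X + tau * Re X)); first ring.
by rewrite hR hI mulr1 mulr0 addr0.
Qed.

End Fourier.

(** * An inequality of Parseval type *)

Section Parseval.
Context {R : realType}.
Notation mu := (@lebesgue_measure R).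
Notation T := (measurableTypeR R).
Notation half := (`[0%R, +oo[%classic : set R).

Lemma prim_mul (F G f g : R -> R) a b : locint f -> locint g ->
  (forall t, 0 <= t -> F t = a + prim f t) ->
  (forall t, 0 <= t -> G t = b + prim g t) ->
  forall t, 0 <= t -> F t * G t = a * b + prim (fun s => f s * G s + g s * F s) t.
Proof.
move=> fi gi FE GE t t0.
have pf := locintM fi (cont0_prim gi); have pg := locintM gi (cont0_prim fi).
rewrite (@eq_prim _ _ (fun s => (b * f s + a * g s) +
    (f s * prim g s + g s * prim f s))); last first.
  by move=> s /andP[s0 _]; rewrite FE// GE//; ring.
have l1 := locintZ b fi; have l2 := locintZ a gi.
have e1 := primD t (locintD l1 l2) (locintD pf pg).
have e2 := primD t l1 l2.
have e3 := primM t fi gi.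
by rewrite e1 e2 -e3 FE// GE// (primZ _ _ fi) (primZ _ _ gi); ring.
Qed.

Lemma Rintegral_dominated_cvg (D : set R) (f_ : nat -> R -> R) (f g : R -> R) :
  measurable D -> (forall n, measurable_fun D (f_ n)) -> measurable_fun D f ->
  (forall x, D x -> f_ n x @[n --> \oo] --> f x) -> summable_on D g ->
  (forall n x, D x -> `|f_ n x| <= g x) ->
  summable_on D f /\
  \int[mu]_(x in D) f_ n x @[n --> \oo] --> \int[mu]_(x in D) f x.
Proof.
move=> mD mf_ mf ff gi fg.
have [] := @dominated_convergence _ _ R mu D mD (fun n x => (f_ n x)%:E)
  (fun x => (f x)%:E) (fun x => (g x)%:E).
- by move=> n; apply/measurable_EFinP; exact: mf_.
- exact/measurable_EFinP.
- by apply: aeW => x Dx; apply: cvg_EFin; [exact: nearW|exact: ff].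
- exact: gi.
- by apply: aeW => x n Dx; rewrite lee_fin fg.
move=> fi _ cv; split=> //.
apply/fine_cvg; rewrite /Rintegral fineK; last exact: integrable_fin_num.
exact: cv.
Qed.

(** Abel weight, making products with a bounded function of w integrable. *)
Definition expw (e w : R) : R := expR (- e * `|w|).

Lemma continuous_expw e : continuous (expw e).
Proof.
move=> x; apply: (@continuous_comp _ _ _ (fun w : R => - e * `|w|) expR).
  by apply: cvgM; [exact: cvg_cst|exact: norm_continuous].
exact: continuous_expR.
Qed.

Lemma expw_ge0 e w : 0 <= expw e w.
Proof. exact: expR_ge0. Qed.

Lemma expw_half e w : 0 <= w -> expw e w = expR (- e * w).
Proof. by move=> w0; rewrite /expw ger0_norm. Qed.

Lemma summable_exp e : 0 < e -> summable_on half (fun t => expR (- e * t)).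
Proof.
move=> e0; have [s _] := csum_exp e0.
rewrite [X in summable_on _ X](_ : _ = fun t => complex.Re (cexp ((- e)%:C)%C t))//.
by apply/funext => t; rewrite cexp_real.
Qed.

(** Adding 1 to the cosine makes the even integrand nonnegative, so that its
    integral over the line, finite or not, is twice the one over the
    half-line. *)
Lemma int_expw_cosD (e tau : R) : 0 < e ->
  summable_on setT (fun w => expw e w * (1 + cos (tau * w))) /\
  \int[mu]_w (expw e w * (1 + cos (tau * w))) = 2 * (e^-1 + e / (e ^+ 2 + tau ^+ 2)).
Proof.
move=> e0; pose G w := expw e w * (1 + cos (tau * w)).
have G0 w : 0 <= G w.
  by rewrite mulr_ge0 ?expw_ge0//; have := cos_geN1 (tau * w); lra.
have cG : continuous G.
  move=> x; apply: cvgM; first exact: continuous_expw.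
  by apply: cvgD; [exact: cvg_cst|exact: continuous_cosM].
have eG : G =1 G \o -%R.
  by move=> w; rewrite /G /expw /= normrN mulrN cosN.
have s1 := summable_exp e0.
have s2 : summable_on half (fun t => expR (- e * t) * cos (tau * t)).
  exact: summable_cosM.
have Gh : \int[mu]_(x in half) G x = e^-1 + e / (e ^+ 2 + tau ^+ 2).
  rewrite -(int_exp_cos tau e0).
  have := int_exp_cos 0 e0; rewrite expr0n addr0 => i0.
  have -> : e^-1 = \int[mu]_(t in half) expR (- e * t).
    transitivity (e / e ^+ 2); first by field; exact: lt0r_neq0.
    by rewrite -i0; apply: eq_Rintegral => t _; rewrite mul0r cos0 mulr1.
  rewrite -RintegralD//; apply: eq_Rintegral => t.
  by rewrite inE/= in_itv/= andbT => t0; rewrite /G expw_half// mulrDr mulr1.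
have Gs : summable_on half G.
  apply: eq_integrable (summable_onD _ s1 s2) => // t.
  by rewrite inE/= in_itv/= andbT => t0; rewrite /G expw_half// mulrDr mulr1.
have GhE : (\int[mu]_(x in half) (G x)%:E)%E = (e^-1 + e / (e ^+ 2 + tau ^+ 2))%:E.
  by rewrite -Gh /Rintegral fineK//; exact: integrable_fin_num.
have := ge0_symfun_integralT G0 cG eG.
rewrite -set_itvcy GhE -EFinM => E.
have mG : measurable_fun setT G by exact: continuous_measurable_fun.
split; last by rewrite /Rintegral E.
apply/integrableP; split; first exact/measurable_EFinP.
apply: (@le_lt_trans _ _ (2 * (e^-1 + e / (e ^+ 2 + tau ^+ 2)))%:E); last exact: ltry.
rewrite -E le_eqVlt; apply/orP; left; apply/eqP; apply: eq_integral => x _.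
rewrite (_ : (EFin \o _) x = (G x)%:E)//.
by rewrite gee0_abs// lee_fin.
Qed.

Lemma summable_expw e : 0 < e -> summable_on setT (expw e).
Proof.
move=> e0; have [s _] := int_expw_cosD 0 e0.
have := summable_onZ (2^-1) measurableT s.
apply: eq_integrable => // w _; rewrite /= mul0r cos0; congr EFin; lra.
Qed.

(** The Fourier transform of the Abel weight is the Poisson kernel. *)
Lemma int_expw_cos (e tau : R) : 0 < e ->
  \int[mu]_w (expw e w * cos (tau * w)) = 2 * (e / (e ^+ 2 + tau ^+ 2)).
Proof.
move=> e0; have ws := summable_expw e0.
have cs := summable_cosM tau measurableT ws.
have [_ E0] := int_expw_cosD 0 e0; have [_ E1] := int_expw_cosD tau e0.
have e1 : \int[mu]_w (expw e w * (1 + cos (tau * w))) =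
    \int[mu]_w expw e w + \int[mu]_w (expw e w * cos (tau * w)).
  by rewrite -RintegralD//; apply: eq_Rintegral => w _; rewrite mulrDr mulr1.
have e2 : \int[mu]_w (expw e w * (1 + cos (0 * w))) = 2 * \int[mu]_w expw e w.
  rewrite -RintegralZl//; apply: eq_Rintegral => w _; rewrite mul0r cos0; ring.
have e3 : \int[mu]_w expw e w = 2 * e^-1.
  have : 2 * \int[mu]_w expw e w = 2 * (e^-1 + e / (e ^+ 2 + 0 ^+ 2)) by rewrite -e2 E0.
  have -> : e / (e ^+ 2 + 0 ^+ 2) = e^-1.
    by rewrite expr0n addr0; field; exact: lt0r_neq0.
  by move=> h; apply: (@mulfI _ (2 : R)) => //; rewrite h; ring.
by move: E1; rewrite e1 e3 mulrDr => /addrI.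
Qed.

(** Fubini, applied to h(s) W(w) C(w) k(s, w) with C(w) = int h(t) k(t, w) dt:
    the inner integral over s is again C(w). *)
Lemma fubini_square (h W Ck : R -> R) (k : T * T -> R) B :
  summable_on half h -> summable_on setT W -> measurable_fun setT k ->
  (forall z, `|k z| <= 1) ->
  (forall w, Ck w = \int[mu]_(t in half) (h t * k (t, w))) ->
  measurable_fun setT Ck -> (forall w, `|Ck w| <= B) ->
  let u s := \int[mu]_w (W w * Ck w * k (s, w)) in
  [/\ measurable_fun setT u, summable_on half (fun s => h s * u s),
      summable_on setT (fun w => W w * Ck w ^+ 2) &
      \int[mu]_(s in half) (h s * u s) = \int[mu]_w (W w * Ck w ^+ 2)].
Proof.
move=> hs Ws mk k1 CkE mC CB u.
have WC : summable_on setT (fun w => W w * Ck w).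
  exact: (@summable_onM _ _ _ _ B).
have mu_ : measurable_fun setT u by exact: measurable_Rparam.
have Hs : summable_on setT (h \_ half).
  have := (@integrable_mkcond _ _ _ mu half (EFin \o h) _).1.
  by rewrite restrict_EFin; apply.
have HE (g : R -> R) :
    \int[mu]_t ((h \_ half) t * g t) = \int[mu]_(t in half) (h t * g t).
  rewrite [RHS]Rintegral_mkcond; apply: eq_Rintegral => t _.
  by rewrite !patchE; case: ifP => _; rewrite ?mul0r.
have ks s : summable_on setT (fun w => W w * Ck w * k (s, w)).
  by apply: (@summable_onM _ _ _ _ 1) => //; exact: measurableT_comp.
split=> //.
- apply: (@summable_onM _ _ _ _ (\int[mu]_w `|W w * Ck w|)) => //.
    exact: measurable_funTS.
  move=> s _; apply: (le_trans (le_normr_Rintegral _ (ks s))) => //.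
  apply: le_Rintegral => //; [exact: (integrable_norm (ks s))|exact: (integrable_norm WC)|].
  by move=> w _; rewrite normrM ler_piMr.
- have := @summable_onM _ _ _ _ B measurableT WC mC (fun w _ => CB w).
  by apply: eq_integrable => // w _; rewrite /= expr2 mulrA.
have := Rfubini Hs WC mk k1; rewrite HE => ->.
apply: eq_Rintegral => w _.
by rewrite (HE (fun t => k (t, w))) -CkE expr2 mulrA.
Qed.

Section SquareIntegral.
Variables (h phi : R -> R) (c : R).
Hypothesis hE : forall t, 0 <= t -> h t = c + prim phi t.
Hypotheses (hs : summable_on half h) (phis : summable_on half phi).

Definition cosint (f : R -> R) w := \int[mu]_(t in half) (f t * cos (w * t)).
Definition sinint (f : R -> R) w := \int[mu]_(t in half) (f t * sin (w * t)).

Let H := h \_ half.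

Let Hs : summable_on setT H.
Proof.
have := (@integrable_mkcond _ _ _ mu half (EFin \o h) _).1.
by rewrite restrict_EFin; apply.
Qed.

Let HE (k : R -> R) : \int[mu]_t (H t * k t) = \int[mu]_(t in half) (h t * k t).
Proof.
rewrite [RHS]Rintegral_mkcond; apply: eq_Rintegral => t _.
by rewrite /H !patchE; case: ifP => _; rewrite ?mul0r.
Qed.

Let mcos : measurable_fun setT (fun z : T * T => cos (z.1 * z.2 : R)).
Proof.
apply: (@measurableT_comp _ _ _ _ _ _ (fun x : R => cos x)).
  by apply: continuous_measurable_fun; exact: continuous_cos.
exact: measurable_funM.
Qed.

Let msin : measurable_fun setT (fun z : T * T => sin (z.1 * z.2 : R)).
Proof.
apply: (@measurableT_comp _ _ _ _ _ _ (fun x : R => sin x)).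
  by apply: continuous_measurable_fun; exact: continuous_sin.
exact: measurable_funM.
Qed.

Let cosintE w : cosint h w = \int[mu]_t (H t * cos (w * t)).
Proof. by rewrite HE. Qed.
Let sinintE w : sinint h w = \int[mu]_t (H t * sin (w * t)).
Proof. by rewrite HE. Qed.

Lemma measurable_cosint : measurable_fun setT (cosint h).
Proof.
rewrite (_ : cosint h = fun w => \int[mu]_t (H t * cos (w * t))); last first.
  by apply/funext => w; rewrite cosintE.
apply: (@measurable_Rparam R H (fun z => cos (z.1 * z.2 : R))) => //.
by move=> z; exact: norm_cos_le1.
Qed.

Lemma measurable_sinint : measurable_fun setT (sinint h).
Proof.
rewrite (_ : sinint h = fun w => \int[mu]_t (H t * sin (w * t))); last first.
  by apply/funext => w; rewrite sinintE.
apply: (@measurable_Rparam R H (fun z => sin (z.1 * z.2 : R))) => //.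
by move=> z; exact: norm_sin_le1.
Qed.

Let B := \int[mu]_(t in half) `|h t|.

Let trig_bound (k : R -> R) : summable_on half (fun t => h t * k t) ->
  (forall t, `|k t| <= 1) -> `|\int[mu]_(t in half) (h t * k t)| <= B.
Proof.
move=> ki k1; apply: (le_trans (le_normr_Rintegral _ ki)) => //.
apply: le_Rintegral => //; [exact: summable_norm|exact: summable_norm|].
by move=> t _; rewrite normrM ler_piMr.
Qed.

Let cosint_bound w : `|cosint h w| <= B.
Proof. by apply: trig_bound; [exact: summable_cosM|move=> t; exact: norm_cos_le1]. Qed.
Let sinint_bound w : `|sinint h w| <= B.
Proof. by apply: trig_bound; [exact: summable_sinM|move=> t; exact: norm_sin_le1]. Qed.

Section Weighted.
Variable e : R.
Hypothesis e0 : 0 < e.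

Let W := expw e.
Let Ws : summable_on setT W := summable_expw e0.
Let WCs : summable_on setT (fun w => W w * cosint h w).
Proof.
apply: (@summable_onM _ _ _ _ B) => //; exact: measurable_cosint.
Qed.
Let WSs : summable_on setT (fun w => W w * sinint h w).
Proof.
apply: (@summable_onM _ _ _ _ B) => //; exact: measurable_sinint.
Qed.

(** 2 pi times the Poisson smoothing of h at scale e. *)
Definition smoothed s :=
  \int[mu]_(t in half) (h t * (2 * (e / (e ^+ 2 + (t - s) ^+ 2)))).

Let smoothedE s : smoothed s =
  \int[mu]_w (W w * cosint h w * cos (s * w)) +
  \int[mu]_w (W w * sinint h w * sin (s * w)).
Proof.
pose k (z : T * T) : R := cos ((z.1 - s) * z.2).
have mk : measurable_fun setT k.
  apply: (@measurableT_comp _ _ _ _ _ _ (fun x : R => cos x)).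
    by apply: continuous_measurable_fun; exact: continuous_cos.
  apply: measurable_funM => //; apply: measurable_funB => //.
have := @Rfubini R H W k Hs Ws mk (fun z => norm_cos_le1 _).
rewrite HE /k /=.
rewrite (_ : \int[mu]_(t in half) _ = smoothed s); last first.
  by apply: eq_Rintegral => t _; rewrite int_expw_cos.
move=> ->; rewrite -RintegralD//; [|exact: summable_cosM|exact: summable_sinM].
apply: eq_Rintegral => w _; rewrite -!mulrA -mulrDr; congr (_ * _).
rewrite HE /cosint /sinint -!RintegralZr//; [|exact: summable_sinM|exact: summable_cosM].
rewrite -RintegralD//; last 2 first.
- have := summable_onZ (cos (s * w)) (measurable_itv _) (summable_cosM w (measurable_itv _) hs).
  by apply: eq_integrable => // t _; rewrite /= mulrC.
- have := summable_onZ (sin (s * w)) (measurable_itv _) (summable_sinM w (measurable_itv _) hs).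
  by apply: eq_integrable => // t _; rewrite /= mulrC.
apply: eq_Rintegral => t _; rewrite mulrBl cosB [t * w]mulrC; ring.
Qed.

Lemma measurable_smoothed : measurable_fun setT smoothed.
Proof.
rewrite (_ : smoothed = fun s => \int[mu]_w (W w * cosint h w * cos (s * w)) +
  \int[mu]_w (W w * sinint h w * sin (s * w))); last by apply/funext => s.
apply: measurable_funD.
  apply: (@measurable_Rparam R _ (fun z => cos (z.1 * z.2 : R))) => //.
  by move=> z; exact: norm_cos_le1.
apply: (@measurable_Rparam R _ (fun z => sin (z.1 * z.2 : R))) => //.
by move=> z; exact: norm_sin_le1.
Qed.

Lemma int_smoothed : summable_on half (fun s => h s * smoothed s) /\
  \int[mu]_(s in half) (h s * smoothed s) =
  \int[mu]_w (W w * (cosint h w ^+ 2 + sinint h w ^+ 2)).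
Proof.
have [|m1 i1 q1 e1] := fubini_square hs Ws mcos (fun z => norm_cos_le1 _) _
    measurable_cosint cosint_bound.
  by move=> w; apply: eq_Rintegral => t _; rewrite [t * w]mulrC.
have [|m2 i2 q2 e2] := fubini_square hs Ws msin (fun z => norm_sin_le1 _) _
    measurable_sinint sinint_bound.
  by move=> w; apply: eq_Rintegral => t _; rewrite [t * w]mulrC.
move: i1 e1 i2 e2 => /= i1 e1 i2 e2.
have hE' : (fun s => h s * smoothed s) = fun s =>
    h s * (\int[mu]_w (W w * cosint h w * cos (s * w))) +
    h s * (\int[mu]_w (W w * sinint h w * sin (s * w))).
  by apply/funext => s; rewrite smoothedE mulrDr.
rewrite hE'; split; first exact: (summable_onD _ i1 i2).
rewrite [LHS]RintegralD// e1 e2 -[LHS]RintegralD//.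
by apply: eq_Rintegral => w _; rewrite mulrDr.
Qed.

(** The Poisson kernel is the derivative of an arctangent, and integration by
    parts moves the derivative to h.  The pointwise limit e -> 0 can then be
    taken by dominated convergence, the arctangent being bounded. *)
Lemma smoothed_atan s : smoothed s =
  2 * (c * atan (s / e) - \int[mu]_(t in half) (phi t * atan ((t - s) / e))).
Proof.
pose K t := atan ((t - s) / e); pose K' t := e / (e ^+ 2 + (t - s) ^+ 2).
have den t : 0 < e ^+ 2 + (t - s) ^+ 2.
  by rewrite ltr_pwDl ?exprn_gt0 ?sqr_ge0.
have cl : continuous (fun t : R => (t - s) / e).
  move=> x; apply: cvgM; last exact: cvg_cst.
  by apply: cvgB; [exact: cvg_id|exact: cvg_cst].
have cK : continuous K.
  move=> x; apply: (@continuous_comp _ _ _ (fun t : R => (t - s) / e) (@atan R)).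
    exact: cl.
  exact: continuous_atan.
have cK' : continuous K'.
  move=> x; apply: cvgM; first exact: cvg_cst.
  apply: cvgV; first exact: lt0r_neq0.
  apply: cvgD; first exact: cvg_cst.
  by apply: cvgM; (apply: cvgB; [exact: cvg_id|exact: cvg_cst]).
have dK (x : R) : is_derive x 1 K (K' x).
  have dl : is_derive x 1 (fun t : R => (t - s) / e) (e^-1).
    rewrite (_ : (fun t : R => (t - s) / e) = (fun t => e^-1 * t) - cst (s / e)).
      rewrite -[X in is_derive _ _ _ X]subr0.
      by apply: is_deriveB; exact: is_derive_linear.
    by apply/funext => t; rewrite !fctE /=; ring.
  have := @is_derive1_comp R (@atan R) (fun t : R => (t - s) / e) x _ _
    (is_derive1_atan ((x - s) / e)) dl.
  have -> // : (1 + ((x - s) / e) ^+ 2)^-1 * e^-1 = K' x.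
  rewrite /K'; have e1 := lt0r_neq0 e0; have := lt0r_neq0 (den x) => d1.
  by field; rewrite e1 d1.
have KE := prim_derive dK cK'.
have K'le t : `|K' t| <= e^-1.
  rewrite ger0_norm; last by rewrite divr_ge0 ?ltW.
  rewrite ler_pdivrMr// -(ler_pM2l e0) mulrA divff ?lt0r_neq0// mul1r.
  by rewrite -expr2 lerDl sqr_ge0.
have Kle t : `|K t| <= pi / 2.
  by rewrite ler_norml ltW ?atan_gtNpi2//= ltW// atan_ltpi2.
have s1 : summable_on half (fun t => phi t * K t).
  apply: (@summable_onM _ _ _ _ (pi / 2)) => //.
  by apply: measurable_funTS; apply: continuous_measurable_fun.
have s2 : summable_on half (fun t => h t * K t).
  apply: (@summable_onM _ _ _ _ (pi / 2)) => //.
  by apply: measurable_funTS; apply: continuous_measurable_fun.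
have s3 : summable_on half (fun t => h t * K' t).
  apply: (@summable_onM _ _ _ _ e^-1) => //.
  by apply: measurable_funTS; apply: continuous_measurable_fun.
have s3' : summable_on half (fun t => K' t * h t).
  by apply: eq_integrable s3 => // t _; rewrite /= mulrC.
have P := prim_mul (summable_locint phis) (cont0_locint (cont0_continuous cK')) hE KE.
have := vanish_at_oo P (summable_onD _ s1 s3') s2.
rewrite RintegralD// => V.
rewrite /smoothed.
have -> : \int[mu]_(t in half) (h t * (2 * (e / (e ^+ 2 + (t - s) ^+ 2)))) =
    2 * \int[mu]_(t in half) (K' t * h t).
  by rewrite -RintegralZl//; apply: eq_Rintegral => t _; rewrite /K'; ring.
congr (2 * _).
have K0 : K 0 = - atan (s / e) by rewrite /K sub0r mulNr atanN.
rewrite K0 in V.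
have arith (a b x y : R) : a * - b + (x + y) = 0 -> y = a * b - x.
  by move=> hh; lra.
move: (V (measurable_itv _)); apply: arith.
Qed.

End Weighted.

Let en n : R := n.+1%:R^-1.
Let en0 n : 0 < en n. Proof. by rewrite /en invr_gt0. Qed.

Let c_phi : c + \int[mu]_(t in half) phi t = 0.
Proof. exact: vanish_at_oo hE phis hs. Qed.

Let atan_cvg (x : R) : atan (x / en n) @[n --> \oo] --> pi / 2 * Num.sg x.
Proof.
have cvgp (y : R) : 0 < y -> atan (y / en n) @[n --> \oo] --> pi / 2.
  move=> y0; apply: (cvg_comp (fun n => y / en n) (@atan R) _ (@cvgy_atan R)).
  apply/cvgryPge => A; near=> n; rewrite /en invrK.
  rewrite -ler_pdivrMl//; apply: (@le_trans _ _ n%:R); last by rewrite ler_nat.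
  by near: n; exact: nbhs_infty_ger.
have [x0|x0|->] := ltgtP x 0.
- rewrite ltr0_sg// mulrN1.
  rewrite [X in X @ _ --> _](_ : _ = fun n => - atan (- x / en n)).
    by apply: cvgN; apply: cvgp; rewrite oppr_gt0.
  by apply/funext => n; rewrite mulNr atanN opprK.
- by rewrite gtr0_sg// mulr1; exact: cvgp.
- by rewrite sgr0 mulr0; under eq_fun do rewrite mul0r atan0; exact: cvg_cst.
Unshelve. all: by end_near. Qed.

Let measurable_atan_shift (s e : R) : measurable_fun setT (fun t : R => atan ((t - s) / e)).
Proof.
apply: continuous_measurable_fun => x.
apply: (@continuous_comp _ _ _ (fun t : R => (t - s) / e) (@atan R)).
  apply: cvgM; last exact: cvg_cst.
  by apply: cvgB; [exact: cvg_id|exact: cvg_cst].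
exact: continuous_atan.
Qed.

Let atan_le (x : R) : `|atan x| <= pi / 2.
Proof. by rewrite ler_norml ltW ?atan_gtNpi2//= ltW// atan_ltpi2. Qed.

Let sgint s : 0 < s ->
  \int[mu]_(t in half) (phi t * (pi / 2 * Num.sg (t - s))) = pi / 2 * (c - 2 * h s).
Proof.
move=> s0; have sm : measurable_fun setT (fun t : R => Num.sg (t - s)).
  rewrite (_ : (fun t => _) = fun t : R =>
    if t < s then -1 else if s < t then 1 else 0).
    apply: measurable_fun_ifT => //; first exact: measurable_fun_ltr.
    by apply: measurable_fun_ifT => //; exact: measurable_fun_ltr.
  apply/funext => t; case: ltgtP => [ts|st|->].
  - by rewrite ltr0_sg// subr_lt0.
  - by rewrite gtr0_sg// subr_gt0.
  - by rewrite subrr sgr0.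
pose g t := phi t * Num.sg (t - s).
have gs : summable_on half g.
  apply: (@summable_onM _ _ _ _ 1) => //; first exact: measurable_funTS.
  by move=> x _; rewrite normr_sg; case: (_ == _).
have -> : \int[mu]_(t in half) (phi t * (pi / 2 * Num.sg (t - s))) =
    pi / 2 * \int[mu]_(t in half) g t.
  by rewrite -RintegralZl//; apply: eq_Rintegral => t _; rewrite mulrCA.
congr (_ * _).
have s0' := ltW s0.
have <- : prim g s + \int[mu]_(t in `]s, +oo[) g t = \int[mu]_(t in half) g t.
  by rewrite -Rintegral_tail// addrC subrK.
have -> : \int[mu]_(t in `]s, +oo[) g t = \int[mu]_(t in half) phi t - prim phi s.
  rewrite Rintegral_tail//; apply: eq_Rintegral => t; rewrite inE/= in_itv/= andbT => st.
  by rewrite /g gtr0_sg ?mulr1// subr_gt0.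
have -> : prim g s = - prim phi s.
  rewrite /prim -Rintegral_itv_bndo_bndc; last first.
    apply: summable_onS (summable_locint gs s) => //.
    by apply: subset_itvl; rewrite bnd_simp.
  rewrite -[X in - X]Rintegral_itv_bndo_bndc; last first.
    apply: summable_onS (summable_locint phis s) => //.
    by apply: subset_itvl; rewrite bnd_simp.
  rewrite -mulN1r -RintegralZl//; last first.
    apply: summable_onS (summable_locint phis s) => //.
    by apply: subset_itvl; rewrite bnd_simp.
  apply: eq_Rintegral => t; rewrite inE/= in_itv/= => /andP[_ ts].
  by rewrite /g ltr0_sg ?subr_lt0// mulrN1 mulN1r.
rewrite hE//; move: c_phi; set I := \int[mu]_(t in _) _; set P := prim _ _.
by lra.
Qed.

Let smoothed_cvg s : 0 < s -> smoothed (en n) s @[n --> \oo] --> 2 * pi * h s.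
Proof.
move=> s0.
rewrite [X in X @ _ --> _](_ : _ = fun n => 2 * (c * atan (s / en n) -
   \int[mu]_(t in half) (phi t * atan ((t - s) / en n)))); last first.
  by apply/funext => n; rewrite smoothed_atan.
have -> : 2 * pi * h s = 2 * (c * (pi / 2 * Num.sg s) - pi / 2 * (c - 2 * h s)).
  by rewrite gtr0_sg//; field.
apply: cvgM; first exact: cvg_cst.
apply: cvgB; first by apply: cvgM; [exact: cvg_cst|exact: atan_cvg].
rewrite -sgint//.
have mphi := summable_on_measurable phis.
have [] := @Rintegral_dominated_cvg half (fun n t => phi t * atan ((t - s) / en n))
  (fun t => phi t * (pi / 2 * Num.sg (t - s))) (fun t => pi / 2 * `|phi t|) => //.
- by move=> n; apply: measurable_funM => //; exact: measurable_funTS.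
- apply: (@measurable_fun_cvg _ _ R _ (fun n t => phi t * atan ((t - s) / en n))) => //.
  + by move=> n; apply: measurable_funM => //; exact: measurable_funTS.
  + by move=> t _; apply: cvgM; [exact: cvg_cst|exact: atan_cvg].
- by move=> t _; apply: cvgM; [exact: cvg_cst|exact: atan_cvg].
- by apply: summable_onZ => //; exact: summable_norm.
- by move=> n t _; rewrite normrM mulrC ler_wpM2r.
Qed.

(** By Fubini, the integral of h times its Poisson smoothing at scale e is the
    integral of the squared transform against the weight exp(- e |w|) <= 1.  As
    e tends to 0, the left-hand side tends to 2 pi int h^2. *)
Lemma parseval_le : sqsum h /\
  ((2 * pi * \int[mu]_(t in half) (h t ^+ 2))%:E <=
   \int[mu]_w (cosint h w ^+ 2 + sinint h w ^+ 2)%:E)%E.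
Proof.
pose D : set R := `]0, +oo[%classic.
have Dh : D `<=` half by apply: subset_itvr; rewrite bnd_simp.
have mh := summable_on_measurable hs.
have mD : measurable D by exact: measurable_itv.
pose M := `|c| + \int[mu]_(t in half) `|phi t|.
have hM t : half t -> `|h t| <= M.
  rewrite /= in_itv/= andbT => t0; rewrite hE// (le_trans (ler_normD _ _))// lerD2l.
  rewrite (le_trans (le_normr_Rintegral _ _))//; first exact: summable_locint.
  exact: (@prim_le_half R (fun t => `|phi t|) t (summable_norm phis) (fun t _ => normr_ge0 _)).
have h2 : sqsum h by split=> //; exact: (summable_onM _ hs mh hM).
split=> //.
have hs2 := h2.2.
have lim : \int[mu]_(s in D) (h s * smoothed (en n) s) @[n --> \oo] -->
    \int[mu]_(s in D) (h s * (2 * pi * h s)).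
  have [] := @Rintegral_dominated_cvg D (fun n s => h s * smoothed (en n) s)
    (fun s => h s * (2 * pi * h s)) (fun s => (pi * M) * `|h s|) => //.
  - move=> n; apply: measurable_funM; first exact: (measurable_funS _ Dh mh).
    by apply: measurable_funTS; apply: measurable_smoothed.
  - apply: measurable_funM; first exact: (measurable_funS _ Dh mh).
    by apply: measurable_funM => //; exact: (measurable_funS _ Dh mh).
  - move=> s; rewrite /D /= in_itv/= andbT => s0.
    by apply: cvgM; [exact: cvg_cst|exact: smoothed_cvg].
  - by apply: summable_onZ => //; apply: summable_onS (summable_norm hs).
  - move=> n s Ds; rewrite normrM mulrC ler_wpM2r//.
    rewrite smoothed_atan// normrM ger0_norm//.
    have s1 : summable_on half (fun t => phi t * atan ((t - s) / en n)).
      apply: (@summable_onM _ _ _ _ (pi / 2)) => //.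
      exact: measurable_funTS.
    have -> : pi * M = 2 * (`|c| * (pi / 2) + pi / 2 * \int[mu]_(t in half) `|phi t|).
      by rewrite /M; field.
    rewrite ler_pM2l// (le_trans (ler_normB _ _))// lerD//.
      by rewrite normrM ler_wpM2l.
    rewrite (le_trans (le_normr_Rintegral _ s1))// -RintegralZl//; last first.
      exact: summable_norm.
    apply: le_Rintegral => //; first exact: summable_norm.
      by apply: summable_onZ => //; exact: summable_norm.
    by move=> t _; rewrite normrM mulrC ler_wpM2r.
have DE (f : R -> R) : summable_on half f -> \int[mu]_(s in D) f s = \int[mu]_(s in half) f s.
  by move=> fs; rewrite Rintegral_itv_obnd_cbnd//; exact: summable_onS fs.
have -> : 2 * pi * \int[mu]_(t in half) (h t ^+ 2) =
    \int[mu]_(s in D) (h s * (2 * pi * h s)).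
  rewrite -RintegralZl// -DE; last exact: summable_onZ.
  by apply: eq_Rintegral => t _; ring.
have limE : (\int[mu]_(s in D) (h s * smoothed (en n) s))%:E @[n --> \oo] -->
    (\int[mu]_(s in D) (h s * (2 * pi * h s)))%:E.
  by apply: cvg_EFin; [exact: nearW|exact: lim].
rewrite -(cvg_lim _ limE)//; apply: lime_le; first exact: cvgP limE.
apply: nearW => n; have [i1 i2] := int_smoothed (en0 n).
rewrite DE// i2.
have mC := measurable_cosint; have mS := measurable_sinint.
have m2 : measurable_fun setT (fun w => cosint h w ^+ 2 + sinint h w ^+ 2).
  by apply: measurable_funD; exact: measurable_funM.
have g0 w : 0 <= cosint h w ^+ 2 + sinint h w ^+ 2 by rewrite addr_ge0 ?sqr_ge0.
have ii : summable_on setT (fun w => expw (en n) w * (cosint h w ^+ 2 + sinint h w ^+ 2)).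
  apply: (@summable_onM _ _ _ _ (B ^+ 2 + B ^+ 2)) => //; first exact: summable_expw.
  move=> w _; rewrite ger0_norm// lerD//.
    by rewrite -(real_normK (num_real _)) lerXn2r ?nnegrE ?(le_trans _ (cosint_bound w)).
  by rewrite -(real_normK (num_real _)) lerXn2r ?nnegrE ?(le_trans _ (sinint_bound w)).
rewrite /Rintegral fineK; last exact: integrable_fin_num.
apply: ge0_le_integral => //.
- by move=> w _; rewrite lee_fin mulr_ge0 ?expw_ge0.
- exact: measurable_int ii.
- exact/measurable_EFinP.
- move=> w _; rewrite lee_fin ler_piMl// /expw -expR0 ler_expR mulNr oppr_le0.
  by rewrite mulr_ge0// ltW.
Qed.

End SquareIntegral.
End Parseval.

(** * Stable polynomials and the responses they define *)

Section Factor.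
Context {R : realType}.
Notation C := (complex R).
Notation toC := (map_poly (real_complex R)).

(** Over the complex numbers d is a product of factors proportional to 1 - l x,
    with l the reciprocal of a root; inversion preserves the sign of the real
    part. *)
Lemma res_factor (d : {poly R}) : d`_0 = 1 ->
  (forall x : C, root (toC d) x -> complex.Re x < 0) ->
  exists rs : seq C, [/\ toC d = res_poly rs, size d = (size rs).+1 &
    forall l, l \in rs -> complex.Re l < 0].
Proof.
move=> d0 dr; have [xs E] := closed_field_poly_normal (toC d).
have d1 : d != 0 by apply: contra_eq_neq d0 => ->; rewrite coef0 eq_sym oner_eq0.
have D1 : toC d != 0 by rewrite map_poly_eq0.
have xr x : x \in xs -> complex.Re x < 0.
  move=> xs_x; apply: dr; rewrite E rootZ ?lead_coef_eq0//.
  by rewrite root_prod_XsubC.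
have xn0 x : x \in xs -> x != 0.
  by move=> /xr; apply: contraTneq => ->; rewrite ltxx.
exists (map (@GRing.inv _) xs); split.
- have prodE : \prod_(z <- xs) ('X - z%:P) =
      (\prod_(z <- xs) (- z)) *: res_poly (map (@GRing.inv _) xs).
    rewrite /res_poly big_map.
    elim: xs xn0 {E xr} => [|x s IH] xn0; first by rewrite !big_nil scale1r.
    rewrite !big_cons IH; last by move=> z zs; apply: xn0; rewrite inE zs orbT.
    have x0 : x != 0 by apply: xn0; rewrite inE eqxx.
    rewrite -scalerAr [_ * \prod_(_ <- _) _]mulrC -scalerA; congr (_ *: _).
    rewrite scalerAl; congr (_ * _).
    by rewrite scalerBr scalerA mulNr mulfV// scaleN1r opprK -mul_polyC mulr1 polyCN addrC.
  move: E; rewrite prodE scalerA; set c := _ * _ => E.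
  suff c1 : c = 1 by rewrite E c1 scale1r.
  have := congr1 (fun p : {poly C} => p.[0]) E.
  rewrite /= hornerZ /res_poly horner_prod big1_seq; last first.
    by move=> i _; rewrite hornerD hornerN hornerZ hornerX mulr0 subr0 hornerC.
  by rewrite mulr1 horner_coef0 coef_map d0 /= => <-.
- rewrite size_map -(size_map_poly (real_complex R)) E size_scale ?lead_coef_eq0//.
  exact: size_prod_XsubC.
- move=> l /mapP[x xsx ->]; have := xr _ xsx; have := xn0 _ xsx.
  case: x {xsx} => a b x0 /= a0.
  have ab : 0 < a ^+ 2 + b ^+ 2 by rewrite ltr_pwDl ?sqr_ge0// exprn_even_gt0//= lt_eqF.
  by rewrite pmulr_llt0// invr_gt0.
Qed.

(** Finitely many negative real parts leave room for a common exponential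
    weight. *)
Lemma res_margin (rs : seq C) : (forall l, l \in rs -> complex.Re l < 0) ->
  exists2 sg : R, 0 < sg & forall l, l \in rs -> complex.Re l + sg < 0.
Proof.
elim: rs => [|l rs IH] H; first by exists 1.
have [|sg s0 Hs] := IH; first by move=> k kr; apply: H; rewrite inE kr orbT.
have l0 : complex.Re l < 0 by apply: H; rewrite inE eqxx.
exists (Num.min sg (- complex.Re l / 2)).
  by rewrite lt_min s0 divr_gt0// oppr_gt0.
move=> k; rewrite inE => /orP[/eqP->|kr].
  by have := ge_min (- complex.Re l / 2) sg (- complex.Re l / 2); rewrite lexx orbT; lra.
by have := ge_min sg sg (- complex.Re l / 2); rewrite lexx /=; have := Hs _ kr; lra.
Qed.

End Factor.

Section RealPolynomials.
Context {R : realType}.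
Notation mu := (@lebesgue_measure R).
Notation half := (`[0%R, +oo[%classic : set R).
Notation C := (complex R).
Notation toC := (map_poly (real_complex R)).
Notation emb f := (fun t : R => ((f t)%:C)%C).
Implicit Types (p q : {poly R}) (f g : R -> R).

Lemma rpol_re p f t : rpol p f t = complex.Re (cpol (toC p) (emb f) t).
Proof. by rewrite cpol_emb. Qed.

Lemma rpol_fD p f g t : locint f -> locint g ->
  rpol p (fun s => f s + g s) t = rpol p f t + rpol p g t.
Proof.
move=> fi gi; rewrite !rpol_re -ReD -(cpol_fD _ _ (clocint_emb fi) (clocint_emb gi)).
by congr (complex.Re (cpol _ _ _)); apply/funext => s; rewrite rmorphD.
Qed.

Lemma rpol_fZ p c f t : locint f -> rpol p (fun s => c * f s) t = c * rpol p f t.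
Proof.
move=> fi; rewrite rpol_re.
have -> : emb (fun s => c * f s) = fun s => (c%:C)%C * emb f s.
  by apply/funext => s; rewrite rmorphM.
by rewrite cpol_fZ ?cpol_emb -?rmorphM//; exact: clocint_emb.
Qed.

Lemma rpolD p q f t : rpol (p + q) f t = rpol p f t + rpol q f t.
Proof. by rewrite rpol_re rmorphD cpolD !cpol_emb. Qed.

Lemma rpolC c f t : rpol c%:P f t = c * f t.
Proof. by rewrite rpol_re map_polyC cpol_polyC -rmorphM. Qed.

Lemma rpolXn k f t : rpol 'X^k f t = iter k prim f t.
Proof.
rewrite (@rpolE _ k.+1) ?size_polyXn// big_ord_recr /= big1 ?add0r.
  by rewrite coefXn eqxx mul1r.
by move=> i _; rewrite coefXn ltn_eqF// mul0r.
Qed.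

Lemma rpolMX p f t : locint f -> rpol (p * 'X) f t = prim (rpol p f) t.
Proof.
move=> fi; rewrite mulrC rpolM//.
exact: (rpolXn 1).
Qed.

Lemma eq_rpol p f g t : (forall s, 0 <= s <= t -> f s = g s) -> 0 <= t ->
  rpol p f t = rpol p g t.
Proof.
move=> fg t0; rewrite !rpol_re (@eq_cpol _ _ _ (emb g)) // => s /fg ->//.
Qed.

Lemma prim_zero f : (forall t, 0 <= t -> prim f t = 0) -> prim f = fun=> 0.
Proof.
move=> pf; apply/funext => t; have [/prim_lt0 ->//|/pf//] := ltP t 0.
Qed.

Lemma prim_inj_cont f : cont0 f -> f 0 = 0 -> (forall t, 0 <= t -> prim f t = 0) ->
  forall t, 0 <= t -> f t = 0.
Proof.
move=> fc f0 /prim_zero pf t; rewrite le_eqVlt => /predU1P[<-//|t0].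
have tt : t < t + 1 by rewrite ltrDl.
have [||dv E] := @continuous_FTC1 R f (BLeft 0) t (t + 1) tt (cont0_locint fc (t + 1)).
- exact: t0.
- have := fc (t + 1); rewrite continuous_within_itvP ?addr_gt0// => -[cf _ _].
  by apply: cf; rewrite in_itv/= t0 ltrDl ltr01.
move: E; rewrite -[fun y => _]/(prim f) pf => <-.
by rewrite derive1_cst.
Qed.

(** Lebesgue differentiation, applied to the restriction of f to each interval
    [0, n]. *)
Lemma ae_eq0_prim1 f : locint f -> (forall t, 0 <= t -> prim f t = 0) ->
  {ae mu, forall t, 0 <= t -> f t = 0}.
Proof.
move=> fi /prim_zero pf.
have H (n : nat) : {ae mu, forall t, 0 <= t <= n%:R -> f t = 0}.
  pose D := `[0%R, n%:R]%classic : set R; pose g := f \_ D.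
  have gi : mu.-integrable setT (EFin \o g).
    have := (@integrable_mkcond _ _ _ mu D (EFin \o f) (measurable_itv _)).1.
    by rewrite restrict_EFin; apply; exact: fi.
  have gl := integrable_locally (measurable_itv _) (fi n%:R).
  have gy (y : itv_bound R) : mu.-integrable [set` Interval (BLeft 0) y] (EFin \o g).
    exact: integrableS gi.
  have n0 : {ae mu, forall t : R, t != 0}.
    exists [set (0 : R)]; split => //; first exact: lebesgue_measure_set1.
    by move=> t /= /negP; rewrite negbK => /eqP.
  have := FTC1 (fun y => gy (BRight y)) gl.
  move=> H; apply: filterS2 n0 H; first exact: (ae_filter_ringOfSetsType mu).
  move=> t tn0 /= H /andP[t0 tn].
  have t1 : 0 < t by rewrite lt_neqAle eq_sym tn0.
  have [] := H _; first exact: t1.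
  rewrite (_ : (fun x : R => _) = fun=> 0); last first.
    apply/funext => x; rewrite -[RHS](congr1 (@^~ (Num.min x n%:R)) pf) /prim /g.
    rewrite [LHS]Rintegral_mkcond [RHS]Rintegral_mkcond; congr Rintegral.
    apply/funext => z; rewrite !patchE !mem_setE /= !in_itv /= le_min.
    by case: (0 <= z) => //=; case: (z <= x) => //=; case: (_ <= _).
  rewrite derive1_cst => _; rewrite /g patchE mem_setE /= in_itv/= t0 tn.
  exact: esym.
have := ae_foralln H; apply: filterS => t /= Ht t0.
have [n tn] : exists n : nat, t <= n%:R.
  by exists (Num.truncn t).+1; rewrite ltW// truncnS_gt.
by apply: (Ht n); rewrite t0.
Qed.

Lemma iter_prim_inj k f : locint f -> (forall t, 0 <= t -> iter k.+1 prim f t = 0) ->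
  forall t, 0 <= t -> prim f t = 0.
Proof.
move=> fi; elim: k => [//|k IH] H; apply: IH.
apply: prim_inj_cont => //; last by rewrite /= prim0.
by apply: cont0_prim; exact: locint_iter.
Qed.

(** All integrals but the innermost have continuous integrands, where
    injectivity holds everywhere; only the last step is up to a null set. *)
Lemma ae_eq0_prim k f : locint f -> (forall t, 0 <= t -> iter k prim f t = 0) ->
  {ae mu, forall t, 0 <= t -> f t = 0}.
Proof.
move=> fi; case: k => [H|k H]; first exact: aeW.
by apply: ae_eq0_prim1 => //; exact: (iter_prim_inj fi H).
Qed.

End RealPolynomials.

Section Gain.
Context {R : realType}.
Notation mu := (@lebesgue_measure R).
Notation half := (`[0%R, +oo[%classic : set R).
Notation C := (complex R).
Notation toC := (map_poly (real_complex R)).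
Notation emb f := (fun t : R => ((f t)%:C)%C).
Implicit Types (p : {poly R}) (f g : R -> R).

(** The roots are values of x = 1 / s, hence reciprocals of eigenvalues; the
    normalization at 0 makes d(J) a product of resolvents. *)
Definition stable_poly (d : {poly R}) :=
  d`_0 = 1 /\ forall x : C, root (toC d) x -> complex.Re x < 0.

Lemma stable_poly_imag d (w : R) : stable_poly d -> (toC d).[(0 +i* w)%C] != 0.
Proof. by move=> [_ dr]; apply/negP => /dr /=; rewrite ltxx. Qed.

Lemma stable_poly_solve d g : stable_poly d -> locint g ->
  exists z, [/\ locint z, forall t, rpol d z t = g t & cont0 g -> cont0 z].
Proof.
move=> [d0 dr] gi; have [rs [E _ _]] := res_factor d0 dr.
have [f [fi fE fc]] := res_exists rs (clocint_emb gi).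
exists (fun t => complex.Re (f t)); split; first exact: fi.1.
- by move=> t; rewrite -Re_cpol E fE.
- by move=> gc; have [] := fc (ccont0_emb gc).
Qed.

Lemma stable_poly_inj d f : stable_poly d -> locint f ->
  (forall t, 0 <= t -> rpol d f t = 0) -> forall t, 0 <= t -> f t = 0.
Proof.
move=> [d0 dr] fi H t t0; have [rs [E _ rsn]] := res_factor d0 dr.
have := @res_inj R rs (emb f) rsn (clocint_emb fi) _ t t0.
rewrite -E => h; have : emb f t = 0 by apply: h => s s0; rewrite cpol_emb H.
by case.
Qed.

(** Both sides of the relation become d(J) applied to functions, since e(J) u =
    e(J) d(J) z, and d(J) is injective.  The power of J remains, as it is
    injective only up to a null set. *)
Lemma rational_response d e k y u z : stable_poly d ->
  locint y -> locint u -> locint z -> (forall t, rpol d z t = u t) ->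
  (forall t, 0 <= t -> rpol ('X^k * d) y t = rpol ('X^k * e) u t) ->
  forall t, 0 <= t -> iter k prim (fun s => y s + -1 * rpol e z s) t = 0.
Proof.
move=> dS yi ui zi zE H.
have ei := locint_rpol e zi.
have wi := locintD yi (locintZ (-1) ei).
apply: (stable_poly_inj dS); first exact: locint_iter.
move=> t t0; have -> : iter k prim (fun s => y s + -1 * rpol e z s) =
    rpol 'X^k (fun s => y s + -1 * rpol e z s).
  by apply/funext => s; rewrite rpolXn.
rewrite -rpolM// mulrC rpol_fD//; last exact: locintZ.
rewrite rpol_fZ// -rpolM// H//.
have -> : 'X^k * d * e = 'X^k * e * d by rewrite mulrAC.
have -> : rpol ('X^k * e * d) z t = rpol ('X^k * e) u t.
  by rewrite (@rpolM R ('X^k * e) d z t zi); congr (rpol _ _ t); apply/funext.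
by rewrite mulN1r subrr.
Qed.

Lemma wsq0_csq (f : R -> C) : csq f <-> wsq 0 f.
Proof.
have E : f = fun t => cexp 0 t * f t.
  apply/funext => t; rewrite (_ : cexp 0 t = 1) ?mul1r//.
  by rewrite /cexp /= !mul0r expR0 cos0 sin0 mulr1 mulr0.
by rewrite /wsq -[(0%:C)%C]/(0 : C) -E.
Qed.

Lemma sqsum_solution d u z : stable_poly d -> sqsum u -> locint z ->
  (forall t, 0 <= t -> rpol d z t = u t) ->
  forall k, (k < size d)%N -> sqsum (iter k prim z).
Proof.
move=> [d0 dr] us zi zE k kd; have [rs [E sd rsn]] := res_factor d0 dr.
have H := @res_wsq R 0 rs (emb z) (emb u) _ (clocint_emb zi)
  (clocint_emb (sqsum_locint us)) _ _ ('X^k) _.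
have [] : csq (cpol 'X^k (emb z)).
  apply: (wsq0_csq _).2; apply: H.
  - by move=> l /rsn; rewrite addr0.
  - by apply: (wsq0_csq _).1; split; [exact: us|exact: (@sqsum0 R)].
  - by move=> t t0; rewrite -E cpol_emb zE.
  - by rewrite size_polyXn -sd.
move=> + _; apply: sqsum_eq => t t0.
by rewrite -(map_polyXn (real_complex R)) cpol_emb /= rpolXn.
Qed.

Lemma sqsum_ae_eq f g : locint f -> sqsum g ->
  {ae mu, forall t, 0 <= t -> f t = g t} ->
  sqsum f /\ \int[mu]_(t in half) (f t ^+ 2) = \int[mu]_(t in half) (g t ^+ 2).
Proof.
move=> fi [mg gs] fg; have mf := locint_measurable_half fi.
have mh : measurable half by exact: measurable_itv.
have mf2 : measurable_fun half (fun t => f t ^+ 2) by exact: measurable_funM.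
have mg2 : measurable_fun half (fun t => g t ^+ 2) by exact: measurable_funM.
have ae2 : ae_eq mu half (fun t => (f t ^+ 2)%:E) (fun t => (g t ^+ 2)%:E).
  apply: filterS fg; first exact: (ae_filter_ringOfSetsType mu).
  by move=> t /= H; rewrite in_itv/= andbT => t0; rewrite H.
have E : (\int[mu]_(t in half) (f t ^+ 2)%:E = \int[mu]_(t in half) (g t ^+ 2)%:E)%E.
  by apply: ae_eq_integral => //; exact/measurable_EFinP.
split; last exact: (congr1 fine E).
split=> //; apply/integrableP; split; first exact/measurable_EFinP.
rewrite (_ : (\int[mu]_(t in half) _)%E = (\int[mu]_(t in half) (f t ^+ 2)%:E)%E).
  have fin : (\int[mu]_(t in half) (g t ^+ 2)%:E)%E \is a fin_num.
    by apply: integrable_fin_num => //; exact: gs.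
  have ge0 : (0 <= \int[mu]_(t in half) (g t ^+ 2)%:E)%E.
    by apply: integral_ge0 => t _; rewrite lee_fin sqr_ge0.
  by rewrite E -(ge0_fin_numE ge0).
by apply: eq_integral => t _; rewrite gee0_abs// lee_fin sqr_ge0.
Qed.

(** The output agrees with e(J) z almost everywhere, the input with d(J) z, and
    [gain_bound] compares the two. *)
Lemma stable_gain (d e : {poly R}) k y u gam : stable_poly d -> (size e <= size d)%N ->
  locint y -> sqsum u ->
  (forall t, 0 <= t -> rpol ('X^k * d) y t = rpol ('X^k * e) u t) ->
  0 <= gam ->
  (forall w : R, sqnorm (toC e).[(0 +i* w)%C] <= gam ^+ 2 * sqnorm (toC d).[(0 +i* w)%C]) ->
  sqsum y /\
  \int[mu]_(t in half) (y t ^+ 2) <= gam ^+ 2 * \int[mu]_(t in half) (u t ^+ 2).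
Proof.
move=> dS sed yi us yu g0 le_ed.
have ui := sqsum_locint us.
have [z [zi zE _]] := stable_poly_solve dS ui.
have zs := sqsum_solution dS us zi (fun t _ => zE t).
have d0 : d != 0.
  by apply: contra_eq_neq dS.1 => ->; rewrite coef0 eq_sym oner_eq0.
have sd : size d = (size d).-1.+1 by rewrite prednK// size_poly_gt0.
have zs' k' : (k' <= (size d).-1)%N -> sqsum (iter k' prim z).
  by move=> kd; apply: zs; rewrite sd ltnS.
have es : sqsum (rpol e z) by apply: (sqsum_rpol zs'); rewrite -sd.
have yae : {ae mu, forall t, 0 <= t -> y t = rpol e z t}.
  have := ae_eq0_prim (locintD yi (locintZ (-1) (locint_rpol e zi)))
    (rational_response dS yi ui zi zE yu).
  apply: filterS; first exact: (ae_filter_ringOfSetsType mu).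
  by move=> t /= H /H; rewrite mulN1r => /subr0_eq.
have [ys ->] := sqsum_ae_eq yi es yae; split => //.
have := gain_bound zs' (d := d) (e := e) _ _ g0 (fun w => stable_poly_imag w dS) le_ed.
rewrite -sd => /(_ (leqnn _) sed).
by have -> : rpol d z = u by apply/funext.
Qed.

End Gain.

(** * Impulse responses and pointwise bounds *)

Section Impulse.
Context {R : realType}.
Notation mu := (@lebesgue_measure R).
Notation half := (`[0%R, +oo[%classic : set R).
Notation C := (complex R).
Notation toC := (map_poly (real_complex R)).
Notation emb f := (fun t : R => ((f t)%:C)%C).
Implicit Types (f g : R -> R).

(** The quadratic polynomial c |-> int (a + c b)^2 has no negative value. *)
Lemma cauchy_schwarz T (a b : R -> R) : cont0 a -> sqsum b ->
  prim (fun s => a s * b s) T ^+ 2 <=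
  prim (fun s => a s ^+ 2) T * prim (fun s => b s ^+ 2) T.
Proof.
move=> ac bs; have bi := sqsum_locint bs.
have b2 : locint (fun s => b s ^+ 2) by exact: summable_locint bs.2.
have a2 := locint_sq ac.
have ab : locint (fun s => a s * b s).
  rewrite (_ : (fun s => a s * b s) = fun s => b s * a s); first exact: locintM.
  by apply/funext => s; rewrite mulrC.
set P := prim (fun s => a s * b s) T; set A := prim _ T; set B := prim _ T.
have quad c : 0 <= A + (2 * c) * P + c ^+ 2 * B.
  have l1 := locintZ (2 * c) ab; have l2 := locintZ (c ^+ 2) b2.
  have e1 := primD T (locintD a2 l1) l2; have e2 := primD T a2 l1.
  rewrite /A /P /B -(primZ (2 * c) T ab) -(primZ (c ^+ 2) T b2) -e2 -e1.
  apply: Rintegral_ge0 => s _.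
  have : 0 <= (a s + c * b s) ^+ 2 by exact: sqr_ge0.
  by rewrite sqrrD exprMn; congr (_ <= _ + _ + _); ring.
have B0 : 0 <= B by apply: Rintegral_ge0 => s _; exact: sqr_ge0.
move: quad B0; clearbody A B P => quad.
(* The minimizing c is - P / B.  If B = 0 the polynomial is affine, and any
   nonzero slope would make it negative somewhere: at the c below it is -1. *)
rewrite le_eqVlt => /predU1P[B0|B0].
  rewrite -B0 mulr0; suff -> : P = 0 by rewrite expr0n.
  apply/eqP; apply: contraT => P0.
  have := quad (- (A + 1) / (2 * P)); rewrite -B0 mulr0 addr0.
  have -> : 2 * (- (A + 1) / (2 * P)) * P = - (A + 1) by field.
  by lra.
have := quad (- P / B).
have -> : A + 2 * (- P / B) * P + (- P / B) ^+ 2 * B = A - P ^+ 2 / B.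
  by field; rewrite gt_eqF.
by rewrite subr_ge0 ler_pdivrMr.
Qed.

Section Resolvent.
Variables (l : C) (rs : seq C) (F : R -> C).
Hypothesis rsn : forall k, k \in l :: rs -> complex.Re k < 0.
Hypothesis Fi : clocint F.
Hypothesis FE : forall t, 0 <= t -> cpol (res_poly (l :: rs)) F t = 1.

Let G := cpol (res_poly rs) F.

Let GE t : 0 <= t -> G t = 1 + cprim (fun s => l * G s) t.
Proof.
move=> t0; have := FE t0; rewrite /res_poly big_cons cpol_factor// -/(res_poly rs) -/G.
by rewrite cprimZ; [move=> <-; rewrite subrK|exact: clocint_cpol].
Qed.

(** G = P(J) F, for P the product over rs, satisfies G = 1 + l J G and therefore
    decays exponentially.  The right-hand side 1 does not decay, so [res_wsq] is
    applied to the factors of P, with G as right-hand side, at the cost of one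
    degree. *)
Lemma resolvent_wsq : exists2 sg : R, 0 < sg &
  forall p : {poly C}, (size p <= (size rs).+1)%N -> wsq sg (cpol p F).
Proof.
have [sg sg0 sgn] := res_margin rsn; exists sg => //.
have Gi : clocint G by exact: clocint_cpol.
have lGi := clocintZ l Gi.
have GS : wsq sg G.
  apply: (@wsq_eq _ sg (fun t => 1 + cprim (fun s => l * G s) t)).
    by move=> t t0; rewrite -GE.
  apply: (@energy_weighted _ sg l 1 (fun=> 0)).
  - by apply: sgn; rewrite inE eqxx.
  - rewrite /wsq (_ : (fun t => _) = fun=> 0); first exact: csq0.
    by apply/funext => t; rewrite mulr0.
  - exact: (ccont0_clocint (@ccont0_cst R 0)).
  - by apply: ccont0D; [exact: ccont0_cst|exact: ccont0_cprim].
  move=> t t0; congr (_ + _); apply: eq_cprim => s /andP[s0 _].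
  by rewrite addr0 GE.
apply: (@res_wsq _ sg rs F G) => //.
by move=> k kr; apply: sgn; rewrite inE kr orbT.
Qed.

Lemma resolvent_csum (p : {poly C}) : (size p <= (size rs).+1)%N -> csum (cpol p F).
Proof. by move=> ps; have [sg sg0 /(_ p ps)] := resolvent_wsq; exact: wsq_csum. Qed.

(** For G as above the transform of G = 1 + l J G gives (i w - l) G^ = 1, and G^
    = P(1 / (i w)) F^. *)
Lemma resolvent_fourier w : w != 0 -> let x := ((0 +i* w)^-1)%C in
  (res_poly (l :: rs)).[x] * fourier w F = x.
Proof.
move=> w0 x.
have sr : (size (res_poly rs) <= (size rs).+1)%N.
  rewrite /res_poly; elim: rs => [|k s IH] /=; first by rewrite big_nil size_poly1.
  rewrite big_cons (leq_trans (size_polyMleq _ _))//.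
  have : (size (1 - k *: 'X : {poly C})%R <= 2)%N.
    rewrite (leq_trans (size_polyD _ _))// geq_max size_poly1 size_polyN.
    by rewrite (leq_trans (size_scale_leq _ _))// size_polyX.
  have arith (a b c : nat) : (a <= 2 -> b <= c.+1 -> (a + b).-1 <= c.+2)%N by lia.
  by move/arith; apply.
have Gs : csum G by exact: resolvent_csum.
have := fourier_prim w (csumZ l Gs) Gs GE.
rewrite (fourierZ w l Gs).
rewrite (@fourier_cpol _ w (size rs) F w0 Fi resolvent_csum _ sr) -/x.
rewrite [in res_poly (_ :: _)]/res_poly big_cons -/(res_poly rs).
rewrite hornerM hornerD hornerN hornerZ hornerX hornerC.
have z0 : (0 +i* w)%C != 0 by rewrite eq_complex /= negb_and w0 orbT.
have -> : (0 +i* w)%C = x^-1 by rewrite /x invrK.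
have x0 : x != 0 by rewrite /x invr_eq0.
move: (res_poly rs).[x] (fourier w F) => P Y H.
have : x * (l * (P * Y)) = P * Y - x by rewrite H; field.
have -> : (1 - l * x) * P * Y = P * Y - x * (l * (P * Y)) by ring.
by move=> ->; rewrite subKr.
Qed.

End Resolvent.

Lemma sqnorm_fourier w (h : R -> R) : summable_on half h ->
  sqnorm (fourier w (emb h)) = cosint h w ^+ 2 + sinint h w ^+ 2.
Proof.
move=> hs; have E t : kern w t * emb h t = (h t * cos (w * t) +i* (-1 * (h t * sin (w * t))))%C.
  by rewrite kernE; apply: complexP; rewrite cE /=; ring.
have ss := summable_sinM w (measurable_itv _) hs.
have ImE : \int[mu]_(t in half) (-1 * (h t * sin (w * t))) = -1 * sinint h w.
  by rewrite RintegralZl.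
rewrite /fourier (_ : (fun t => _) = fun t =>
  (h t * cos (w * t) +i* (-1 * (h t * sin (w * t))))%C); last exact/funext.
by rewrite /cint /= ImE /sqnorm /= mulN1r sqrrN.
Qed.

(** h = f(J) eta with d(J) eta = 1.  Moving f(J) and d(J) across the convolution
    gives the representation of f(J) z; by [fourier_cpol] and
    [resolvent_fourier], the transform of h is x f / d at x = 1 / (i w), which
    is G. *)
Lemma impulse_response (d f : {poly R}) : stable_poly d ->
  (size f < size d)%N ->
  exists h : R -> R, [/\ cont0 h,
    forall z : R -> R, locint z -> forall T : R, 0 <= T ->
      prim (rpol f z) T = convol h (rpol d z) T,
    sqsum h &
    forall G : R -> C, (forall w : R, w != 0 -> let x := ((0 +i* w)^-1)%C in
        G w * (toC d).[x] = x * (toC f).[x]) ->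
      ((2 * pi * \int[mu]_(t in half) (h t ^+ 2))%:E <= \int[mu]_w (sqnorm (G w))%:E)%E].
Proof.
move=> dS fd; have [-> {fd}|f0] := eqVneq f 0.
  exists (fun=> 0); split.
  - exact: (@cont0_cst R 0).
  - move=> z zi T T0.
    rewrite (_ : rpol 0 z = fun=> 0); last first.
      by apply/funext => t; rewrite /rpol size_poly0 big_ord0.
    by apply: eq_prim => s _; rewrite /refl mul0r.
  - exact: (@sqsum0 R).
  move=> G _; rewrite (_ : \int[mu]_(t in half) _ = 0) ?mulr0.
    by apply: integral_ge0 => w _; rewrite lee_fin sqnorm_ge0.
  by rewrite /Rintegral integral0_eq // => t _; rewrite expr0n.
have [eta [etai etaE etac]] := stable_poly_solve dS (cont0_locint (@cont0_cst R 1)).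
have {}etac := etac (@cont0_cst R 1).
have [rs [dE sd rsn]] := res_factor dS.1 dS.2.
case: rs dE sd rsn => [|l rs] dE sd rsn.
  by move: fd f0; rewrite sd ltnS leqn0 size_poly_eq0 => ->.
have sf : (size f <= (size rs).+1)%N by move: fd; rewrite sd.
have Ei : clocint (emb eta) by exact: clocint_emb.
have EE t : 0 <= t -> cpol (res_poly (l :: rs)) (emb eta) t = 1.
  by move=> _; rewrite -dE cpol_emb etaE.
have cs := resolvent_csum rsn Ei EE.
have ps (p : {poly R}) : (size p <= (size rs).+1)%N -> summable_on half (rpol p eta).
  move=> sp; have [] := cs (toC p); first by rewrite size_map_poly.
  by move=> + _; apply: eq_integrable => // t _; rewrite /= cpol_emb.
pose h := rpol f eta.
have hc : cont0 h by exact: cont0_rpol.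
(* f - f(0) d vanishes at 0, so f(J) eta = f(0) d(J) eta + J (...) with d(J) eta
   = 1: this exhibits h as f(0) plus a primitive. *)
pose phi := rpol ((f - f`_0 *: d) %/ 'X) eta.
have hE t : 0 <= t -> h t = f`_0 + prim phi t.
  move=> t0; rewrite /phi -(rpolMX _ _ etai).
  have dvd : 'X %| (f - f`_0 *: d).
    rewrite -['X]subr0 -(polyC0) dvdp_XsubCl /root hornerD hornerN hornerZ.
    by rewrite !horner_coef0 dS.1 mulr1 subrr.
  rewrite (divpK dvd) /h.
  have -> : rpol f eta t = rpol (f`_0 *: d) eta t + rpol (f - f`_0 *: d) eta t.
    by rewrite -rpolD addrC subrK.
  by congr (_ + _); rewrite -mul_polyC rpolM// rpolC etaE mulr1.
have phis : summable_on half phi.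
  apply: ps; rewrite size_divp ?polyX_eq0// size_polyX -subn1.
  have := size_polyD f (- (f`_0 *: d)); rewrite size_polyN.
  have := size_scale_leq (f`_0) d.
  rewrite sd /=; have arith (a b c n : nat) : (a <= n.+1 -> b <= n.+2 -> c <= maxn a b ->
    c - (2 - 1) <= n.+1)%N by lia.
  by move=> h1 h2; exact: arith sf h1 h2.
have hs : summable_on half h by exact: ps.
have [h2 pars] := parseval_le hE hs phis.
exists h; split=> //.
- move=> z zi T T0; rewrite (convol_rpol _ etac (locint_rpol d zi))//.
  transitivity (convol (rpol d eta) (rpol f z) T).
    rewrite /convol.
    transitivity (prim (fun s => refl T (fun=> 1) s * rpol f z s) T).
      by apply: eq_prim => s _; rewrite /refl mul1r.
    by apply: eq_prim => s _; rewrite /refl etaE.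
  rewrite (convol_rpol _ etac (locint_rpol f zi))//.
  apply: eq_convol => // s /andP[s0 _]; by rewrite -!rpolM// mulrC.
move=> G GE; apply: (le_trans pars).
have hG w : w != 0 -> cosint h w ^+ 2 + sinint h w ^+ 2 = sqnorm (G w).
  move=> w0; set x := ((0 +i* w)^-1)%C.
  have eh : emb h = cpol (toC f) (emb eta) by apply/funext => t; rewrite cpol_emb.
  rewrite -sqnorm_fourier// eh.
  rewrite (@fourier_cpol _ w (size rs) _ w0 Ei cs) ?size_map_poly// -/x.
  have fE := resolvent_fourier rsn Ei EE w0; rewrite -dE /= -/x in fE.
  have z0 : (0 +i* w)%C != 0 :> C by rewrite eq_complex /= negb_and w0 orbT.
  have x0 : x != 0 by rewrite /x invr_eq0.
  have D0 : (toC d).[x] != 0 by apply: contra_eq_neq fE => ->; rewrite mul0r eq_sym.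
  congr sqnorm; apply: (mulIf D0); rewrite GE// -/x -mulrA [_ * (toC d).[x]]mulrC.
  by rewrite fE mulrC.
have mC := measurable_cosint hs; have mS := measurable_sinint hs.
have m2 : measurable_fun setT (fun w => cosint h w ^+ 2 + sinint h w ^+ 2).
  by apply: measurable_funD; exact: measurable_funM.
have mG : measurable_fun setT (fun w => sqnorm (G w)).
  rewrite (_ : (fun w => _) = fun w => if w == 0 then sqnorm (G 0) else
      cosint h w ^+ 2 + sinint h w ^+ 2); last first.
    by apply/funext => w; case: eqVneq => [->//|/hG].
  apply: measurable_fun_ifT => //.
  exact: measurable_fun_eqr.
rewrite le_eqVlt; apply/orP; left; apply/eqP; apply: ae_eq_integral => //.
- exact/measurable_EFinP.
- exact/measurable_EFinP.
exists [set (0 : R)]; split => //; first exact: lebesgue_measure_set1.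
move=> w /= H; apply: contrapT => /eqP w0; apply: H => _.
by rewrite hG.
Qed.

(** y is J f(J) z almost everywhere and, both being continuous and 0 at 0,
    everywhere; this is the convolution of the impulse response with u. *)
Lemma stable_peak (d e : {poly R}) k (y u : R -> R) (G : R -> C) (K : R) :
  stable_poly d -> (size e <= size d)%N -> e`_0 = 0 ->
  cont0 y -> y 0 = 0 -> sqsum u ->
  (forall t, 0 <= t -> rpol ('X^k * d) y t = rpol ('X^k * e) u t) ->
  (forall w : R, w != 0 -> let x := ((0 +i* w)^-1)%C in
     G w * (toC d).[x] = (toC e).[x]) ->
  (\int[mu]_w (sqnorm (G w))%:E <= K%:E)%E ->
  forall t, 0 <= t -> y t ^+ 2 <= (2 * pi)^-1 * K * \int[mu]_(t in half) (u t ^+ 2).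
Proof.
move=> dS sed e0 yc y0 us yu GE GK.
have ui := sqsum_locint us; have yi := cont0_locint yc.
have [z [zi zE _]] := stable_poly_solve dS ui.
have [f fE] : exists f : {poly R}, e = 'X * f.
  exists (e %/ 'X); rewrite mulrC divpK// -['X]subr0 -(polyC0) dvdp_XsubCl /root.
  by rewrite horner_coef0 e0.
have sfd : (size f < size d)%N.
  have [->|f0] := eqVneq f 0.
    rewrite size_poly0 size_poly_gt0.
    by apply: contra_eq_neq dS.1 => ->; rewrite coef0 eq_sym oner_eq0.
  by move: sed; rewrite fE mulrC size_mulX.
have [h [hc hE hs hG]] := impulse_response dS sfd.
have yE t : 0 <= t -> y t = prim (rpol f z) t.
  have eE : rpol e z = prim (rpol f z).
    by apply/funext => s; rewrite fE mulrC (rpolMX _ _ zi).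
  have fi := locint_rpol f zi.
  have := rational_response dS yi ui zi zE yu; rewrite eE => H.
  move=> t0; apply/eqP; rewrite -subr_eq0 -mulN1r; apply/eqP.
  have wc : cont0 (fun s => y s + -1 * prim (rpol f z) s).
    by apply: cont0D => //; apply: cont0Z; exact: cont0_prim.
  case: (k) H => [|k'] H; first exact: H.
  apply: (prim_inj_cont wc) => //; first by rewrite y0 prim0 mulr0 addr0.
  by apply: iter_prim_inj H; exact: cont0_locint.
have GK' := le_trans (hG G _) GK.
move=> t t0; rewrite yE// hE//.
rewrite (_ : convol h _ t = prim (fun s => refl t h s * u s) t); last first.
  by apply: eq_prim => s _; rewrite zE.
have CS := cauchy_schwarz t (@cont0_refl _ t _ hc) us.
apply: (le_trans CS).
have pi0 : 0 < (2 * pi)^-1 :> R by rewrite invr_gt0 mulr_gt0 ?pi_gt0.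
apply: ler_pM.
- by apply: Rintegral_ge0 => s _; exact: sqr_ge0.
- by apply: Rintegral_ge0 => s _; exact: sqr_ge0.
- have h2i := locint_sq hc.
  have h2c : cont0 (fun s => h s ^+ 2) by exact: cont0M.
  have -> : prim (fun s => refl t h s ^+ 2) t = prim (fun s => h s ^+ 2) t.
    have := prim_refl h2c (s := t) (T := t); rewrite lexx t0 subrr prim0 subr0 => <-//.
  apply: (@le_trans _ _ (\int[mu]_(s in half) h s ^+ 2)).
    by apply: prim_le_half => [|s _]; [exact: hs.2|exact: sqr_ge0].
  rewrite ler_pdivlMl ?mulr_gt0 ?pi_gt0//.
  by rewrite -lee_fin; apply: GK' => w w0 /=; rewrite GE// fE rmorphM /= map_polyX hornerM hornerX.
- by apply: prim_le_half => [|s _]; [exact: us.2|exact: sqr_ge0].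
Qed.

End Impulse.

(** * Descriptor systems as polynomial relations *)

Section SystemPolynomials.
Context {R : realType}.
Notation mu := (@lebesgue_measure R).
Notation half := (`[0%R, +oo[%classic : set R).
Notation C := (complex R).
Notation toC := (map_poly (real_complex R)).

(** Each term of the Leibniz formula is a product of n polynomials of degree at
    most 1. *)
Lemma size_det_linear n (M : 'M[{poly R}]_n) :
  (forall i j, size (M i j) <= 2)%N -> (size (\det M)%R <= n.+1)%N.
Proof.
move=> M2; rewrite /determinant; apply: (leq_trans (size_sum _ _ _)).
apply/bigmax_leqP => s _; rewrite -signr_odd mulr_sign.
have -> (b : bool) (p : {poly R}) : size (if b then - p else p) = size p.
  by case: b; rewrite ?size_polyN.
apply: (leq_trans (size_prod_leq _ _)); rewrite card_ord.
have : (\sum_(i < n) size (M i (s i)) <= \sum_(i < n) 2)%N by exact: leq_sum.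
rewrite big_const_ord iter_addn_0 => h; rewrite leq_subLR.
by move: h; set a := (\sum_(i < n) _)%N; lia.
Qed.

Lemma adj_scale (F : fieldType) n (P : 'M[F]_n) (x : F) : x != 0 -> \det P != 0 ->
  \adj (x *: P) = (\det (x *: P) / x) *: invmx P.
Proof.
move=> x0 P0; have U : P \in unitmx by rewrite unitmxE unitfE.
apply: (can_inj (mulKmx U)); rewrite -scalemxAr mulmxV//.
apply: (scalerI x0); rewrite scalemxAl mul_mx_adj scalerA mulrC divfK//.
by rewrite scalemx1.
Qed.

Section System.
Context (N m : nat) (S : descriptor_system R N m).

Definition pencil_poly : 'M[{poly R}]_N :=
  map_mx polyC (sysE S) - 'X *: map_mx polyC (sysA S).

(** The reversed characteristic polynomial of the pencil, in the variable x = 1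
    / s.  A singular E makes it vanish at 0. *)
Definition den_poly : {poly R} := \det pencil_poly.

Definition num_poly (i : 'I_m) : {poly R} :=
  'X * (map_mx polyC (sysC S) *m \adj pencil_poly *m map_mx polyC (sysB S)) i ord0.

Lemma pencil_polyE i j : pencil_poly i j = (sysE S i j)%:P - 'X * (sysA S i j)%:P.
Proof. by rewrite !mxE. Qed.

Lemma size_pencil_poly i j : (size (pencil_poly i j) <= 2)%N.
Proof.
rewrite pencil_polyE (leq_trans (size_polyD _ _))// geq_max size_polyN.
rewrite (leq_trans (size_polyC_leq1 _))//= mulrC mul_polyC.
by rewrite (leq_trans (size_scale_leq _ _))// size_polyX.
Qed.

Lemma size_num_poly i : (size (num_poly i) <= N.+1)%N.
Proof.
rewrite /num_poly mulrC; set p := _ i ord0.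
suff pN : (size p <= N)%N.
  by rewrite (leq_trans (size_polyMleq _ _))// size_polyX addn2.
rewrite /p mxE; apply: (leq_trans (size_sum _ _ _)); apply/bigmax_leqP => k _.
rewrite !mxE mulrC mul_polyC (leq_trans (size_scale_leq _ _))//.
apply: (leq_trans (size_sum _ _ _)); apply/bigmax_leqP => l _.
rewrite !mxE mul_polyC (leq_trans (size_scale_leq _ _))//.
rewrite /cofactor -signr_odd mulr_sign.
have -> (b : bool) (q : {poly R}) : size (if b then - q else q) = size q.
  by case: b; rewrite ?size_polyN.
apply: (leq_trans (size_det_linear _)); last by rewrite prednK//; case: (N) k => [[]|].
by move=> a b; rewrite !mxE -pencil_polyE size_pencil_poly.
Qed.

Definition cpencil (x : C) : 'M[C]_N := complex_mx (sysE S) - x *: complex_mx (sysA S).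

Local Notation evalC x := (horner_eval (x : C) \o toC).

Lemma horner_pencil (x : C) : map_mx (evalC x) pencil_poly = cpencil x.
Proof.
apply/matrixP => i j; rewrite !mxE /= /horner_eval rmorphB rmorphM /= !map_polyC map_polyX.
by rewrite hornerD hornerN hornerM hornerX !hornerC.
Qed.

Lemma horner_den (x : C) : (toC den_poly).[x] = \det (cpencil x).
Proof. by rewrite -horner_pencil det_map_mx. Qed.

Lemma horner_num i (x : C) : (toC (num_poly i)).[x] =
  x * (complex_mx (sysC S) *m \adj (cpencil x) *m complex_mx (sysB S)) i ord0.
Proof.
have CE (a b : nat) (M : 'M[R]_(a, b)) : map_mx (evalC x) (map_mx polyC M) = complex_mx M.
  by apply/matrixP => k l; rewrite !mxE /= map_polyC /horner_eval hornerC.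
rewrite -horner_pencil -!CE -map_mx_adj -!map_mxM mxE /= /horner_eval.
rewrite /num_poly; set p := (_ *m _) i ord0.
by rewrite (_ : toC ('X * p) = 'X * toC p) ?hornerM ?hornerX// rmorphM /= map_polyX.
Qed.

Lemma cpencil_pencil (x : C) : x != 0 -> cpencil x = x *: pencil S x^-1.
Proof.
by move=> x0; rewrite /cpencil /pencil scalerBr scalerA mulfV// scale1r.
Qed.

Lemma transfer_poly i (x : C) : x != 0 -> \det (pencil S x^-1) != 0 ->
  transfer S x^-1 i ord0 * (toC den_poly).[x] = (toC (num_poly i)).[x].
Proof.
move=> x0 P0; rewrite horner_num horner_den cpencil_pencil//.
set P := pencil S x^-1.
rewrite (adj_scale x0 P0) /transfer -/P -scalemxAr -scalemxAl [in RHS]mxE.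
move: (_ i ord0) (\det _) => h D.
by rewrite mulrA mulrCA mulfV// mulr1 mulrC.
Qed.

Hypothesis stS : stable_system S.

Lemma stable_det (x : C) : 0 <= complex.Re x -> \det (pencil S x) != 0.
Proof. by move=> x0; apply: contraTneq x0 => /stS; rewrite ltNge. Qed.

Lemma sysA_unit : sysA S \in unitmx.
Proof.
have := @stable_det 0 (lexx 0).
rewrite /pencil scale0r sub0r -scaleN1r detZ mulf_eq0 negb_or => /andP[_].
by rewrite det_map_mx fmorph_eq0 unitmxE unitfE.
Qed.

(** The leading coefficient is det (- A), and A is invertible because 0 is not
    an eigenvalue: up to that factor, this is the characteristic polynomial of
    A^-1 E. *)
Lemma size_den_poly : size den_poly = N.+1.
Proof.
have AU := sysA_unit.
have E : pencil_poly = map_mx polyC (- sysA S) *m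
    char_poly_mx (invmx (sysA S) *m sysE S).
  rewrite /char_poly_mx mulmxBr -map_mxM mulNmx mulmxA mulmxV// mul1mx.
  rewrite mul_mx_scalar /pencil_poly !map_mxN scalerN opprK.
  by rewrite addrC.
rewrite /den_poly E det_mulmx det_map_mx mul_polyC size_scale ?size_char_poly//.
by rewrite -scaleN1r detZ mulf_neq0 ?expf_neq0 ?oppr_eq0 ?oner_eq0// -unitfE -unitmxE.
Qed.

Lemma den_poly_neq0 : den_poly != 0.
Proof. by rewrite -size_poly_gt0 size_den_poly. Qed.

Lemma den_poly_root (x : C) : x != 0 -> root (toC den_poly) x -> complex.Re x < 0.
Proof.
move=> x0; rewrite /root horner_den cpencil_pencil// detZ mulf_eq0 expf_eq0.
rewrite (negPf x0) andbF /= => /eqP /stS.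
case: x x0 => a b x0 /= a0.
have ab : 0 < a ^+ 2 + b ^+ 2.
  rewrite lt_def addr_ge0 ?sqr_ge0// andbT; apply: contra x0 => /eqP e.
  by have [-> ->] := sumsq_le0 (eq_ind_r (fun z => z <= 0) (lexx 0) e).
by move: a0; rewrite pmulr_llt0// invr_gt0.
Qed.

Lemma transfer_imag i (w : R) : w != 0 -> let x := ((0 +i* w)^-1)%C in
  transfer S (0 +i* w)%C i ord0 * (toC den_poly).[x] = (toC (num_poly i)).[x].
Proof.
move=> w0 x; have z0 : (0 +i* w)%C != 0 :> C by rewrite eq_complex /= negb_and w0 orbT.
have := @transfer_poly i x; rewrite /x invrK; apply; first by rewrite invr_eq0.
exact: stable_det.
Qed.

End System.

Implicit Types (p q : {poly R}) (f g u : R -> R).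

Lemma rpol_sum I (r : seq I) (F : I -> {poly R}) f t :
  rpol (\sum_(i <- r) F i) f t = \sum_(i <- r) rpol (F i) f t.
Proof.
elim: r => [|i r IH]; first by rewrite !big_nil /rpol size_poly0 big_ord0.
by rewrite !big_cons rpolD IH.
Qed.

Lemma rpol_fsum n (F : 'I_n -> R -> R) p t : (forall i, locint (F i)) ->
  rpol p (fun s => \sum_(i < n) F i s) t = \sum_(i < n) rpol p (F i) t.
Proof.
elim: n F => [|n IH] F Fi.
  rewrite big_ord0 (_ : (fun s => _) = fun s => 0 * (0 : R)); last first.
    by apply/funext => s; rewrite big_ord0 mulr0.
  by rewrite rpol_fZ ?mul0r//; exact: (cont0_locint (@cont0_cst R 0)).
rewrite big_ord_recl -IH// -rpol_fD//; last by have [] := sum_locint (fun i => Fi (lift ord0 i)).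
by congr (rpol p _ t); apply/funext => s; rewrite big_ord_recl.
Qed.

Section Solution.
Context (N m : nat) (S : descriptor_system R N m).
Variables (u : R -> R) (v : R -> 'cV[R]_N) (w : R -> 'cV[R]_m).
Hypothesis sol : is_solution S u v w.
Hypothesis ui : locint u.

Let V k t := v t k ord0.

Lemma solution_cont0 k : cont0 (V k).
Proof.
have [_ vc _ _] := sol => t.
by apply: continuous_subspaceW (vc k); apply: subset_itvl; rewrite bnd_simp.
Qed.

Let Vi k : locint (V k).
Proof. by apply: cont0_locint; exact: solution_cont0. Qed.

(** The differential-algebraic equation, integrated once; E v vanishes at 0, and
    the equation in the derivative may fail on a null set. *)
Lemma solution_row k t : 0 <= t ->
  \sum_(l < N) rpol (pencil_poly S k l) (V l) t = rpol ((sysB S k ord0)%:P * 'X) u t.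
Proof.
move=> t0; have [v0 _ [Ev' AC ae] _] := sol.
have Ai : forall l, locint (fun s => sysA S k l * V l s) by move=> l; exact: locintZ.
have [As Asum] := sum_locint Ai.
have Bi := locintZ (sysB S k ord0) ui.
have E1 : \sum_(l < N) sysE S k l * V l t =
    \sum_(l < N) prim (fun s => sysA S k l * V l s) t + prim (fun s => sysB S k ord0 * u s) t.
  rewrite -Asum -(primD t As Bi).
  have [Ei] := AC k t t0; rewrite v0 mulmx0 [X in _ = X + _]mxE add0r mxE => ->.
  rewrite /prim /Rintegral; congr fine; apply: ae_eq_integral => //.
  - by case/integrableP : Ei.
  - by case/integrableP : (locintD As Bi t).
  apply: filterS ae; first exact: (ae_filter_ringOfSetsType mu).
  move=> s /= H; rewrite in_itv/= => /andP[s0 _]; rewrite H// !mxE.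
  by rewrite mulrC.
rewrite rpolMX// (_ : rpol _ u = fun s => sysB S k ord0 * u s); last first.
  by apply/funext => s; rewrite rpolC.
have -> : \sum_(l < N) rpol (pencil_poly S k l) (V l) t =
    \sum_(l < N) sysE S k l * V l t - \sum_(l < N) prim (fun s => sysA S k l * V l s) t.
  rewrite -sumrB; apply: eq_bigr => l _.
  rewrite pencil_polyE (_ : _ - _ = (sysE S k l)%:P + (- sysA S k l)%:P * 'X); last first.
    by rewrite polyCN mulNr mulrC.
  rewrite rpolD rpolC rpolMX//; congr (_ + _); rewrite -[RHS]mulN1r -primZ//.
  by congr (prim _ t); apply/funext => s; rewrite rpolC mulN1r mulNr.
by rewrite E1 addrC addKr.
Qed.

(** Cramer's rule over polynomials in J. *)
Lemma solution_state j t : 0 <= t ->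
  rpol (den_poly S) (V j) t =
  rpol (\sum_(k < N) \adj (pencil_poly S) j k * ((sysB S k ord0)%:P * 'X)) u t.
Proof.
move=> t0; rewrite [RHS]rpol_sum.
have -> : \sum_(k < N) rpol (\adj (pencil_poly S) j k * ((sysB S k ord0)%:P * 'X)) u t =
    \sum_(k < N) \sum_(l < N) rpol (\adj (pencil_poly S) j k * pencil_poly S k l) (V l) t.
  apply: eq_bigr => k _; rewrite rpolM//.
  rewrite (@eq_rpol _ _ _ (fun s => \sum_(l < N) rpol (pencil_poly S k l) (V l) s))//.
    rewrite rpol_fsum; last by move=> l; exact: locint_rpol.
    by apply: eq_bigr => l _; rewrite rpolM.
  by move=> s /andP[s0 _]; rewrite solution_row.
rewrite exchange_big /=.
transitivity (\sum_(l < N)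
    rpol (\sum_(k < N) \adj (pencil_poly S) j k * pencil_poly S k l) (V l) t); last first.
  by apply: eq_bigr => l _; rewrite rpol_sum.
have adjE l : \sum_(k < N) \adj (pencil_poly S) j k * pencil_poly S k l =
    den_poly S *+ (j == l).
  have /matrixP /(_ j l) := mul_adj_mx (pencil_poly S).
  by rewrite mxE => ->; rewrite mxE.
under eq_bigr do rewrite adjE.
rewrite (bigD1 j)//= eqxx mulr1n big1 ?addr0// => l lj.
by rewrite eq_sym (negPf lj) mulr0n /rpol size_poly0 big_ord0.
Qed.

Definition output i t := (sysC S *m v t) i ord0.

Lemma outputE i t : 0 <= t -> w t i ord0 = output i t.
Proof. by move=> t0; have [_ _ _ ->] := sol. Qed.

Let output_sum i : output i = fun t => \sum_(j < N) sysC S i j * V j t.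
Proof. by apply/funext => t; rewrite /output mxE. Qed.

Lemma output_cont0 i : cont0 (output i).
Proof. by rewrite output_sum; apply: sum_cont0 => j; apply: cont0Z; exact: solution_cont0. Qed.

Lemma output0 i : output i 0 = 0.
Proof. by have [v0 _ _ _] := sol; rewrite /output v0 mulmx0 mxE. Qed.

Lemma output_rpol i t : 0 <= t ->
  rpol (den_poly S) (output i) t = rpol (num_poly S i) u t.
Proof.
move=> t0; rewrite output_sum rpol_fsum; last by move=> j; exact: locintZ.
have -> : num_poly S i = \sum_(j < N) (sysC S i j)%:P *
    \sum_(k < N) \adj (pencil_poly S) j k * ((sysB S k ord0)%:P * 'X).
  rewrite /num_poly -mulmxA mxE mulr_sumr; apply: eq_bigr => j _.
  rewrite [in LHS]mxE mulrCA; congr (_ * _); rewrite mxE mulr_sumr; apply: eq_bigr => k _.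
  by rewrite mulrCA; congr (_ * _); rewrite mxE mulrC.
rewrite rpol_sum; apply: eq_bigr => j _.
rewrite rpol_fZ// rpolM// rpolC; congr (_ * _); exact: solution_state.
Qed.

End Solution.
End SystemPolynomials.

(** * Cancellation of poles forced by finite norms *)

Section Component.
Context {R : realType}.
Notation mu := (@lebesgue_measure R).
Notation half := (`[0%R, +oo[%classic : set R).
Notation C := (complex R).
Notation toC := (map_poly (real_complex R)).
Implicit Types (p d e : {poly R}).

(** The integral of a nonnegative function is a supremum over the simple
    functions below it, hence monotone even without measurability. *)
Lemma ge0_le_integralT (f g : R -> \bar R) : (forall x, 0 <= f x)%E ->
  (forall x, f x <= g x)%E -> (\int[mu]_x f x <= \int[mu]_x g x)%E.
Proof.
move=> f0 fg; have g0 x : (0 <= g x)%E by exact: le_trans (f0 x) (fg x).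
rewrite !ge0_integralTE//; apply: le_ereal_sup => _ [h hf <-].
by exists h => // x; exact: le_trans (hf x) (fg x).
Qed.

Lemma poly_valuation p : p != 0 -> exists k p0, p = 'X^k * p0 /\ p0`_0 != 0.
Proof.
move=> p0; have [k [q q0 E]] := multiplicity_XsubC p 0.
exists k, q; rewrite p0 /= in q0; split; last by rewrite -horner_coef0.
by rewrite E subr0 mulrC.
Qed.

Definition sqnorm_imag p (s : R) : R := sqnorm (toC p).[(0 +i* s)%C].

Lemma sqnormXn (z : C) k : sqnorm (z ^+ k) = sqnorm z ^+ k.
Proof.
elim: k => [|k IH]; first by rewrite !expr0 /sqnorm /= expr1n expr0n addr0.
by rewrite !exprS sqnormM IH.
Qed.

Lemma sqnorm_imagM p q s : sqnorm_imag (p * q) s = sqnorm_imag p s * sqnorm_imag q s.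
Proof. by rewrite /sqnorm_imag rmorphM hornerM sqnormM. Qed.

Lemma sqnorm_imagXn k s : sqnorm_imag 'X^k s = (s ^+ 2) ^+ k.
Proof.
rewrite /sqnorm_imag (map_polyXn (real_complex R)) hornerXn sqnormXn; congr (_ ^+ k).
by rewrite /sqnorm /= expr0n add0r.
Qed.

Lemma sqnorm_imag0 p : sqnorm_imag p 0 = p`_0 ^+ 2.
Proof.
rewrite /sqnorm_imag -[(0 +i* 0)%C]/(0 : C) horner_coef0 coef_map /sqnorm /=.
by rewrite expr0n addr0.
Qed.

Lemma sqnorm_imag_ge0 p s : 0 <= sqnorm_imag p s. Proof. exact: sqnorm_ge0. Qed.

Lemma continuous_sqnorm_imag p : continuous (sqnorm_imag p).
Proof.
have H : continuous (fun s : R => complex.Re (toC p).[(0 +i* s)%C]) /\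
         continuous (fun s : R => complex.Im (toC p).[(0 +i* s)%C]).
  elim/poly_ind: p => [|p c [IHr IHi]].
    by split => x; rewrite (_ : (fun s : R => _) = fun=> 0); try exact: cvg_cst;
      apply/funext => s; rewrite rmorph0 horner0.
  have E (s : R) : (toC (p * 'X + c%:P)).[(0 +i* s)%C] =
      (toC p).[(0 +i* s)%C] * (0 +i* s)%C + (c%:C)%C.
    by rewrite rmorphD rmorphM /= map_polyX map_polyC hornerMXaddC.
  split => x.
    rewrite (_ : (fun s : R => _) = fun s =>
        - (complex.Im (toC p).[(0 +i* s)%C] * s) + c).
      by apply: cvgD; [apply: cvgN; apply: cvgM; [exact: IHi|exact: cvg_id]|exact: cvg_cst].
    by apply/funext => s; rewrite E !cE /= mulr0 sub0r.
  rewrite (_ : (fun s : R => _) = fun s => complex.Re (toC p).[(0 +i* s)%C] * s).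
    by apply: cvgM; [exact: IHr|exact: cvg_id].
  by apply/funext => s; rewrite E !cE /= mulr0 !addr0.
move=> x; rewrite /sqnorm_imag /sqnorm; apply: cvgD; apply: cvgM; by [apply: H.1|apply: H.2].
Qed.

Lemma ge0_at0 (f : R -> R) : continuous f -> (forall s, s != 0 -> 0 <= f s) -> 0 <= f 0.
Proof.
move=> fc f0; rewrite leNgt; apply/negP => fn.
have := cvgr_lt (f 0) (fc 0) 0 fn; rewrite near_nbhs => -[/= e e0 /(_ (e / 2))].
rewrite /ball /= sub0r normrN ger0_norm ?divr_ge0 ?ltW//.
rewrite ltr_pdivrMr// ltr_pMr// ltr1n => /(_ isT).
by rewrite ltNge f0// mulf_neq0 ?gt_eqF.
Qed.

Lemma invc_imag (w : R) : w != 0 -> ((0 +i* w)^-1)%C = (0 +i* (- w^-1))%C :> C.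
Proof.
move=> w0; have z0 : (0 +i* w)%C != 0 :> C by rewrite eq_complex /= negb_and w0 orbT.
apply: (mulfI z0); rewrite mulfV//; apply: complexP; rewrite cE /=.
  by rewrite mul0r sub0r mulrN opprK mulfV.
by rewrite mul0r mulr0 addr0.
Qed.

Lemma integral_tail_pinfty (W c : R) : 0 < c ->
  (\int[mu]_w ((fun=> c) \_ `[W, +oo[ w)%:E = +oo)%E.
Proof.
move=> c0.
have -> : (fun w => ((fun=> c) \_ `[W, +oo[ w)%:E) = (fun=> c%:E) \_ `[W, +oo[.
  by apply/funext => w; rewrite !patchE; case: ifP.
rewrite -integral_mkcond integral_cst//= lebesgue_measure_itv /= ltry.
by rewrite addye// gt0_muley// lte_fin.
Qed.

Section Cancel.
Variables (d e : {poly R}) (G : R -> C).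
Hypothesis GE : forall w : R, w != 0 -> let x := ((0 +i* w)^-1)%C in
  G w * (toC d).[x] = (toC e).[x].

Lemma sqnorm_imag_response s : s != 0 -> sqnorm (G (- s^-1)) * sqnorm_imag d s = sqnorm_imag e s.
Proof.
move=> s0; have w0 : - s^-1 != 0 by rewrite oppr_eq0 invr_eq0.
by have := GE w0; rewrite /= invc_imag// invrN opprK invrK /sqnorm_imag => <-; rewrite sqnormM.
Qed.

Variables (k : nat) (d0 : {poly R}).
Hypothesis dE : d = 'X^k * d0.

Lemma sqnorm_imag_response_valuation j e0 s : (j <= k)%N -> e = 'X^j * e0 -> s != 0 ->
  sqnorm (G (- s^-1)) * ((s ^+ 2) ^+ (k - j) * sqnorm_imag d0 s) = sqnorm_imag e0 s.
Proof.
move=> jk eE s0; have := sqnorm_imag_response s0; rewrite dE eE !sqnorm_imagM !sqnorm_imagXn -{1}(subnKC jk) exprD.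
have s2 : (s ^+ 2) ^+ j != 0 by rewrite !expf_neq0.
by move=> H; apply: (mulfI s2); rewrite -H; ring.
Qed.

Lemma continuous_XnM_sqnorm_imag j p : continuous (fun s : R => (s ^+ 2) ^+ j * sqnorm_imag p s).
Proof.
move=> x; apply: (@cvgM _ _ _ _ (fun s : R => (s ^+ 2) ^+ j)); last exact: continuous_sqnorm_imag.
exact: (continuous_comp (@exprn_continuous _ 2 x) (@exprn_continuous _ j _)).
Qed.

(** If e were divisible by a smaller power of x than d, then |e / d| would blow
    up at x = 0, that is at infinite frequency.  The bound itself extends to x =
    0 by continuity. *)
Lemma bounded_cancel gam : (forall w, sqnorm (G w) <= gam) ->
  exists e1, e = 'X^k * e1 /\ forall s, sqnorm_imag e1 s <= gam * sqnorm_imag d0 s.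
Proof.
move=> Gg.
have [e1 eE] : exists e1 : {poly R}, e = 'X^k * e1.
  have [->|en0] := eqVneq e 0; first by exists 0; rewrite mulr0.
  have [j [e0 [eE e00]]] := poly_valuation en0.
  have [kj|jk] := leqP k j.
    by exists ('X^(j - k) * e0); rewrite mulrA -exprD subnKC.
  suff : 0 <= - sqnorm_imag e0 0.
    by rewrite sqnorm_imag0 oppr_ge0 leNgt exprn_even_gt0//= e00.
  have := @ge0_at0 (fun s => gam * ((s ^+ 2) ^+ (k - j) * sqnorm_imag d0 s) - sqnorm_imag e0 s).
  rewrite expr0n /= expr0n subn_eq0 leqNgt jk /= mul0r mulr0 sub0r; apply.
    move=> x; apply: cvgB; last exact: continuous_sqnorm_imag.
    by apply: cvgM; [exact: cvg_cst|exact: continuous_XnM_sqnorm_imag].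
  move=> s s0; rewrite subr_ge0 -(sqnorm_imag_response_valuation (ltnW jk) eE s0).
  by rewrite ler_wpM2r// mulr_ge0 ?sqnorm_imag_ge0// exprn_ge0// sqr_ge0.
exists e1; split=> // s; rewrite -subr_ge0.
have c : continuous (fun s => gam * sqnorm_imag d0 s - sqnorm_imag e1 s).
  move=> x; apply: cvgB; last exact: continuous_sqnorm_imag.
  by apply: cvgM; [exact: cvg_cst|exact: continuous_sqnorm_imag].
have H t : t != 0 -> 0 <= gam * sqnorm_imag d0 t - sqnorm_imag e1 t.
  move=> t0; rewrite subr_ge0 -(sqnorm_imag_response_valuation (leqnn k) eE t0).
  by rewrite subnn expr0 mul1r ler_wpM2r// sqnorm_imag_ge0.
have [->|s0] := eqVneq s 0; last exact: H.
exact: (ge0_at0 c H).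
Qed.

(** Otherwise |e / d|^2 would be bounded below by a positive constant at high
    frequencies, that is for x near 0, and its integral would be infinite. *)
Lemma integrable_cancel K : (\int[mu]_w (sqnorm (G w))%:E <= K%:E)%E ->
  exists f, e = 'X^(k.+1) * f.
Proof.
move=> GK; have [->|en0] := eqVneq e 0; first by exists 0; rewrite mulr0.
have [j [e0 [eE e00]]] := poly_valuation en0.
have [kj|jk] := ltnP k j.
  by exists ('X^(j - k.+1) * e0); rewrite mulrA -exprD subnKC.
exfalso; pose phi s := (s ^+ 2) ^+ (k - j) * sqnorm_imag d0 s.
have phi0 s : 0 <= phi s by rewrite mulr_ge0 ?sqnorm_imag_ge0// exprn_ge0// sqr_ge0.
pose a := sqnorm_imag e0 0; pose M := phi 0 + 1.
have a0 : 0 < a by rewrite /a sqnorm_imag0 exprn_even_gt0.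
have M0 : 0 < M by rewrite ltr_wpDl.
have h1 : a / 2 < sqnorm_imag e0 0 by rewrite -/a; lra.
have h2 : phi 0 < M by rewrite /M ltrDl.
have n1 := cvgr_gt _ (@continuous_sqnorm_imag e0 0) _ h1.
have n2 := cvgr_lt _ (@continuous_XnM_sqnorm_imag (k - j) d0 0) _ h2.
have : \forall s \near (0 : R), a / 2 < sqnorm_imag e0 s /\ phi s < M.
  by near=> s; split; near: s; [exact: n1|exact: n2].
move/nbhs_ballP => [eps /= eps0 He].
(* The frequency w corresponds to x = 1 / (i w) = i s with s = - 1 / w, and w >=
   W forces |s| < eps. *)
pose W := eps^-1 + 1.
have W0 : 0 < W by rewrite addr_gt0// invr_gt0.
have low w : W <= w -> a / 2 / M <= sqnorm (G w).
  move=> Ww; have w0 : 0 < w := lt_le_trans W0 Ww.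
  pose s := - w^-1; have s0 : s != 0 by rewrite oppr_eq0 invr_eq0 gt_eqF.
  have [|h3 h4] := He s.
    rewrite /ball /= sub0r normrN /s normrN gtr0_norm ?invr_gt0//.
    rewrite invf_plt ?posrE//; apply: lt_le_trans Ww; by rewrite ltrDl.
  have := sqnorm_imag_response_valuation jk eE s0; rewrite /s invrN invrK opprK -/s -/(phi s) => E.
  rewrite ler_pdivrMr//; apply: (le_trans (ltW h3)); rewrite -E.
  by rewrite ler_wpM2l ?sqnorm_ge0// ltW.
have c0 : 0 < a / 2 / M by rewrite !divr_gt0.
have := @ge0_le_integralT (fun w => ((fun=> a / 2 / M) \_ `[W, +oo[ w)%:E)
  (fun w => (sqnorm (G w))%:E).
rewrite integral_tail_pinfty// => H.
have : (+oo <= K%:E :> \bar R)%E.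
  apply: le_trans GK; apply: H => w; rewrite lee_fin patchE; case: ifP => //.
  - by move=> _; exact: ltW.
  - by rewrite mem_setE /= in_itv /= andbT => /low.
  - by move=> _; exact: sqnorm_ge0.
by rewrite leye_eq.
Unshelve. all: by end_near. Qed.

End Cancel.

Lemma rpolZ c p (f : R -> R) t : rpol (c *: p) f t = c * rpol p f t.
Proof. by rewrite rpol_re map_polyZ cpolZ cpol_emb -rmorphM. Qed.

Section Response.
Variables (d e : {poly R}) (G : R -> C) (y u : R -> R).
Hypothesis GE : forall w : R, w != 0 -> let x := ((0 +i* w)^-1)%C in
  G w * (toC d).[x] = (toC e).[x].
Hypothesis dn0 : d != 0.
Hypothesis dr : forall x : C, x != 0 -> root (toC d) x -> complex.Re x < 0.
Hypothesis sed : (size e <= size d)%N.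
Hypotheses (yc : cont0 y) (y0 : y 0 = 0) (us : sqsum u).
Hypothesis yu : forall t, 0 <= t -> rpol d y t = rpol e u t.

Let normalise : exists k (d0 : {poly R}), [/\ d = 'X^k * d0, d0`_0 != 0 & stable_poly ((d0`_0)^-1 *: d0)].
Proof.
have [k [d0 [dE d00]]] := poly_valuation dn0; exists k, d0; split => //.
split; first by rewrite coefZ mulVf.
move=> x; rewrite map_polyZ /= rootZ; last by rewrite fmorph_eq0 invr_eq0.
move=> xr; apply: dr.
  apply: contraTneq xr => ->; rewrite /root horner_coef0 coef_map /=.
  by rewrite fmorph_eq0.
by rewrite dE rmorphM rootM xr orbT.
Qed.

Let sizeXn k p : p != 0 -> size ('X^k * p) = (k + size p)%N.
Proof. by move=> pn0; rewrite mulrC size_mulXn. Qed.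

Theorem response_gain gam : 0 <= gam -> (forall w, sqnorm (G w) <= gam ^+ 2) ->
  sqsum y /\ \int[mu]_(t in half) (y t ^+ 2) <= gam ^+ 2 * \int[mu]_(t in half) (u t ^+ 2).
Proof.
move=> g0 Gg; have [k [d0 [dE d00 dS]]] := normalise.
have [e1 [eE e1d]] := bounded_cancel GE dE Gg.
pose c := (d0`_0)^-1; have c0 : c != 0 by rewrite invr_eq0.
have d0n0 : d0 != 0 by apply: contra_eq_neq d00 => ->; rewrite coef0 eqxx.
apply: (@stable_gain _ _ (c *: e1) k _ _ _ dS) => //.
- rewrite !size_scale//; have [->|e1n0] := eqVneq e1 0; first by rewrite size_poly0.
  by move: sed; rewrite dE eE !sizeXn// leq_add2l.
- exact: cont0_locint.
- by move=> t t0; rewrite -!scalerAr -dE -eE !rpolZ yu.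
- move=> w; rewrite !map_polyZ !hornerZ !sqnormM mulrCA.
  by rewrite ler_wpM2l ?sqnorm_ge0//; exact: e1d.
Qed.

Theorem response_peak K : (\int[mu]_w (sqnorm (G w))%:E <= K%:E)%E ->
  forall t, 0 <= t -> y t ^+ 2 <= (2 * pi)^-1 * K * \int[mu]_(t in half) (u t ^+ 2).
Proof.
move=> GK; have [k [d0 [dE d00 dS]]] := normalise.
have [f eE] := integrable_cancel GE dE GK.
pose c := (d0`_0)^-1; have c0 : c != 0 by rewrite invr_eq0.
have d0n0 : d0 != 0 by apply: contra_eq_neq d00 => ->; rewrite coef0 eqxx.
have eE' : e = 'X^k * ('X * f) by rewrite eE exprSr mulrA.
apply: (@stable_peak _ _ (c *: ('X * f)) k _ _ G _ dS) => //.
- rewrite !size_scale//; have [->|f0] := eqVneq ('X * f) 0; first by rewrite size_poly0.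
  by move: sed; rewrite dE eE' !sizeXn// leq_add2l.
- by rewrite coefZ coefXM mulr0.
- by move=> t t0; rewrite -!scalerAr -dE -eE' !rpolZ yu.
- move=> w w0 x; rewrite !map_polyZ !hornerZ mulrCA; congr (_ * _).
  have x0 : x ^+ k != 0.
    by rewrite expf_neq0// invr_eq0 eq_complex /= negb_and w0 orbT.
  apply: (mulfI x0); have := GE w0; rewrite /= -/x dE eE'.
  by rewrite (rmorphM (map_poly _) 'X^k d0) (rmorphM (map_poly _) 'X^k ('X * f)) /=
    (map_polyXn (real_complex R)) !hornerM !hornerXn mulrCA.
Qed.

End Response.

End Component.

(** * Orthonormal expansions and norms *)

Section Orthonormal.
Context {R : realType} (q : nat) (Pi : set (Rvec R q)) (rho : Rvec R q -> R).
Context (Phi : nat -> Rvec R q -> R) (I : {fset nat}).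
Hypothesis mPi : measurable Pi.
Hypothesis dens : probability_density Pi rho.
Hypothesis ons : complete_orthonormal_system Pi rho Phi.

Notation nu := (@lebesgue_tuple R q).
Notation m := #|` I|.
Notation b k := (basis_fun Phi (I:=I) k).

Lemma sq_density_integrable f : in_L2rho Pi rho f ->
  nu.-integrable Pi (fun p => (f p ^+ 2 * rho p)%:E).
Proof.
move=> [mf fin]; have [mr r0 _] := dens.
apply/integrableP; split.
  by apply/measurable_EFinP; apply: measurable_funM => //; exact: measurable_funM.
rewrite (_ : (\int[_]_(p in Pi) _)%E = sq_expectation Pi rho f)//.
apply: eq_integral => p; rewrite inE => Pp.
by rewrite gee0_abs// lee_fin mulr_ge0 ?sqr_ge0// r0.
Qed.

(** |f g| <= f^2 + g^2. *)
Lemma product_density_integrable f g : in_L2rho Pi rho f -> in_L2rho Pi rho g ->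
  nu.-integrable Pi (fun p => (f p * g p * rho p)%:E).
Proof.
move=> fL gL; have [mr r0 _] := dens; have [mf _] := fL; have [mg _] := gL.
have fgi := integrableD mPi (sq_density_integrable fL) (sq_density_integrable gL).
apply: le_integrable fgi => //.
  by apply/measurable_EFinP; apply: measurable_funM => //; exact: measurable_funM.
move=> p Pp; rewrite -EFinD /= lee_fin normrM -mulrDl [leRHS]normrM.
apply: ler_wpM2r; first exact: normr_ge0.
rewrite [leRHS]ger0_norm ?addr_ge0 ?sqr_ge0// normrM.
have := sqr_ge0 (`|f p| - `|g p|); have := sqr_ge0 (`|f p| + `|g p|).
rewrite -[f p ^+ 2](real_normK (num_real _)) -[g p ^+ 2](real_normK (num_real _)).
by rewrite sqrrD sqrrB; move: (normr_ge0 (f p)) (normr_ge0 (g p)); nra.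
Qed.

Lemma basis_in_L2 k : in_L2rho Pi rho (b k).
Proof. by have [L2 _ _] := ons; exact: L2. Qed.

Lemma basis_orthonormal k l : inner_L2rho Pi rho (b k) (b l) = (k == l)%:R.
Proof.
have [_ on _] := ons; rewrite on; congr (_%:R); congr nat_of_bool.
by rewrite nth_uniq ?fset_uniq// -cardfE ?card_ord.
Qed.

Lemma sq_expectation_combination (c : 'I_m -> R) :
  sq_expectation Pi rho (fun p => \sum_(k < m) c k * b k p) =
  (\sum_(k < m) c k ^+ 2)%:E.
Proof.
pose F (z : 'I_m * 'I_m) p := ((c z.1 * c z.2)%:E * (b z.1 p * b z.2 p * rho p)%:E)%E.
have Fi z : nu.-integrable Pi (F z).
  by apply: integrableZl => //; apply: product_density_integrable; exact: basis_in_L2.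
rewrite /sq_expectation.
transitivity (\int[nu]_(p in Pi) \sum_(z : 'I_m * 'I_m) F z p)%E.
  apply: eq_integral => p _; rewrite /F.
  under [RHS]eq_bigr do rewrite -EFinM.
  rewrite sumEFin; congr EFin.
  rewrite expr2 big_distrlr /= pair_big /= mulr_suml.
  by apply: eq_bigr => -[k l] _ /=; ring.
rewrite (@integral_sum _ _ _ _ _ mPi _ _ Fi).
have FE z : (\int[nu]_(p in Pi) F z p)%E = (c z.1 * c z.2 * (z.1 == z.2)%:R)%:E.
  have gi := product_density_integrable (basis_in_L2 z.1) (basis_in_L2 z.2).
  rewrite /F integralZl// -basis_orthonormal [RHS]EFinM; congr (_ * _)%E.
  by rewrite /inner_L2rho /expectation_rho /Rintegral fineK//; exact: integrable_fin_num.
under eq_bigr do rewrite FE.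
rewrite sumEFin -(pair_big xpredT xpredT (fun k l => c k * c l * (k == l)%:R)) /=.
congr EFin; apply: eq_bigr => k _.
rewrite (bigD1 k)//= eqxx mulr1 big1 ?addr0 -?expr2// => l lk.
by rewrite eq_sym (negPf lk) mulr0.
Qed.

End Orthonormal.

Section Norms.
Context {R : realType}.
Notation mu := (@lebesgue_measure R).
Notation half := (`[0%R, +oo[%classic : set R).
Notation C := (complex R).

Lemma in_L2time_sqsum (u : R -> R) : in_L2time u ->
  sqsum u /\ L2time_norm u = sqrte (\int[mu]_(t in half) (u t ^+ 2))%:E.
Proof.
move=> [mu_ fin].
have I0 : (0 <= \int[mu]_(t in half) (u t ^+ 2)%:E)%E.
  by apply: integral_ge0 => t _; rewrite lee_fin sqr_ge0.
have Ifin : (\int[mu]_(t in half) (u t ^+ 2)%:E)%E \is a fin_num.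
  rewrite -sqrte_fin_num//; rewrite ge0_fin_numE ?sqrte_ge0//; exact: fin.
split; last by rewrite /L2time_norm /Rintegral fineK.
split => //; apply/integrableP; split.
  by apply/measurable_EFinP; exact: measurable_funM.
rewrite (_ : (\int[mu]_(t in half) _)%E = (\int[mu]_(t in half) (u t ^+ 2)%:E)%E).
  by rewrite -ge0_fin_numE.
by apply: eq_integral => t _; rewrite gee0_abs// lee_fin sqr_ge0.
Qed.

Lemma normc_sqnorm (z : C) : Normc.normc z ^+ 2 = sqnorm z.
Proof. by case: z => a b; rewrite /= sqr_sqrtr ?addr_ge0 ?sqr_ge0. Qed.

Lemma Hinf_normP (G : C -> C) : (Hinf_norm G < +oo)%E ->
  exists2 g : R, 0 <= g & Hinf_norm G = g%:E /\
    forall w : R, sqnorm (G (0 +i* w)%C) <= g ^+ 2.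
Proof.
move=> fin.
have ub w : ((Normc.normc (G (0 +i* w)%C))%:E <= Hinf_norm G)%E.
  by apply: ereal_sup_ubound; exists w.
have n0 (z : C) : 0 <= Normc.normc z by case: z => a b; exact: sqrtr_ge0.
have H0 : (0 <= Hinf_norm G)%E by apply: le_trans (ub 0); rewrite lee_fin.
have Hf : Hinf_norm G \is a fin_num by rewrite ge0_fin_numE.
exists (fine (Hinf_norm G)); first exact: fine_ge0.
split; first by rewrite fineK.
move=> w; rewrite -normc_sqnorm lerXn2r ?nnegrE ?fine_ge0//.
by rewrite -lee_fin fineK.
Qed.

Lemma H2_normP (G : C -> C) : (H2_norm G < +oo)%E ->
  exists K : R, (H2_norm G ^+ 2 = ((2 * pi)^-1 * K)%:E)%E /\
    (\int[mu]_w (sqnorm (G (0 +i* w)%C))%:E <= K%:E)%E.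
Proof.
move=> fin.
have E : (\int[mu]_w (Normc.normc (G (0 +i* w)%C) ^+ 2)%:E =
          \int[mu]_w (sqnorm (G (0 +i* w)%C))%:E)%E.
  by apply: eq_integral => w _; rewrite normc_sqnorm.
have I0 : (0 <= \int[mu]_w (sqnorm (G (0 +i* w)%C))%:E)%E.
  by apply: integral_ge0 => t _; rewrite lee_fin sqnorm_ge0.
have p0 : 0 < (2 * pi)^-1 :> R by rewrite invr_gt0 mulr_gt0 ?pi_gt0.
move: fin; rewrite /H2_norm E.
case: (\int[mu]_w _)%E I0 => [K| |] //.
  rewrite lee_fin => K0 _; exists K; split => //; rewrite sqr_sqrte ?EFinM// -EFinM lee_fin.
  by rewrite mulr_ge0// ltW.
by rewrite gt0_muley ?lte_fin.
Qed.

End Norms.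

Theorem theorem2 (R : realType) (q n r : nat)
    (Pi : set (Rvec R q)) (rho : Rvec R q -> R)
    (Phi : nat -> Rvec R q -> R)
    (S : Rvec R q -> descriptor_system R n 1)
    (I : {fset nat})
    (Sbar : descriptor_system R r #|` I|)
    (u : R -> R)
    (vhat : R -> 'cV[R]_(\sum_(i < #|` I|) n)%N) (what : R -> 'cV[R]_#|` I|)
    (vbar : R -> 'cV[R]_r) (wbar : R -> 'cV[R]_#|` I|) :
  let Shat := galerkin_system Pi rho Phi S I in
  let Hdiff (i : 'I_#|` I|) (s : R[i]) :=
    transfer Shat s i ord0 - transfer Sbar s i ord0 in
  let ydiff (t : R) (p : Rvec R q) :=
    expansion Phi what t p - expansion Phi wbar t p in
  measurable Pi ->
  probability_density Pi rho ->
  complete_orthonormal_system Pi rho Phi ->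
  (forall p, Pi p -> Phi 0%N p = 1) ->
  (forall p, Pi p -> regular_pencil (S p)) ->
  (forall p, Pi p -> stable_system (S p)) ->
  galerkin_expectations_exist Pi rho Phi S I ->
  regular_pencil Shat ->
  regular_pencil Sbar ->
  in_L2time u ->
  is_solution Shat u vhat what ->
  is_solution Sbar u vbar wbar ->
  stable_system Shat ->
  stable_system Sbar ->
  ((forall i, (H2_norm (Hdiff i) < +oo)%E) ->
    (ereal_sup [set L2rho_norm Pi rho (ydiff t) | t in `[0%R, +oo[]
       <= sqrte (\sum_(i < #|` I|) H2_norm (Hdiff i) ^+ 2)
          * L2time_norm u)%E) /\
  ((forall i, (Hinf_norm (Hdiff i) < +oo)%E) ->
    (L2L2_norm Pi rho ydiff
       <= sqrte (\sum_(i < #|` I|) Hinf_norm (Hdiff i) ^+ 2)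
          * L2time_norm u)%E).
Proof.
move=> Shat Hdiff ydiff mPi dens ons _ _ _ _ _ _ uL hsol bsol hst bst.
have [us uE] := in_L2time_sqsum uL; have ui := sqsum_locint us.
pose y i t := output Shat vhat i t + -1 * output Sbar vbar i t.
pose d := den_poly Shat * den_poly Sbar.
pose e i := num_poly Shat i * den_poly Sbar - num_poly Sbar i * den_poly Shat.
pose G i (w : R) := Hdiff i (0 +i* w)%C.
have hc i : cont0 (output Shat vhat i) by exact: (output_cont0 hsol).
have bc i : cont0 (output Sbar vbar i) by exact: (output_cont0 bsol).
have yc i : cont0 (y i).
  have h1 := hc i.
  have h2 := @cont0Z R (-1) _ (bc i).
  exact (@cont0D R _ _ h1 h2).
have y0 i : y i 0 = 0 by rewrite /y (output0 hsol) (output0 bsol) mulr0 addr0.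
have dn0 : d != 0 by rewrite mulf_neq0 ?den_poly_neq0.
have dr (x : R[i]) : x != 0 -> root (map_poly (real_complex R) d) x -> complex.Re x < 0.
  move=> x0; rewrite rmorphM rootM => /orP[]; exact: den_poly_root.
have sed i : (size (e i) <= size d)%N.
  rewrite /d size_mul ?den_poly_neq0// !size_den_poly// addnS /=.
  apply: (leq_trans (size_polyD _ _)); rewrite size_polyN geq_max.
  apply/andP; split; apply: (leq_trans (size_polyMleq _ _));
    rewrite size_den_poly// addnS /=.
    by rewrite leq_add2r; exact: size_num_poly.
  by rewrite addSnnS addnC leq_add2l; exact: size_num_poly.
have yu i t : 0 <= t -> rpol d (y i) t = rpol (e i) u t.
  move=> t0; have hi := cont0_locint (hc i); have bi := cont0_locint (bc i).
  rewrite rpol_fD//; last exact: locintZ.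
  rewrite rpol_fZ//.
  have -> : rpol d (output Shat vhat i) t = rpol (num_poly Shat i * den_poly Sbar) u t.
    rewrite /d mulrC [in RHS]mulrC !rpolM//.
    by apply: eq_rpol => // s /andP[s0 _]; exact: (output_rpol hsol ui).
  have -> : rpol d (output Sbar vbar i) t = rpol (num_poly Sbar i * den_poly Shat) u t.
    rewrite /d [in RHS]mulrC !rpolM//.
    by apply: eq_rpol => // s /andP[s0 _]; exact: (output_rpol bsol ui).
  by rewrite /e rpolD -(rpolZ (-1)) scaleN1r.
have GE i (w : R) : w != 0 -> let x := ((0 +i* w)^-1)%C in
    G i w * (map_poly (real_complex R) d).[x] = (map_poly (real_complex R) (e i)).[x].
  move=> w0 x; have := transfer_imag hst i w0; have := transfer_imag bst i w0.
  rewrite -/x /G /Hdiff /d /e rmorphM rmorphB !rmorphM hornerM hornerD hornerN !hornerM.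
  by move=> <- <-; ring.
have ydE t : 0 <= t -> sq_expectation Pi rho (ydiff t) = (\sum_i y i t ^+ 2)%:E.
  move=> t0; rewrite -(sq_expectation_combination mPi dens ons); congr sq_expectation.
  apply/funext => p; rewrite /ydiff /expansion -sumrB; apply: eq_bigr => i _.
  by rewrite (outputE hsol)// (outputE bsol)// -mulrBl /y mulN1r.
pose U := \int[@lebesgue_measure R]_(t in `[0%R, +oo[) (u t ^+ 2).
have U0 : 0 <= U by apply: Rintegral_ge0 => t _; exact: sqr_ge0.
split=> Hfin.
- have /choice[K HK] := fun i => H2_normP (Hfin i).
  have -> : (\sum_i H2_norm (Hdiff i) ^+ 2)%E = (\sum_i ((2 * pi)^-1 * K i))%:E.
    by rewrite -sumEFin; apply: eq_bigr => i _; exact: (HK i).1.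
  have Kb i := response_peak (GE i) dn0 dr (sed i) (yc i) (y0 i) us (yu i) (HK i).2.
  apply: ub_ereal_sup => _ [t t0 <-]; rewrite /= in_itv/= andbT in t0.
  have K0 : 0 <= \sum_i ((2 * pi)^-1 * K i).
    apply: sumr_ge0 => i _; rewrite -lee_fin -(HK i).1.
    exact: sqre_ge0.
  rewrite uE -sqrteM ?lee_fin// /L2rho_norm ydE// -EFinM lee_sqrt; last first.
    by rewrite lee_fin mulr_ge0.
  rewrite lee_fin mulr_suml; apply: ler_sum => i _; exact: Kb.
- have /choice[g Hg] : forall i, exists g : R, 0 <= g /\ Hinf_norm (Hdiff i) = g%:E /\
      forall w : R, sqnorm (G i w) <= g ^+ 2.
    by move=> i; have [g g0 H] := Hinf_normP (Hfin i); exists g.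
  have -> : (\sum_i Hinf_norm (Hdiff i) ^+ 2)%E = (\sum_i g i ^+ 2)%:E.
    by rewrite -sumEFin; apply: eq_bigr => i _; have [_ [-> _]] := Hg i.
  have gb i := response_gain (GE i) dn0 dr (sed i) (yc i) us (yu i) (Hg i).1 (Hg i).2.2.
  have g0 : 0 <= \sum_i g i ^+ 2 by apply: sumr_ge0 => i _; exact: sqr_ge0.
  rewrite uE -sqrteM ?lee_fin// -EFinM /L2L2_norm lee_sqrt; last first.
    by rewrite lee_fin mulr_ge0.
  rewrite (_ : (\int[_]_(t in _) _)%E =
      (\int[@lebesgue_measure R]_(t in `[0%R, +oo[) \sum_i (y i t ^+ 2)%:E)%E); last first.
    apply: eq_integral => t; rewrite inE/= in_itv/= andbT => t0.
    by rewrite sumEFin -ydE.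
  have ys i : (@lebesgue_measure R).-integrable `[0%R, +oo[ (fun t => (y i t ^+ 2)%:E).
    exact: (gb i).1.2.
  rewrite integral_sum// mulr_suml -sumEFin; apply: lee_sum => i _.
  have := (gb i).2; rewrite -lee_fin; apply: le_trans.
  by rewrite /Rintegral fineK//; exact: integrable_fin_num.
Qed.
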